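(* Let $d\ge 1$, $n\in\mathbb N$ ($n\ge 1$) and $m>1$ be real, and set $\beta=\frac{1}{2+d(m-1)}$ and $B=\frac{m-1}{2m(2+d(m-1))}$. Let $\mathbf X_d^n(t)$, $t>0$, be the position at time $t$ of a random flight in $\mathbb R^d$ with speed $c=1/\sqrt B$ and exactly $n$ changes of direction in $[0,t]$, whose intertimes have joint density $f_1$ when $d=1$, and joint density either $f_2$ (with $d\ge2$) or $f_3$ (with $d\ge 3$) when $d>1$ (random flights and the densities $f_1,f_2,f_3$ are defined in the context). Put $\mathbf Y_d^n(t):=\mathbf X_d^n(t^\beta)$. Then for every fixed $t>0$ the random vector $\mathbf Y_d^n(t)$ has probability density $$\frac{P(\mathbf Y_d^n(t)\in \mathrm d\mathbf x_d)}{\mathrm d\mathbf x_d}=u(\mathbf x_d,t),$$ where $u(\mathbf x_d,t)=Ct^{-\alpha}\left(1-B\frac{\|\mathbf x_d\|^2}{t^{2\beta}}\right)_+^{\frac1{m-1}}$ with $\alpha=d\beta$ and $C=\frac{\Gamma(\frac d2+\frac m{m-1})B^{d/2}}{\Gamma(\frac m{m-1})\pi^{d/2}}$, whenever $n$ and $m$ are related as follows: (i) for $d=1$ (intertimes with density $f_1$): $m=\frac{n+1}{n-1}=1+\frac1k$ if $n=2k+1$, and $m=\frac{n}{n-2}=1+\frac1k$ if $n=2k+2$, with $k\ge 1$ an integer; (ii) when $d\geq 2$ and the intertimes have density $f_2$: $m=\frac{n(d-1)}{n(d-1)-2}$, with $d>\frac2n+1$; (iii) when $d\geq 3$ and the intertimes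 have density $f_3$: $m=\frac{n(d-2)}{n(d-2)-2}$, with $d>\frac2n+2$.
   Context: Notation: $(x)_+=\max(0,x)$; $\|\cdot\|$ is the Euclidean norm on $\mathbb R^d$; $\mathbf x_d=(x_1,\dots,x_d)$. The function $u$ is the Kompanets–Zel'dovich–Barenblatt function associated with the Porous Medium Equation $\partial_t u=\Delta(u^m)$. Random flights with $n$ changes of direction. Fix $c>0$, $t>0$. A particle starts at the origin of $\mathbb R^d$ and moves with constant speed $c$; in $[0,t]$ it changes direction exactly $n$ times. The lengths of the successive time intervals between changes are $\tau_1,\dots,\tau_n$ and $\tau_{n+1}:=t-\sum_{j=1}^n\tau_j$. The vector $(\tau_1,\dots,\tau_n)$ has a density supported on the simplex $S_n=\{(t_1,\dots,t_n): 0<t_j<t-\sum_{k=0}^{j-1}t_k,\ 1\le j\le n\}$ (with $t_0=0$, and $t_{n+1}:=t-\sum_{j=1}^n t_j$), equal to one of $$f_1(t_1,\dots,t_n)=\frac{n!}{t^n}\,1_{S_n},$$ $$f_2(t_1,\dots,t_n)=\frac{\Gamma((n+1)(d-1))}{(\Gamma(d-1))^{n+1}}\frac{\prod_{j=1}^{n+1}t_j^{d-2}}{t^{(n+1)(d-1)-1}}\,1_{S_n}\quad(d\ge2),$$ $$f_3(t_1,\dots,t_n)=\frac{\Gamma((n+1)(\frac d2-1))}{(\Gamma(\frac d2-1))^{n+1}}\frac{\prod_{j=1}^{n+1}t_j^{\frac d2-2}}{t^{(n+1)(\frac d2-1)-1}}\,1_{S_n}\quad(d\ge3).$$ For $d=1$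 (telegraph process) the position at time $t$ is $X_1^n(t)=c\,V_0\sum_{k=0}^n(-1)^k\tau_{k+1}$, where $P(V_0=1)=P(V_0=-1)=\frac12$ and $V_0$ is independent of the intertimes. For $d>1$ the position at time $t$ is $\mathbf X_d^n(t)=c\sum_{k=0}^n\tau_{k+1}\mathbf V_k$, where $\mathbf V_0,\dots,\mathbf V_n$ are independent, uniformly distributed on the unit sphere $\mathbb S_1^{d-1}=\{\mathbf x_d:\|\mathbf x_d\|=1\}$, and independent of the intertimes. $\mathbf X_d^n(t^\beta)$ means this construction with $t$ replaced by $t^\beta$ (also in the density of the intertimes). *)

(* Defs.v *)
From HB Require Import structures.
From mathcomp Require Import all_boot all_order all_algebra.
From mathcomp Require Import all_classical all_reals all_analysis.

Set Implicit Arguments.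
Unset Strict Implicit.
Unset Printing Implicit Defensive.

Import Order.TTheory GRing.Theory Num.Theory.
Local Open Scope classical_set_scope.
Local Open Scope ring_scope.

(* R^n is [n.-tuple R], with the product sigma-algebra of the library.  The
   library has no Lebesgue measure on it: [lebesgue_Rn] is built by recursion on
   n, as the image of [lebesgue_measure \x lebesgue_Rn n] under
   (x, y) |-> x :: y, starting from the unit mass on R^0.  Sigma-finiteness is
   proved by hand because the library's instance for [\x] is not inferred. *)
Section lebesgue_Rn.
Context (R : realType).

Definition consRn n (p : measurableTypeR R * n.-tuple R) : n.+1.-tuple R :=
  [tuple of p.1 :: p.2].

Lemma measurable_consRn n : measurable_fun setT (@consRn n).
Proof.
apply: (@measurable_cons _ _ _ R (fun p : measurableTypeR R * n.-tuple R => p.1)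
  n (fun p => p.2)).
- exact: (@measurable_fst _ _ (measurableTypeR R) (n.-tuple R)).
- exact: (@measurable_snd _ _ (measurableTypeR R) (n.-tuple R)).
Qed.

Section step.
Variables (n : nat) (mu : {sigma_finite_measure set (n.-tuple R) -> \bar R}).

Let leb1 : {sigma_finite_measure set (measurableTypeR R) -> \bar R} :=
  @lebesgue_measure R.

Definition lebesgue_step : set (n.+1.-tuple R) -> \bar R :=
  pushforward (leb1 \x mu)%E (@consRn n).

Let step0 : lebesgue_step set0 = 0%E.
Proof. by rewrite /lebesgue_step /pushforward preimage_set0 measure0. Qed.

Let step_ge0 A : (0 <= lebesgue_step A)%E.
Proof. exact: (measure_ge0 (leb1 \x mu)%E). Qed.

Let step_sigma_additive : semi_sigma_additive lebesgue_step.
Proof.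
apply: (@measure_semi_sigma_additive _ _ _
  (pushforward (leb1 \x mu)%E (@consRn n))).
exact: measurable_consRn.
Qed.

HB.instance Definition _ := isMeasure.Build _ _ _ lebesgue_step
  step0 step_ge0 step_sigma_additive.

Lemma lebesgue_step_sigma_finite : sigma_finite setT lebesgue_step.
Proof.
have /sigma_finiteP[F [FT ndF Foo]] := sigma_finiteT leb1.
have /sigma_finiteP[G [GT ndG Goo]] := sigma_finiteT mu.
pose g (z : n.+1.-tuple R) : measurableTypeR R * n.-tuple R :=
  (thead z, [tuple of behead z]).
have cK : cancel (@consRn n) g.
  by move=> [x y]; rewrite /g/= theadE; congr pair; exact/val_inj.
have mg : measurable_fun setT g.
  apply: measurable_fun_pair => /=.
    exact: (@measurable_tnth _ R n.+1 ord0).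
  exact: measurable_behead.
exists (fun i => g @^-1` (F i `*` G i)).
  rewrite -preimage_bigcup -[LHS](preimage_setT g); congr (_ @^-1` _).
  rewrite -setXTT FT GT predeqE => -[x y]; split.
    move=> [/= [i _ Fx] [j _ Gy]]; exists (maxn i j) => //; split.
    - by move: x Fx; exact/subsetPset/ndF/leq_maxl.
    - by move: y Gy; exact/subsetPset/ndG/leq_maxr.
  by move=> [i _ []/= ? ?]; split; exists i.
move=> i; have [? ?] := Foo i; have [? ?] := Goo i; split.
  by rewrite -[X in measurable X]setTI; apply: mg => //; exact: measurableX.
rewrite /lebesgue_step /pushforward -comp_preimage.
rewrite (_ : g \o _ = id); last by apply/funext => z /=; rewrite cK.
rewrite preimage_id product_measure1E// lte_mul_pinfty// ge0_fin_numE//.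
Qed.

HB.instance Definition _ := @Measure_isSigmaFinite.Build _ _ _ lebesgue_step
  lebesgue_step_sigma_finite.

End step.

Fixpoint lebesgue_Rn n : {sigma_finite_measure set (n.-tuple R) -> \bar R} :=
  if n is n'.+1 then lebesgue_step (lebesgue_Rn n') else \d_[tuple].

End lebesgue_Rn.
Arguments lebesgue_Rn {R} n.

Section euclidean.
Context (R : realType) (d : nat).

Definition norm2 (x : d.-tuple R) : R :=
  Num.sqrt (\sum_(i < d) tnth x i ^+ 2).

Definition normalize (x : d.-tuple R) : d.-tuple R :=
  [tuple tnth x i / norm2 x | i < d].

(* Normalized surface measure of the unit sphere: the surface measure of a part
   A of the sphere is d times the volume of the cone {r a | 0 < r <= 1, a in A},
   and the total surface is d times the volume of the unit ball. *)
Definition sphere_prob (A : set (d.-tuple R)) : R :=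
  fine (lebesgue_Rn d [set x | 0 < norm2 x <= 1 /\ A (normalize x)]) /
  fine (lebesgue_Rn d [set x | norm2 x <= 1]).

End euclidean.

Definition Gamma (R : realType) (a : R) : R :=
  \int[@lebesgue_measure R]_(x in `]0, +oo[) (x `^ (a - 1) * expR (- x)).

Section probability.
Context (R : realType) (disp : measure_display) (T : measurableType disp)
  (P : probability T R).

Definition has_density n (X : {RV P >-> n.-tuple R}) (f : n.-tuple R -> R) :=
  [/\ measurable_fun setT f, forall x, 0 <= f x &
      forall A, measurable A ->
        P (X @^-1` A) = (\int[lebesgue_Rn n]_(x in A) (f x)%:E)%E].

Definition uniform_on_sphere d (V : {RV P >-> d.-tuple R}) :=
  forall A, measurable A -> P (V @^-1` A) = (sphere_prob A)%:E.

Definition independent d1 d2 (T1 : measurableType d1) (T2 : measurableType d2)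
    (X : T -> T1) (Y : T -> T2) :=
  forall A B, measurable A -> measurable B ->
    P (X @^-1` A `&` Y @^-1` B) = (P (X @^-1` A) * P (Y @^-1` B))%E.

Definition mutually_independent d' (T' : measurableType d') (I : finType)
    (X : I -> T -> T') :=
  forall (J : {set I}) (A : I -> set T'), (forall i, measurable (A i)) ->
    P (\bigcap_(i in [set` J]) X i @^-1` A i) =
    (\prod_(i in J) P (X i @^-1` A i))%E.

End probability.

Section intertimes.
Context (R : realType) (n : nat) (t : R).
Implicit Types x : n.-tuple R.

(* [intertime x k] is t_(k+1): the entries of x are t_1, ..., t_n, and the
   out-of-range index k = n returns the default t_(n+1) = t - (t_1 + ... + t_n). *)
Definition intertime x (k : 'I_n.+1) : R := nth (t - \sum_(s <- x) s) x k.

Definition simplex : set (n.-tuple R) :=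
  [set x | forall j : 'I_n,
     0 < tnth x j < t - \sum_(k < n | (k < j)%N) tnth x k].

Definition f1 x : R := n`!%:R / t ^+ n * \1_simplex x.

(* Dirichlet density with all n + 1 parameters equal to a. *)
Definition dirichlet_pdf (a : R) x : R :=
  Gamma (n.+1%:R * a) / Gamma a ^+ n.+1 *
  ((\prod_(k < n.+1) intertime x k `^ (a - 1)) / t `^ (n.+1%:R * a - 1)) *
  \1_simplex x.

Definition f2 (d : nat) := dirichlet_pdf (d%:R - 1).

Definition f3 (d : nat) := dirichlet_pdf (d%:R / 2 - 1).

End intertimes.

Section random_flights.
Context (R : realType) (disp : measure_display) (T : measurableType disp)
  (P : probability T R).
Variables (c : R) (n : nat) (t : R) (f : n.-tuple R -> R).

(* [f] is the joint density of the first n intertimes over the duration [t];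
   the (n+1)-st one is determined by the others, see [intertime]. *)
Definition telegraph_position (X : {RV P >-> 1.-tuple R}) :=
  exists (tau : {RV P >-> n.-tuple R}) (V0 : {RV P >-> R}),
    [/\ has_density tau f,
        P (V0 @^-1` [set 1]) = (2^-1)%:E /\ P (V0 @^-1` [set -1]) = (2^-1)%:E,
        independent P V0 tau &
        forall w, X w = [tuple
          c * V0 w * \sum_(k < n.+1) (-1) ^+ k * intertime t (tau w) k]].

Definition flight_position d (X : {RV P >-> d.-tuple R}) :=
  exists (tau : {RV P >-> n.-tuple R}) (V : 'I_n.+1 -> {RV P >-> d.-tuple R}),
    [/\ has_density tau f,
        forall k, uniform_on_sphere (V k),
        mutually_independent P (fun k => V k : T -> d.-tuple R),
        independent P (fun w => [tuple V k w | k < n.+1]) tau &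
        forall w, X w = [tuple
          c * \sum_(k < n.+1) intertime t (tau w) k * tnth (V k w) i | i < d]].

End random_flights.

(* kzb = Kompanets-Zel'dovich-Barenblatt; m is the exponent in the porous medium
   equation du/dt = Laplacian (u^m). *)
Section kzb.
Context (R : realType) (d : nat) (m : R).

Definition kzb_beta : R := 1 / (2 + d%:R * (m - 1)).

Definition kzb_alpha : R := d%:R * kzb_beta.

Definition kzb_B : R := (m - 1) / (2 * m * (2 + d%:R * (m - 1))).

Definition kzb_C : R :=
  Gamma (d%:R / 2 + m / (m - 1)) * kzb_B `^ (d%:R / 2) /
  (Gamma (m / (m - 1)) * pi `^ (d%:R / 2)).

Definition kzb (x : d.-tuple R) (t : R) : R :=
  kzb_C * t `^ (- kzb_alpha) *
  Num.max 0 (1 - kzb_B * (norm2 x ^+ 2 / t `^ (2 * kzb_beta))) `^ (1 / (m - 1)).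

End kzb.

(* Main.v *)
(* The position X and the density u have the same moment generating function,
   and this determines the law of X because u has bounded support.

   For a uniform direction V, E exp<xi, r V> = sum_k z^k / (4^k k! (d/2)_k) at
   z = r^2 |xi|^2.  By independence E exp<xi, X> is the integral over the simplex
   of the density of the intertimes times a product of such series in the
   intertimes, that is, an iterated convolution, over [0, +oo), of power series
   with the weights t^(a - 1).  Convolution turns into Cauchy product of the
   coefficients, which is Vandermonde's identity for f2 and the Rothe-Hagen
   identity for f3.  For the telegraph process the convolution of exp(eta s) and
   exp(- eta s) is sinh(eta s) / eta, and averaging over the initial sign turns an
   unpaired exponential into cosh(eta s).  In all cases
   E exp<xi, X> = sum_k z^k / (4^k k! (d/2 + p)_k) at z = r^2 |xi|^2, with r the
   speed times the duration and p = m / (m - 1), which is the transform of the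
   normalized density (1 - |x|^2 / r^2)_+^(p - 1), that is, of u.

   For the uniqueness, the values of the moment generating function at integer
   points are the joint moments of the variables exp(x_i), which are bounded; and
   the polynomials (1 - y^N)^K converge boundedly on (0, 1] to the indicator of
   y <= a when K is about a^-N / N, so these moments determine the probabilities
   of the boxes {x_i <= b_i for all i}. *)

Require Import Defs.
From HB Require Import structures.
From mathcomp Require Import all_boot all_order all_algebra.
From mathcomp Require Import all_classical all_reals all_analysis.
From mathcomp Require Import measurable_realfun interval_inference ring lra.

Set Implicit Arguments.
Unset Strict Implicit.
Unset Printing Implicit Defensive.

Import Order.TTheory GRing.Theory Num.Theory.
Import numFieldNormedType.Exports.
Local Open Scope classical_set_scope.
Local Open Scope ring_scope.

(** The intertime laws are special because each weight t^(a - 1) fits the transform of a direction.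
    With s the Laplace variable and z = c^2 |xi|^2, the product of t^(a - 1) and the Bessel series
    of one direction has Laplace transform proportional to s^-a G(z / s^2)^a, where G(w) = (1 -
    w)^(-1/2) if a = d - 1 and G(w) = 2 / (1 + sqrt(1 - w)) if a = d/2 - 1. Hence n + 1 intertimes
    only replace a by (n + 1) a, and both families return a Bessel series in which d/2 has moved to
    d/2 + p, with p = n (d - 1) / 2 or p = n (d - 2) / 2. Equating p with m / (m - 1) is the
    relation between n and m.

    The computation stays within nonnegative extended-real integrals, where Tonelli and monotone
    convergence ask for no integrability: exponentials are symmetrised into cosh, so only even
    moments occur. Polar coordinates are replaced by homogeneity, which reduces ball and sphere
    moments to Gaussian ones.

    For uniqueness, the bound on X is extracted from the transform itself by Markov's inequality,
    and upper bounds on the coordinates suffice because exp(x_i) is positive anyway. *)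

Lemma exprn_double_ge0 (R : realDomainType) (x : R) k : 0 <= x ^+ k.*2.
Proof. by rewrite exprn_even_ge0// odd_double. Qed.

Ltac meas1b :=
  first [assumption
  | match goal with H : forall _, measurable_fun _ _ |- _ => exact: H end
  | exact: measurable_cst | exact: measurable_id
        | exact: measurable_fst | exact: measurable_snd |
  lazymatch goal with
  | |- measurable_fun _ (fun x => if _ then _ else _) => apply: measurable_fun_ifT
  | |- measurable_fun _ (fun x => (_ < _)%R) => apply: measurable_fun_ltr
  | |- measurable_fun _ (Order.lt ?c) =>
      apply: (@measurable_fun_ltr _ _ _ _ (cst c) id)
  | |- measurable_fun _ (Order.le ?c) =>
      apply: (@measurable_fun_ler _ _ _ _ (cst c) id)
  | |- measurable_fun _ (fun x => (_ <= _)%R) => apply: measurable_fun_ler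
  | |- measurable_fun _ (fun x => EFin _) => apply/measurable_EFinP; rewrite ?/comp
  | |- measurable_fun _ (EFin \o _) => apply/measurable_EFinP
  | |- measurable_fun _ (fun x => (_ * _)%E) => apply: emeasurable_funM
  | |- measurable_fun _ (fun x => (_ + _)%E) => apply: emeasurable_funD
  | |- measurable_fun _ (fun x => (_ * _)%R) =>
      first [apply: measurable_funM | apply: emeasurable_funM]
  | |- measurable_fun _ (fun x => (_ + - _)%R) => apply: measurable_funB
  | |- measurable_fun _ (fun x => (_ + _)%R) =>
      first [apply: measurable_funD | apply: emeasurable_funD]
  | |- measurable_fun _ (fun x => (- _)%R) => apply: measurable_funN
  | |- measurable_fun _ (fun x => (_ ^+ _)%R) => apply: measurable_funX
  | |- measurable_fun _ (fun x => expR _) =>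
      apply: (measurableT_comp (@measurable_expR _))
  | |- measurable_fun _ (fun x => powR _ _) =>
      apply: (measurableT_comp (@measurable_powR _ _))
  end].
Ltac meas1 := meas1b.
Ltac meas := repeat meas1.

Ltac nn1b :=
  first [assumption
  | match goal with H : forall _, is_true (Order.le _ _) |- _ => exact: H end
  | match goal with H : forall _ _, is_true (Order.le _ _) |- _ => exact: H end
  | exact: lexx | exact: exprn_double_ge0
  | exact: ler01 | apply: ltW; assumption | exact: expR_ge0 | exact: powR_ge0 |
  lazymatch goal with
  | |- forall _, _ => move=> ?
  | |- is_true (Order.le _ (EFin _)) => rewrite lee_fin
  | |- is_true (Order.le _ (if _ then _ else _)) => case: ifP => ?
  | |- is_true (Order.le _ (_ * _)%E) => apply: mule_ge0
  | |- is_true (Order.le _ (_ + _)%E) => apply: adde_ge0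
  | |- is_true (Order.le _ (_ * _)%R) => first [apply: mulr_ge0 | apply: mule_ge0]
  | |- is_true (Order.le _ (_ + _)%R) => first [apply: addr_ge0 | apply: adde_ge0]
  | |- is_true (Order.le _ (_ *+ _)%R) => apply: mulrn_wge0
  | |- is_true (Order.le _ (_ ^+ _)%R) => apply: exprn_ge0
  | |- is_true (Order.le _ (_ ^-1)%R) => rewrite invr_ge0
  | |- is_true (Order.le _ (integral _ _ _)) => apply: integral_ge0
  | |- is_true (Order.le _ (_%:R)%R) => exact: ler0n
  end].
Ltac nn1 := nn1b.
Ltac nn := repeat nn1.

(** * Nonnegative integrals on the line: affine changes of variable and Tonelli *)

Section Ge0IntegralT.
Context d (T : measurableType d) (R : realType) (mu : {measure set T -> \bar R}).
Implicit Types (f : T -> \bar R) (k : R).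
Local Open Scope ereal_scope.

Lemma ge0_integralTZl k f : (0 <= k)%R -> measurable_fun setT f ->
  (forall x, 0 <= f x) -> \int[mu]_x (k%:E * f x) = k%:E * \int[mu]_x f x.
Proof. by move=> k0 mf f0; rewrite ge0_integralZl_EFin. Qed.

Lemma ge0_integralTZlR k (g : T -> R) : (0 <= k)%R -> measurable_fun setT g ->
  (forall x, 0 <= g x)%R ->
  \int[mu]_x (k * g x)%:E = k%:E * \int[mu]_x (g x)%:E.
Proof.
move=> k0 mg g0; rewrite -ge0_integralTZl//; last exact/measurable_EFinP.
Qed.

End Ge0IntegralT.

Section LebesgueTransformations.
Context (R : realType).
Local Notation mu := (@lebesgue_measure R).
Implicit Type f : R -> \bar R.

(** Lebesgue measure is determined by its values on the intervals []a, b]], and translation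
    preserves these. *)
Lemma ge0_integral_shift f (c : R) : measurable_fun setT f ->
  (forall x, 0 <= f x)%E -> (\int[mu]_x f (x + c)%R = \int[mu]_x f x)%E.
Proof.
move=> mf f0; pose phi : R -> measurableTypeR R := fun x => x + c.
have mphi : measurable_fun setT phi by exact: measurable_funD.
have E (A : set R) : measurable A -> pushforward mu phi A = mu A.
  move=> mA; apply/esym.
  apply: (@lebesgue_measure_unique _ (pushforward mu phi)) => // _ [[a b]] _ <-.
  change (mu `]a, b] = mu (phi @^-1` `]a, b])).
  rewrite (_ : phi @^-1` _ = `]a - c, b - c]%classic); last first.
    apply/seteqP; split => x; rewrite /phi /= !in_itv/=; lra.
  rewrite !lebesgue_measure_itv/= !lte_fin ltrD2r.
  by case: ifP => // _; rewrite -!EFinB; congr EFin; lra.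
rewrite -[RHS](@eq_measure_integral _ _ _ setT mu (pushforward mu phi) f);
  last by move=> A mA _; exact: E.
by rewrite ge0_integral_pushforward.
Qed.

(** The Jacobian multiplies the left side so that no inverse occurs. A negative r exchanges the open
    and the closed end of an interval, hence the two sign cases. *)
Lemma ge0_integral_scale f (r : R) : r != 0 -> measurable_fun setT f ->
  (forall x, 0 <= f x)%E ->
  (`|r|%:E * \int[mu]_x f (r * x)%R = \int[mu]_x f x)%E.
Proof.
move=> r0 mf f0; pose phi : R -> measurableTypeR R := fun x => r * x.
have mphi : measurable_fun setT phi by exact: measurable_funM.
have r0' : 0 <= `|r| by [].
pose m0 := mscale (NngNum r0') (pushforward mu phi).
pose m : {measure set (measurableTypeR R) -> \bar R} := m0 mphi.
have E (A : set R) : measurable A -> mu A = m A.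
  move=> mA; apply: lebesgue_measure_unique => // _ [[a b]] _ <-.
  change (mu `]a, b] = `|r|%:E * mu (phi @^-1` `]a, b]))%E.
  have [rp|rn|req] := ltgtP 0 r; last by rewrite -req eqxx in r0.
  - rewrite (_ : phi @^-1` _ = `]a / r, b / r]%classic); last first.
      apply/seteqP; split => x; rewrite /phi /= !in_itv/= => /andP[];
        rewrite ltr_pdivrMr// ler_pdivlMr// mulrC => ->;
        by rewrite mulrC => ->.
    rewrite !lebesgue_measure_itv/= !lte_fin ltr_pM2r ?invr_gt0//.
    case: ifP => _; last by rewrite mule0.
    by rewrite -!EFinB -EFinM gtr0_norm//; congr EFin; field.
  - rewrite (_ : phi @^-1` _ = `[b / r, a / r[%classic); last first.
      apply/seteqP; split => x; rewrite /phi /= !in_itv/= => /andP[];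
        rewrite ler_ndivrMr// ltr_ndivlMr// ![_ * r]mulrC => A1 A2;
        by rewrite A1 A2.
    rewrite !lebesgue_measure_itv/= !lte_fin ltr_nM2r ?invr_lt0//.
    case: ifP => _; last by rewrite mule0.
    by rewrite -!EFinB -EFinM ltr0_norm//; congr EFin; field.
rewrite [RHS](@eq_measure_integral _ _ _ setT m mu f);
  last by move=> A mA _; exact: E.
rewrite ge0_integral_mscale//.
by congr (_ * _)%E; rewrite ge0_integral_pushforward.
Qed.

Lemma ge0_integral_reflect f (c : R) : measurable_fun setT f ->
  (forall x, 0 <= f x)%E -> (\int[mu]_x f (c - x)%R = \int[mu]_x f x)%E.
Proof.
move=> mf f0; rewrite -[RHS](@ge0_integral_shift _ c)//.
rewrite -[RHS](@ge0_integral_scale _ (-1)) ?oppr_eq0 ?oner_eq0//.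
- rewrite normrN1 mul1e; apply: eq_integral => x _; congr f; ring.
- by apply: measurableT_comp => //; exact: measurable_funD.
Qed.

End LebesgueTransformations.

Section CurriedTonelli.
Context d1 d2 (T1 : measurableType d1) (T2 : measurableType d2) (R : realType).
Variables (m1 : {sigma_finite_measure set T1 -> \bar R})
  (m2 : {sigma_finite_measure set T2 -> \bar R}).
Variable F : T1 -> T2 -> \bar R.
Hypothesis mF : measurable_fun setT (fun z : T1 * T2 => F z.1 z.2).
Hypothesis F0 : forall x y, (0 <= F x y)%E.

Lemma tonelli_swap :
  (\int[m1]_x \int[m2]_y F x y = \int[m2]_y \int[m1]_x F x y)%E.
Proof. exact: (@fubini_tonelli _ _ T1 T2 R m1 m2 _ mF (fun z => F0 z.1 z.2)). Qed.

Lemma measurable_integral_r : measurable_fun setT (fun x => (\int[m2]_y F x y)%E).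
Proof.
exact: (@measurable_fun_fubini_tonelli_F _ _ T1 T2 R m2 _ mF (fun z => F0 z.1 z.2)).
Qed.

End CurriedTonelli.

Section MeasurableComp2.
Context d d1 d2 (T : measurableType d) (T1 : measurableType d1)
  (T2 : measurableType d2).

Lemma measurable_comp_fst (f : T1 -> T) : measurable_fun setT f ->
  measurable_fun setT (fun z : T1 * T2 => f z.1).
Proof. by move=> mf; exact: measurableT_comp. Qed.

Lemma measurable_comp_snd (f : T2 -> T) : measurable_fun setT f ->
  measurable_fun setT (fun z : T1 * T2 => f z.2).
Proof. by move=> mf; exact: measurableT_comp. Qed.

End MeasurableComp2.

(** * The Gamma function *)

Section PowerIntegrals.
Context (R : realType).
Local Notation mu := (@lebesgue_measure R).

Lemma integral_powR_cc (a e t : R) : a != 0 -> 0 < e -> e < t ->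
  (\int[mu]_(x in `[e, t]) (x `^ (a - 1))%:E = ((t `^ a - e `^ a) / a)%:E)%E.
Proof.
move=> a0 e0 et.
have cP (b x : R) : 0 < x -> {for x, continuous (fun y : R => y `^ b)}.
  move=> x0; apply/differentiable_continuous/derivable1_diffP.
  by have [] := is_derive1_powR b x0.
have dF (x : R) : 0 < x -> is_derive x 1 (fun y : R => y `^ a * a^-1) (x `^ (a - 1)).
  move=> x0; have ? := is_derive1_powR a x0.
  by apply: is_derive_eq; rewrite /GRing.scale/=; field.
rewrite (@continuous_FTC2 _ _ (fun x => x `^ a * a^-1))//.
- by rewrite -EFinB mulrBl.
- apply: continuous_in_subspaceT => x /[!inE]/= /[!in_itv]/= /andP[ex _].
  by apply: cP; exact: lt_le_trans ex.
- have cF (x : R) : 0 < x -> {for x, continuous (fun y : R => y `^ a * a^-1)}.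
    move=> x0; apply/differentiable_continuous/derivable1_diffP.
    by have [] := dF _ x0.
  split.
  + move=> x; rewrite in_itv/= => /andP[ex _].
    by have [] := dF x (lt_trans e0 ex).
  + by apply: cvg_at_right_filter; exact: cF.
  + by apply: cvg_at_left_filter; apply: cF; exact: lt_trans et.
- move=> x; rewrite in_itv/= => /andP[ex _].
  by rewrite derive1E; have [_ ->] := dF x (lt_trans e0 ex).
Qed.

(** For a < 1 the integrand is unbounded at 0, so the fundamental theorem is applied on [1/(n+1), t]
    and followed by monotone convergence. *)
Lemma integral_powR_oc (a t : R) : 0 < a -> 0 < t ->
  (\int[mu]_(x in `]0%R, t]) (x `^ (a - 1))%:E = (t `^ a / a)%:E)%E.
Proof.
move=> a0 t0.
have := @ge0_nondecreasing_set_cvg_integral _ (measurableTypeR R) R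
  (fun n => `[n.+1%:R^-1, t]%classic) (fun x => (x `^ (a - 1))%:E) mu.
have -> : \bigcup_i `[i.+1%:R^-1, t]%classic = `]0%R, t]%classic.
  rewrite itv_open_bnd_bigcup; apply: eq_bigcup => // i _.
  by rewrite add0r.
move=> h; apply: (@cvg_unique _ _ _ _ _ _ (h _ _ _ _)) => //.
- move=> m n mn; apply/subsetPset => x /=; rewrite !in_itv/= => /andP[mx ->].
  by rewrite (le_trans _ mx)// lef_pV2 ?posrE// ler_nat.
- by move=> i; apply: measurable_funTS; meas.
- by move=> i x _; rewrite lee_fin powR_ge0.
- have H : (t `^ a - i.+1%:R^-1 `^ a) / a @[i --> \oo] --> (t `^ a - 0) / a.
    apply: cvgMl; apply: cvgB; first exact: cvg_cst.
    have /cvg_at_rightP := powR_cvg0 a0; apply; split => //.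
    exact: cvg_harmonic.
  rewrite /= -[t `^ a]subr0.
  have E : \forall n \near \oo, (\int[mu]_(x in `[n.+1%:R^-1%R, t]) (x `^ (a - 1))%:E =
      ((t `^ a - n.+1%:R^-1 `^ a) / a)%:E)%E.
    near=> n; rewrite integral_powR_cc ?gt_eqF//.
    by near: n; exact: (near_infty_natSinv_lt (PosNum t0)).
  apply/fine_cvgP; split; first by near=> n; rewrite (near E).
  apply: cvg_trans H; apply: near_eq_cvg; near=> n.
  by rewrite /= (near E).
Unshelve. all: end_near.
Qed.

End PowerIntegrals.

Section TruncatedPower.
Context (R : realType).

(** The truncated power x_+^(a - 1), indexed like the Gamma integral. Its vanishing for x <= 0
    encodes domains of integration, so that integrals, convolutions and simplex densities all live
    on the whole line. *)
Definition tpow (a x : R) : R := if 0 < x then x `^ (a - 1) else 0.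

Lemma tpow_ge0 a x : 0 <= tpow a x.
Proof. by rewrite /tpow; case: ifP => // _; exact: powR_ge0. Qed.

Lemma measurable_tpow a : measurable_fun [set: R] (tpow a).
Proof. by rewrite /tpow; meas. Qed.

Lemma tpowM a s x : 0 < s -> tpow a (s * x) = s `^ (a - 1) * tpow a x.
Proof.
move=> s0; rewrite /tpow pmulr_rgt0//; case: ifP => x0; last by rewrite mulr0.
by rewrite powRM ?ltW.
Qed.

Lemma tpowE a x : 0 < x -> tpow a x = x `^ (a - 1).
Proof. by rewrite /tpow => ->. Qed.

Lemma tpow0 a x : x <= 0 -> tpow a x = 0.
Proof. by rewrite /tpow ltNge => ->. Qed.

End TruncatedPower.

Ltac meas1 ::= first [exact: measurable_tpow | meas1b
  | apply: (measurableT_comp (measurable_tpow _))].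
Ltac nn1 ::= first [exact: tpow_ge0 | nn1b].

Section GammaFunction.
Context (R : realType).
Local Notation mu := (@lebesgue_measure R).

Lemma integral_tpow_lt (a t : R) : 0 < a -> 0 < t ->
  (\int[mu]_x (if x < t then tpow a x else 0)%:E = (t `^ a / a)%:E)%E.
Proof.
move=> a0 t0; rewrite -integral_powR_oc//.
rewrite -integral_itv_bndo_bndc; last first.
  by apply: measurable_funTS; meas.
rewrite [RHS]integral_mkcond; apply: eq_integral => x _.
rewrite patchE mem_setE in_itv/= /tpow.
by case: (ltP 0 x) => x0 //=; case: ifP.
Qed.

Lemma integral_exp_gt (y : R) :
  (\int[mu]_x (if y < x then expR (- x) else 0)%:E = (expR (- y))%:E)%E.
Proof.
rewrite -(@ge0_integral_shift _ _ y) /=; [|by meas|by nn].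
transitivity (\int[mu]_x (expR (- y) * (if 0 < x then expR (- x) else 0))%:E)%E.
  apply: eq_integral => x _; congr EFin.
  by rewrite ltrDr opprD expRD; case: ifP; rewrite ?mulr0// mulrC.
rewrite ge0_integralTZlR; [|by nn|by meas|by nn].
rewrite -[RHS]mule1; congr (_ * _)%E.
rewrite -(@integral_exponential_pdf R 1)//.
rewrite [LHS](_ : _ = \int[mu]_(x in `]0%R, +oo[) (expR (- x))%:E)%E; last first.
  rewrite [RHS]integral_mkcond; apply: eq_integral => x _.
  by rewrite patchE mem_setE in_itv/= andbT; case: ifP.
rewrite integral_itv_obnd_cbnd; last by apply: measurable_funTS; meas.
rewrite [LHS]integral_mkcond; apply: eq_integral => x _.
rewrite /exponential_pdf !patchE; case: ifP => // _.
by rewrite mul1r mulN1r.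
Qed.

(** [Gamma] is a real-valued integral and would be 0 if the integral were infinite, so the
    functional equation and finiteness are obtained in the extended reals first. *)
Definition EGamma (a : R) := (\int[mu]_x (tpow a x * expR (- x))%:E)%E.

Lemma EGamma_ge0 a : (0 <= EGamma a)%E.
Proof.
by apply: integral_ge0 => x _; rewrite lee_fin mulr_ge0 ?tpow_ge0 ?expR_ge0.
Qed.

Lemma EGamma1 : EGamma 1 = 1%E.
Proof.
rewrite -(expR0 R) -[in RHS](oppr0 R) -integral_exp_gt; apply: eq_integral => x _.
by rewrite /tpow expR0; case: ifP; rewrite ?mul0r// subrr powRr0 mul1r.
Qed.

(** Tonelli for a y^(a - 1) exp(- x) on the region 0 < y < x replaces integration by parts:
    integrating out y gives x^a exp(- x), integrating out x gives a y^(a - 1) exp(- y). *)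
Lemma EGammaS a : 0 < a -> EGamma (a + 1) = (a%:E * EGamma a)%E.
Proof.
move=> a0; have tp0 := tpow_ge0; have mt := measurable_tpow a.
pose F (z : R * R) := ((if z.2 < z.1 then expR (- z.1) else 0) * (a * tpow a z.2))%:E.
have F0 z : (0 <= F z)%E by rewrite /F; nn.
have mt2 : measurable_fun setT (fun z : measurableTypeR R * measurableTypeR R => tpow a z.2).
  by apply: measurableT_comp (measurable_tpow a) _.
have mF : measurable_fun [set: measurableTypeR R * measurableTypeR R] F.
  by rewrite /F; meas.
have := @fubini_tonelli _ _ (measurableTypeR R) (measurableTypeR R) R mu mu F mF F0.
rewrite /F/= => E.
transitivity (\int[mu]_x \int[mu]_y ((if (y < x)%R then expR (- x) else 0) * (a * tpow a y))%:E)%E.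
  apply: eq_integral => x _.
  have [x0|x0] := ltP 0 x; last first.
    have -> : tpow (a + 1) x * expR (- x) = 0 by rewrite (tpow0 _ x0) mul0r.
    apply/esym/integral0_eq => y _; congr EFin; case: ifP => yx.
      by rewrite (tpow0 _ (le_trans (ltW yx) x0)) !mulr0.
    exact: mul0r.
  transitivity (\int[mu]_y ((expR (- x) * a) * (if (y < x)%R then tpow a y else 0))%:E)%E.
    rewrite ge0_integralTZlR; [|by nn|by meas|by nn].
    rewrite (integral_tpow_lt a0 x0) -EFinM; congr EFin.
    rewrite (tpowE _ x0) addrK.
    by field; rewrite gt_eqF.
  by apply: eq_integral => y _; congr EFin; case: ifP => _; ring.
rewrite E -ge0_integralTZl; [|by nn|by meas|by nn].
apply: eq_integral => y _.
transitivity (\int[mu]_x ((a * tpow a y) * (if (y < x)%R then expR (- x) else 0))%:E)%E.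
  by apply: eq_integral => x _; congr EFin; rewrite mulrC.
rewrite ge0_integralTZlR; [|by nn|by meas|by nn].
by rewrite integral_exp_gt -!EFinM mulrA.
Qed.

Lemma EGamma_nat n : (EGamma n.+1%:R < +oo)%E.
Proof.
elim: n => [|n ih]; first by rewrite EGamma1 ltry.
rewrite -natr1 EGammaS ?ltr0Sn//.
by apply: lte_mul_pinfty => //; rewrite ?lee_fin.
Qed.

(** For b >= 1 and x > 0, x^(b - 1) is at most 1 + x^N with N >= b - 1. A smaller parameter a is
    reached from a + 1 through the functional equation. *)
Lemma EGamma_lty a : 0 < a -> (EGamma a < +oo)%E.
Proof.
move=> a0; suff H (b : R) : 1 <= b -> (EGamma b < +oo)%E.
  have : (EGamma (a + 1) < +oo)%E by apply: H; rewrite lerDr ltW.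
  rewrite (EGammaS a0); have := EGamma_ge0 a.
  case: (EGamma a) => // [r _ _|_]; first exact: ltry.
  by rewrite gt0_muley ?lte_fin.
move=> b1; have [N bN] : exists N, b - 1 <= N%:R.
  by exists (Num.bound (b - 1)); apply/ltW/archi_boundP; lra.
have te0 := tpow_ge0; have mt := measurable_tpow.
apply: (@le_lt_trans _ _ (EGamma 1 + EGamma N.+1%:R)%E); last first.
  by rewrite EGamma1 lte_add_pinfty ?ltry ?EGamma_nat.
rewrite /EGamma -ge0_integralD//; [|by nn|by meas|by nn|by meas].
apply: ge0_le_integral => //; [by nn|by meas|by meas|].
move=> x _; rewrite -EFinD lee_fin -mulrDl ler_wpM2r ?expR_ge0// /tpow.
case: ifP => x0; last by rewrite addr0.
rewrite subrr powRr0 -natr1 addrK powR_mulrn ?(ltW x0)//.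
have [x1|x1] := leP x 1.
  apply: (@le_trans _ _ 1); last by rewrite lerDl exprn_ge0// ltW.
  apply: (@le_trans _ _ (1 `^ (b - 1))); last by rewrite powR1.
  by rewrite ge0_ler_powR ?nnegrE ?(ltW x0)// subr_ge0.
apply: (@le_trans _ _ (x ^+ N)); last by rewrite lerDr.
by rewrite -powR_mulrn ?(ltW x0)// ler_powR// ltW.
Qed.

Lemma EGamma_gt0 a : 0 < a -> (0 < EGamma a)%E.
Proof.
move=> a0; have te0 := tpow_ge0; have mt := measurable_tpow.
apply: (@lt_le_trans _ _ ((expR (-1))%:E * (1 `^ a / a)%:E)%E).
  by rewrite -EFinM lte_fin mulr_gt0 ?expR_gt0// powR1 divr_gt0.
rewrite -(integral_tpow_lt a0 ltr01) -ge0_integralTZl; [|by nn|by meas|by nn].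
apply: ge0_le_integral => //; [by nn|by meas|by meas|].
move=> x _; rewrite -EFinM lee_fin; case: ifP => x1.
  by rewrite [leRHS]mulrC ler_wpM2r ?tpow_ge0// ler_expR lerN2 ltW.
by rewrite mulr0; nn.
Qed.

Lemma EGammaE a : 0 < a -> EGamma a = (Gamma a)%:E.
Proof.
move=> a0; rewrite /Gamma /Rintegral.
have -> : (\int[mu]_(x in `]0%R, +oo[) (x `^ (a - 1) * expR (- x))%:E = EGamma a)%E.
  rewrite /EGamma [LHS]integral_mkcond; apply: eq_integral => x _.
  rewrite patchE mem_setE in_itv/= andbT /tpow; case: ifP => // _.
  by rewrite mul0r.
by rewrite fineK// ge0_fin_numE ?EGamma_ge0// EGamma_lty.
Qed.

Lemma Gamma_gt0 (a : R) : 0 < a -> 0 < Gamma a.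
Proof. by move=> a0; rewrite -lte_fin -(EGammaE a0) EGamma_gt0. Qed.

Lemma GammaS (a : R) : 0 < a -> Gamma (a + 1) = a * Gamma a.
Proof.
move=> a0; apply: EFin_inj.
by rewrite EFinM -!EGammaE ?EGammaS// addr_gt0.
Qed.

Lemma Gamma1 : Gamma (1 : R) = 1.
Proof. by apply: EFin_inj; rewrite -EGammaE// EGamma1. Qed.

End GammaFunction.

(** * Convolution *)

Section Convolution.
Context (R : realType).
Local Notation mu := (@lebesgue_measure R).
Implicit Types f g h : R -> \bar R.
Local Open Scope ereal_scope.

Definition conv f g (t : R) : \bar R := \int[mu]_x (f x * g (t - x)%R).

Lemma conv_ge0 f g t : (forall x, 0 <= f x) -> (forall x, 0 <= g x) ->
  0 <= conv f g t.
Proof. by move=> f0 g0; apply: integral_ge0 => x _; exact: mule_ge0. Qed.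

Lemma measurable_sub2 f : measurable_fun setT f ->
  measurable_fun setT (fun z : measurableTypeR R * measurableTypeR R =>
    f (z.1 - z.2)%R).
Proof.
move=> mf; apply: (measurableT_comp mf).
by apply: measurable_funB; [exact: measurable_fst|exact: measurable_snd].
Qed.

Lemma measurable_conv f g : measurable_fun setT f -> measurable_fun setT g ->
  (forall x, 0 <= f x) -> (forall x, 0 <= g x) ->
  measurable_fun setT (conv f g).
Proof.
move=> mf mg f0 g0.
apply: (@measurable_integral_r _ _ (measurableTypeR R) (measurableTypeR R) R mu
  (fun t x => f x * g (t - x)%R)) => [|x y]; last exact: mule_ge0.
apply: emeasurable_funM; first exact: measurable_comp_snd.
exact: measurable_sub2.
Qed.

Lemma convA f g h t : measurable_fun setT f -> measurable_fun setT g ->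
  measurable_fun setT h ->
  (forall x, 0 <= f x) -> (forall x, 0 <= g x) -> (forall x, 0 <= h x) ->
  conv f (conv g h) t = conv (conv f g) h t.
Proof.
move=> mf mg mh f0 g0 h0; rewrite /conv.
have shift1 (c : R) (k : R -> \bar R) : measurable_fun setT k ->
    measurable_fun setT (fun y : R => k (c - y)%R).
  move=> mk; apply: (measurableT_comp mk); exact: measurable_funB.
transitivity (\int[mu]_x \int[mu]_y (f x * (g (y - x)%R * h (t - y)%R))).
  apply: eq_integral => x _.
  rewrite -[LHS]ge0_integralZl//; last 2 first.
  - by apply: emeasurable_funM => //; exact: shift1.
  - by move=> y _; exact: mule_ge0.
  rewrite -[LHS](@ge0_integral_shift _ _ (- x)).
  - by apply: eq_integral => y _; congr (_ * (_ * h _)); ring.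
  - by apply: emeasurable_funM; [exact: measurable_cst|
      apply: emeasurable_funM => //; exact: shift1].
  - by move=> y; rewrite !mule_ge0.
rewrite (@tonelli_swap _ _ (measurableTypeR R) (measurableTypeR R) R mu mu); last 2 first.
- apply: emeasurable_funM; first exact: measurable_comp_fst.
  apply: emeasurable_funM.
    apply: (measurableT_comp mg); apply: measurable_funB;
      [exact: measurable_snd|exact: measurable_fst].
  apply: (measurableT_comp mh); apply: measurable_funB;
    [exact: measurable_cst|exact: measurable_snd].
- by move=> x y; rewrite !mule_ge0.
apply: eq_integral => y _; rewrite -ge0_integralZr//; last 2 first.
- apply: emeasurable_funM => //; exact: shift1.
- by move=> x _; exact: mule_ge0.
by apply: eq_integral => x _; rewrite muleA.
Qed.

End Convolution.

Section PowerConvolution.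
Context (R : realType).
Local Notation mu := (@lebesgue_measure R).
Local Open Scope ereal_scope.

(** The substitution x -> t x separates the dependence on t; the value at 1 is the Beta integral. *)
Lemma conv_tpow1 (b c : R) t :
  conv (EFin \o tpow b) (EFin \o tpow c) t =
  (tpow (b + c) t)%:E * conv (EFin \o tpow b) (EFin \o tpow c) 1.
Proof.
have [t0|t0] := ltP 0%R t; last first.
  rewrite (tpow0 _ t0) mul0e; apply: integral0_eq => x _ /=.
  have [x0|x0] := ltP 0%R x.
    by rewrite -EFinM (@tpow0 _ _ (t - x)%R) ?mulr0//; lra.
  by rewrite -EFinM (tpow0 _ x0) mul0r.
pose F (x : R) := (tpow b x * tpow c (t - x))%:E.
have mc (e : R) : measurable_fun setT (fun x : R => tpow c (e - x)%R).
  apply: (measurableT_comp (measurable_tpow _)); exact: measurable_funB.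
have F0 x : 0 <= F x by rewrite /F; nn.
have mF : measurable_fun setT F by have mct := mc t; rewrite /F; meas.
transitivity (\int[mu]_x F x).
  by apply: eq_integral => x _; rewrite /F EFinM.
have tn0 : t != 0%R by rewrite gt_eqF.
rewrite -(ge0_integral_scale tn0 mF F0) (gtr0_norm t0) (tpowE _ t0).
transitivity (t%:E * ((t `^ (b - 1) * t `^ (c - 1))%:E *
    \int[mu]_x (tpow b x * tpow c (1 - x)%R)%:E)).
  congr (_ * _); rewrite -ge0_integralTZl; [|by nn| |by nn]; last first.
    by have mc1 := mc 1%R; meas.
  apply: eq_integral => x _; rewrite /F -EFinM; congr EFin.
  rewrite -{2}[t]mulr1 -mulrBr !(tpowM _ _ t0); ring.
rewrite muleA -EFinM; congr (_%:E * _).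
rewrite -{1}[t]powRr1; last exact: ltW.
have tD : t != 0%R -> forall u v : R, (t `^ u * t `^ v = t `^ (u + v))%R.
  by move=> t1 u v; rewrite powRD// t1 implybT.
by rewrite !(tD tn0); congr (_ `^ _)%R; ring.
Qed.

(** Integrating [conv_tpow1] against exp(- t) gives Gamma(b + c) times the Beta integral, while
    Tonelli and a shift turn the same double integral into Gamma(b) Gamma(c). *)
Lemma beta_integral (b c : R) : (0 < b)%R -> (0 < c)%R ->
  conv (EFin \o tpow b) (EFin \o tpow c) 1 =
  (Gamma b * Gamma c / Gamma (b + c))%:E.
Proof.
move=> b0 c0; set K := conv _ _ 1%R.
have bc0 : (0 < b + c)%R by exact: addr_gt0.
have K0 : 0 <= K by apply: conv_ge0 => x /=; nn.
have mB (x : R) (e : R) : measurable_fun setT (fun t : R => tpow e (t - x)%R).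
  by apply: (measurableT_comp (measurable_tpow _)); exact: measurable_funB.
suff E : (Gamma (b + c))%:E * K = (Gamma b * Gamma c)%:E.
  rewrite -[K]mul1e (_ : 1%E = (Gamma (b + c))^-1%:E * (Gamma (b + c))%:E); last first.
    by rewrite -EFinM mulVf// gt_eqF// Gamma_gt0.
  by rewrite -muleA E -EFinM mulrC.
rewrite -EGammaE// /EGamma -ge0_integralZr//; [|by meas|by nn].
transitivity (\int[mu]_t \int[mu]_x (tpow b x * tpow c (t - x)%R * expR (- t))%:E).
  apply: eq_integral => t _.
  rewrite EFinM [X in X * _]muleC -muleA -conv_tpow1.
  rewrite -ge0_integralTZl; [|by nn| |by nn]; last first.
    by rewrite /comp; meas.
  by apply: eq_integral => x _; rewrite /= -!EFinM; congr EFin; ring.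
rewrite (@tonelli_swap _ _ (measurableTypeR R) (measurableTypeR R) R mu mu); last 2 first.
- by meas.
- by nn.
transitivity (\int[mu]_x ((tpow b x * expR (- x))%:E * EGamma c)); last first.
  rewrite ge0_integralZr ?EGamma_ge0//; [|by meas|by nn].
  by rewrite -/(EGamma b) EGammaE// EGammaE// EFinM.
apply: eq_integral => x _.
have -> : EGamma c = \int[mu]_t (tpow c (t - x)%R * expR (- (t - x)))%:E.
  by rewrite /EGamma -[LHS](@ge0_integral_shift _ _ (- x)%R); [|by meas|by nn].
rewrite -ge0_integralTZl; [|by nn|by meas|by nn].
apply: eq_integral => t _; rewrite -EFinM; congr EFin.
have -> : expR (- t) = (expR (- x) * expR (- (t - x)))%R.
  by rewrite -expRD; congr expR; ring.
ring.
Qed.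

End PowerConvolution.

Section NonnegSeries.
Context (R : realType).
Local Open Scope ereal_scope.
Implicit Types a b : nat -> \bar R.

Lemma nneseriesZl_ereal (c : \bar R) a : 0 <= c -> (forall k, 0 <= a k) ->
  \sum_(k <oo) (c * a k) = c * \sum_(k <oo) a k.
Proof.
move=> c0 a0; rewrite -!ge0_integral_count//; last by move=> k; exact: mule_ge0.
by rewrite ge0_integralZl.
Qed.

Lemma nneseriesZr_ereal (c : \bar R) a : 0 <= c -> (forall k, 0 <= a k) ->
  \sum_(k <oo) (a k * c) = (\sum_(k <oo) a k) * c.
Proof.
move=> c0 a0; rewrite muleC -nneseriesZl_ereal//.
by apply: eq_eseriesr => k _; rewrite muleC.
Qed.

Lemma nneseries_finite a n : (forall k, 0 <= a k) ->
  (forall k, (n <= k)%N -> a k = 0) -> \sum_(k <oo) a k = \sum_(k < n) a k.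
Proof.
move=> a0 an; rewrite (@nneseries_split _ a 0 n)// add0n big_mkord.
by rewrite [X in _ + X]eseries0 ?adde0// => k nk _; exact: an.
Qed.

Lemma nneseries_diagonal (F : nat -> nat -> \bar R) :
  (forall k l, 0 <= F k l) ->
  \sum_(k <oo) \sum_(l <oo) F k l = \sum_(N <oo) \sum_(k < N.+1) F k (N - k)%N.
Proof.
move=> F0.
(* [G] extends the triangle k <= N by zero, so that the order of two full sums can be exchanged. *)
pose G k N : \bar R := if (k <= N)%N then F k (N - k)%N else 0.
have G0 k N : 0 <= G k N by rewrite /G; case: ifP.
transitivity (\sum_(k <oo) \sum_(N <oo) G k N).
  apply: eq_eseriesr => k _.
  transitivity (\sum_(l <oo) G k (l + k)%N).
    by apply: eq_eseriesr => l _; rewrite /G leq_addl addnK.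
  rewrite nneseries_addn// eseries_cond /= eseries_mkcond.
  by apply: eq_eseriesr => l _; rewrite /G; case: ifP => // ->.
rewrite nneseries_interchange//; apply: eq_eseriesr => N _.
rewrite (@nneseries_finite _ N.+1)//.
  by apply: eq_bigr => k _; rewrite /G -ltnS ltn_ord.
by move=> k Nk; rewrite /G leqNgt Nk.
Qed.

Lemma measurable_nneseries d (T : measurableType d) (h : nat -> T -> \bar R) :
  (forall k x, 0 <= h k x) -> (forall k, measurable_fun setT (h k)) ->
  measurable_fun setT (fun x => \sum_(k <oo) h k x).
Proof.
move=> h0 mh.
exact: (@ge0_emeasurable_sum _ _ _ _ h xpredT (fun k x _ _ => h0 k x) (fun k _ => mh k)).
Qed.

End NonnegSeries.

Section PowerSeriesConvolution.
Context (R : realType).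
Local Notation mu := (@lebesgue_measure R).
Local Open Scope ereal_scope.

(** The Riemann-Liouville kernel. Division by Gamma(b) makes it a convolution semigroup in b with no
    constants, its Laplace transform being s^-b. *)
Definition gpow (b t : R) : \bar R := (tpow b t / Gamma b)%:E.

Lemma gpow_ge0 b t : (0 < b)%R -> 0 <= gpow b t.
Proof.
by move=> b0; rewrite lee_fin divr_ge0 ?tpow_ge0// ltW// Gamma_gt0.
Qed.

Lemma measurable_gpow b : measurable_fun setT (gpow b).
Proof. by rewrite /gpow; meas. Qed.

Lemma conv_gpow b c t : (0 < b)%R -> (0 < c)%R ->
  conv (gpow b) (gpow c) t = gpow (b + c) t.
Proof.
move=> b0 c0.
have := conv_tpow1 b c t; rewrite beta_integral//.
have := Gamma_gt0 b0; have := Gamma_gt0 c0.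
have := Gamma_gt0 (addr_gt0 b0 c0).
rewrite /gpow; move: (Gamma b) (Gamma c) (Gamma (b + c)) => gb gc gbc.
move=> gbc0 gc0 gb0 E.
transitivity ((gb^-1 / gc)%:E * conv (EFin \o tpow b) (EFin \o tpow c) t).
  rewrite /conv -ge0_integralTZl.
  - by apply: eq_integral => x _; rewrite /= -!EFinM; congr EFin; ring.
  - by rewrite divr_ge0 ?invr_ge0 ?ltW.
  - rewrite /comp; meas; apply: measurable_funB; meas.
  - by move=> x /=; nn.
rewrite E -!EFinM; congr EFin; field.
by rewrite !gt_eqF.
Qed.

Lemma conv_nneseries (F G : nat -> R -> \bar R) t :
  (forall k x, 0 <= F k x) -> (forall k x, 0 <= G k x) ->
  (forall k, measurable_fun setT (F k)) -> (forall k, measurable_fun setT (G k)) ->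
  conv (fun x => \sum_(k <oo) F k x) (fun x => \sum_(l <oo) G l x) t =
  \sum_(k <oo) \sum_(l <oo) conv (F k) (G l) t.
Proof.
move=> F0 G0 mF mG; rewrite /conv.
have mGt l : measurable_fun setT (fun x : R => G l (t - x)%R).
  by apply: (measurableT_comp (mG l)); exact: measurable_funB.
transitivity (\int[mu]_x \sum_(k <oo) \sum_(l <oo) (F k x * G l (t - x)%R)).
  apply: eq_integral => x _.
  rewrite -nneseriesZr_ereal//; last by apply: nneseries_ge0.
  by apply: eq_eseriesr => k _; rewrite nneseriesZl_ereal.
have FG0 k l x : 0 <= F k x * G l (t - x)%R by exact: mule_ge0.
have mFG k l : measurable_fun setT (fun x : R => F k x * G l (t - x)%R).
  exact: emeasurable_funM.
rewrite integral_nneseries//; last 2 first.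
- move=> k; apply: (@measurable_nneseries _ _ _ (fun l x => F k x * G l (t - x)%R)).
  + by move=> l x; exact: FG0.
  + by move=> l; exact: mFG.
- by move=> k x _; apply: nneseries_ge0.
apply: eq_eseriesr => k _; apply: integral_nneseries => //.
by move=> l; exact: mFG.
Qed.

Definition cauchy_prod (phi psi : nat -> R) (N : nat) : R :=
  (\sum_(k < N.+1) phi k * psi (N - k)%N)%R.

(* The Laplace transform of gseries phi b z is s^-b times the generating function
   of phi at z / s^2, so convolution multiplies generating functions. *)
Definition gseries (phi : nat -> R) (b z t : R) : \bar R :=
  \sum_(k <oo) ((phi k * z ^+ k)%:E * gpow (b + 2 * k%:R) t).

Lemma gseries_ge0 phi b z t : (forall k, 0 <= phi k)%R -> (0 < b)%R ->
  (0 <= z)%R -> 0 <= gseries phi b z t.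
Proof.
move=> phi0 b0 z0; apply: nneseries_ge0 => k _ _; apply: mule_ge0; first by nn.
by apply: gpow_ge0; rewrite ltr_wpDr// mulr_ge0.
Qed.

Lemma measurable_gseries phi b z : (forall k, 0 <= phi k)%R -> (0 < b)%R ->
  (0 <= z)%R -> measurable_fun setT (gseries phi b z).
Proof.
move=> phi0 b0 z0; apply: measurable_nneseries => [k t|k].
  apply: mule_ge0; first by nn.
  by apply: gpow_ge0; rewrite ltr_wpDr// mulr_ge0.
by apply: emeasurable_funM; [exact: measurable_cst|exact: measurable_gpow].
Qed.

Lemma conv_gseries phi psi b c z t :
  (forall k, 0 <= phi k)%R -> (forall k, 0 <= psi k)%R ->
  (0 < b)%R -> (0 < c)%R -> (0 <= z)%R ->
  conv (gseries phi b z) (gseries psi c z) t =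
  gseries (cauchy_prod phi psi) (b + c) z t.
Proof.
move=> phi0 psi0 b0 c0 z0.
have bk k : (0 < b + 2 * k%:R)%R by rewrite ltr_wpDr// mulr_ge0.
have ck k : (0 < c + 2 * k%:R)%R by rewrite ltr_wpDr// mulr_ge0.
rewrite conv_nneseries; last 4 first.
- by move=> k x; apply: mule_ge0; [nn|exact: gpow_ge0].
- by move=> k x; apply: mule_ge0; [nn|exact: gpow_ge0].
- by move=> k; apply: emeasurable_funM; [exact: measurable_cst|exact: measurable_gpow].
- by move=> k; apply: emeasurable_funM; [exact: measurable_cst|exact: measurable_gpow].
transitivity (\sum_(k <oo) \sum_(l <oo)
    ((phi k * z ^+ k)%:E * (psi l * z ^+ l)%:E *
     gpow (b + c + 2 * (k + l)%:R) t)).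
  apply: eq_eseriesr => k _; apply: eq_eseriesr => l _.
  rewrite (_ : (b + c + 2 * (k + l)%:R)%R =
    ((b + 2 * k%:R) + (c + 2 * l%:R))%R); last by rewrite natrD; ring.
  rewrite -conv_gpow// /conv -EFinM -ge0_integralTZl.
  - by apply: eq_integral => x _; rewrite muleACA.
  - by nn.
  - apply: emeasurable_funM; first exact: measurable_gpow.
    apply: (measurableT_comp (measurable_gpow _)); exact: measurable_funB.
  - by move=> x; apply: mule_ge0; exact: gpow_ge0.
rewrite nneseries_diagonal; last first.
  move=> k l; apply: mule_ge0; first by nn.
  by apply: gpow_ge0; rewrite ltr_wpDr ?addr_gt0// mulr_ge0.
apply: eq_eseriesr => N _.
transitivity (\sum_(k < N.+1) (phi k * psi (N - k)%N * z ^+ N)%:E *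
    gpow (b + c + 2 * N%:R) t).
  apply: eq_bigr => k _; have kN : (k <= N)%N by rewrite -ltnS.
  rewrite subnKC//; congr (_ * _); rewrite -EFinM; congr EFin.
  rewrite (_ : z ^+ N = z ^+ k * z ^+ (N - k))%R; last by rewrite -exprD subnKC.
  ring.
rewrite -ge0_sume_distrl; last by move=> k _; nn.
by rewrite sumEFin -mulr_suml.
Qed.

End PowerSeriesConvolution.

(** * Rising factorials and convolution identities *)

Section RisingFactorial.
Context (R : realType).
Implicit Types x y : R.

Definition rising x k : R := \prod_(i < k) (x + i%:R).

Lemma rising0 x : rising x 0 = 1. Proof. exact: big_ord0. Qed.

Lemma risingS x k : rising x k.+1 = rising x k * (x + k%:R).
Proof. exact: big_ord_recr. Qed.

Lemma risingSl x k : rising x k.+1 = x * rising (x + 1) k.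
Proof.
rewrite /rising big_ord_recl addr0; congr (_ * _); apply: eq_bigr => i _.
by rewrite lift0 -natr1; ring.
Qed.

Lemma rising_gt0 x k : 0 < x -> 0 < rising x k.
Proof. by move=> x0; apply: prodr_gt0 => i _; rewrite ltr_wpDr. Qed.

Lemma rising_ge0 x k : 0 < x -> 0 <= rising x k.
Proof. by move=> x0; exact/ltW/rising_gt0. Qed.

Lemma rising_double x k :
  rising x (k.*2) = 4 ^+ k * rising (x / 2) k * rising ((x + 1) / 2) k.
Proof.
elim: k => [|k ih]; first by rewrite !rising0 expr0 !mulr1.
rewrite doubleS !risingS ih exprS -natr1 -muln2 natrM; by field.
Qed.

Lemma rising_add x k l : rising x (k + l) = rising x k * rising (x + k%:R) l.
Proof.
elim: l => [|l ih]; first by rewrite addn0 rising0 mulr1.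
by rewrite addnS !risingS ih natrD; ring.
Qed.

Lemma rising1 k : rising 1 k = k`!%:R.
Proof.
elim: k => [|k ih]; first by rewrite rising0.
by rewrite risingS ih factS natrM -natr1; ring.
Qed.

Lemma rising_Gamma x k : 0 < x -> Gamma (x + k%:R) = rising x k * Gamma x.
Proof.
move=> x0; elim: k => [|k ih]; first by rewrite addr0 rising0 mul1r.
have xk : 0 < x + k%:R by rewrite ltr_wpDr.
have := GammaS xk; rewrite (_ : x + k%:R + 1 = x + k.+1%:R); last first.
  by rewrite -natr1 addrA.
by move=> ->; rewrite ih risingS; move: (Gamma x) => g; ring.
Qed.

(* Coefficient of z^k in (1 - z)^(-x/2). *)
Definition phi_bessel x k : R := rising (x / 2) k / k`!%:R.

Lemma phi_bessel_ge0 x k : 0 < x -> 0 <= phi_bessel x k.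
Proof. by move=> x0; rewrite divr_ge0// rising_ge0// divr_gt0. Qed.

Lemma fact_neq0 k : k`!%:R != 0 :> R.
Proof. by rewrite pnatr_eq0 -lt0n fact_gt0. Qed.

(** The coefficients of (1 - z)^(-x) satisfy (k + 1) a_(k+1) = (x + k) a_k. Writing N + 1 = k + (N +
    1 - k) under the sum, which amounts to differentiating the product of the two series, produces
    the common factor x + y + N of the recursion on the right. *)
Lemma vandermonde_rising x y N :
  \sum_(k < N.+1) rising x k / k`!%:R * (rising y (N - k) / (N - k)`!%:R) =
  rising (x + y) N / N`!%:R.
Proof.
pose a z k := rising z k / k`!%:R : R.
have aS z k : k.+1%:R * a z k.+1 = (z + k%:R) * a z k.
  have : k.+1%:R != 0 :> R by rewrite pnatr_eq0.
  have := fact_neq0 k; rewrite /a risingS factS natrM.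
  by move: (k`!%:R) (k.+1%:R : R) => f n f0 n0; field; rewrite f0 n0.
rewrite -/(a _ _).
elim: N => [|N ih]; first by rewrite big_ord1 /a !rising0 fact0 invr1 !mulr1.
have N1 : N.+1%:R != 0 :> R by rewrite pnatr_eq0.
apply: (mulfI N1); rewrite aS -ih mulr_sumr.
transitivity (\sum_(k < N.+2) (k%:R * a x k * a y (N.+1 - k)%N +
                               a x k * ((N.+1 - k)%:R * a y (N.+1 - k)%N))).
  apply: eq_bigr => k _; rewrite natrB; last by rewrite -ltnS.
  by rewrite -/(a _ _) -/(a _ _); ring.
rewrite big_split/= big_ord_recl/= mul0r mul0r add0r.
rewrite [X in _ + X]big_ord_recr/= subnn mul0r mulr0 addr0 -big_split/= mulr_sumr.
apply: eq_bigr => k _; have kN : (k <= N)%N by rewrite -ltnS.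
rewrite /bump/= add1n subSS subSn// !aS natrB// /a; ring.
Qed.

Lemma cauchy_phi_bessel x y N :
  cauchy_prod (phi_bessel x) (phi_bessel y) N = phi_bessel (x + y) N.
Proof. by rewrite /cauchy_prod /phi_bessel vandermonde_rising mulrDl. Qed.

(** This is x / (x + 2k) times the binomial coefficient of x + 2k over k, the coefficient of z^k in
    C(z)^x for the Catalan generating function C. The factor x + 2k is cancelled, which leaves a
    polynomial in x. *)
Definition hagen x k : R :=
  if k is k'.+1 then x * rising (x + k.+1%:R) k' / k`!%:R else 1.

Definition hagen_poly k : {poly R} :=
  if k is k'.+1 then
    (k`!%:R)^-1 *: ('X * \prod_(i < k') ('X + (k.+1%:R + i%:R)%:P)) else 1.

Lemma horner_hagen_poly k x : (hagen_poly k).[x] = hagen x k.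
Proof.
case: k => [|k]; rewrite /hagen_poly /hagen ?hornerC//.
rewrite hornerZ hornerM hornerX horner_prod mulrC; congr (_ * _ * _).
by apply: eq_bigr => i _; rewrite hornerD hornerX hornerC addrA.
Qed.

(** The Catalan equation C = 1 + z C^2, multiplied by C^x and read at z^(k+1). *)
Lemma hagenS x k : hagen (x + 1) k.+1 - hagen x k.+1 = hagen (x + 2) k.
Proof.
case: k => [|k].
  by rewrite /hagen !rising0 factS fact0 muln1 !divr1; ring.
rewrite /hagen (_ : x + 1 + k.+3%:R = x + k.+3%:R + 1); last by ring.
rewrite (_ : x + 2 + k.+2%:R = x + k.+3%:R + 1); last by ring.
rewrite risingS [rising (x + k.+3%:R) _]risingSl factS natrM.
move: (rising _ k) => r.
have := fact_neq0 k.+1; move: (k.+1`!%:R) => f f0.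
by field; rewrite f0 /= -natrD pnatr_eq0.
Qed.

Lemma poly_nat_roots (p : {poly R}) : (forall n, p.[n%:R] = 0) -> p = 0.
Proof.
move=> p0; apply/eqP; apply: contraT => pn0.
have := @max_poly_roots _ p [seq i%:R | i <- iota 0 (size p)] pn0.
rewrite size_map size_iota ltnn; apply.
  by apply/allP => _ /mapP[i _ ->]; rewrite /root p0.
by rewrite map_inj_uniq ?iota_uniq// => i j /eqP; rewrite eqr_nat => /eqP.
Qed.

(* Rothe-Hagen convolution: both sides are polynomials in x, and at x = n they
   satisfy the same recursion in n by the identity at N - 1. *)
Lemma rothe_hagen x y N :
  \sum_(k < N.+1) hagen x k * hagen y (N - k) = hagen (x + y) N.
Proof.
elim: N x => [|N ih] x; first by rewrite big_ord1 mulr1.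
pose p : {poly R} := \sum_(k < N.+2) hagen_poly k * (hagen y (N.+1 - k))%:P -
  (hagen_poly N.+1 \Po ('X + y%:P)).
have pE z : p.[z] = \sum_(k < N.+2) hagen z k * hagen y (N.+1 - k) -
    hagen (z + y) N.+1.
  rewrite /p hornerD hornerN horner_comp hornerD hornerX hornerC horner_sum.
  congr (_ - _); last exact: horner_hagen_poly.
  by apply: eq_bigr => k _; rewrite hornerM hornerC horner_hagen_poly.
suff p0 : p = 0.
  by apply/eqP; rewrite -subr_eq0 -pE p0 horner0.
apply: poly_nat_roots; elim=> [|n ihn].
  rewrite pE add0r big_ord_recl/= subn0 mul1r big1 ?addr0 ?subrr// => k _.
  by rewrite /hagen/= !mul0r.
rewrite -ihn; apply/eqP; rewrite -subr_eq0 !pE.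
rewrite big_ord_recl [X in _ - (X - _)]big_ord_recl/=.
rewrite -[n.+1%:R]natr1.
have E (a b c d e : R) : a + b - c - (a + d - e) = (b - d) - (c - e) by ring.
rewrite E.
rewrite (_ : n%:R + 1 + y = n%:R + y + 1); last by ring.
rewrite hagenS -sumrB subr_eq0; apply/eqP.
rewrite (_ : n%:R + y + 2 = n%:R + 2 + y); last by ring.
rewrite -ih; apply: eq_bigr => k _.
by rewrite /bump/= add1n subSS -mulrBl hagenS.
Qed.

(* Coefficient of z^k in (2 / (1 + sqrt (1 - z)))^x. *)
Definition phi_hagen x k : R := hagen x k / 4 ^+ k.

(** The quotient form exhibits a Bessel coefficient: at x = d/2 - 1 the last factor is (d/2)_k. *)
Lemma phi_hagenE x k : 0 < x ->
  phi_hagen x k = rising x k.*2 / (4 ^+ k * k`!%:R * rising (x + 1) k).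
Proof.
move=> x0; case: k => [|k].
  by rewrite /phi_hagen /hagen !rising0 fact0 expr0 !mulr1.
rewrite /phi_hagen /hagen doubleS risingSl -addnn -addSn rising_add.
rewrite (_ : x + 1 + k.+1%:R = x + k.+2%:R); last by ring.
have := rising_gt0 k.+1 (addr_gt0 x0 ltr01).
move: (rising _ k.+1) => r r0.
move: (rising _ k) => s.
have := fact_neq0 k.+1; move: (k.+1`!%:R) => f f0.
have : 4 ^+ k.+1 != 0 :> R by rewrite expf_neq0// pnatr_eq0.
move: (4 ^+ k.+1) => e e0.
by field; rewrite f0 e0 gt_eqF.
Qed.

Lemma phi_hagen_ge0 x k : 0 < x -> 0 <= phi_hagen x k.
Proof.
move=> x0; rewrite phi_hagenE// divr_ge0 ?rising_ge0// !mulr_ge0 ?exprn_ge0//.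
by rewrite rising_ge0// addr_gt0.
Qed.

Lemma cauchy_phi_hagen x y N :
  cauchy_prod (phi_hagen x) (phi_hagen y) N = phi_hagen (x + y) N.
Proof.
rewrite /cauchy_prod /phi_hagen -rothe_hagen mulr_suml; apply: eq_bigr => k _.
rewrite (_ : 4 ^+ N = 4 ^+ k * 4 ^+ (N - k) :> R).
  have : 4 ^+ k != 0 :> R by rewrite expf_neq0// pnatr_eq0.
  have : 4 ^+ (N - k) != 0 :> R by rewrite expf_neq0// pnatr_eq0.
  move: (4 ^+ k) (4 ^+ (N - k)) => e f e0 f0.
  by field; rewrite e0 f0.
by rewrite -exprD subnKC// -ltnS.
Qed.

End RisingFactorial.

(** * Integration over R^n *)

Section EuclideanIntegrals.
Context (R : realType).
Local Notation mu := (@lebesgue_measure R).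
Local Open Scope ereal_scope.

Lemma integral_lebesgue_Rn0 (f : 0.-tuple R -> \bar R) : measurable_fun setT f ->
  \int[lebesgue_Rn 0]_x f x = f [tuple].
Proof.
by move=> mf; rewrite [LHS]integral_dirac// diracT mul1e.
Qed.

Lemma measurable_consRn_l n (f : n.+1.-tuple R -> \bar R) : measurable_fun setT f ->
  measurable_fun setT (fun z : measurableTypeR R * n.-tuple R => f (consRn z)).
Proof. by move=> mf; apply: measurableT_comp => //; exact: measurable_consRn. Qed.

Lemma integral_lebesgue_RnS n (f : n.+1.-tuple R -> \bar R) :
  measurable_fun setT f -> (forall x, 0 <= f x) ->
  \int[lebesgue_Rn n.+1]_z f z =
  \int[mu]_x \int[lebesgue_Rn n]_y f (consRn (x, y)).
Proof.
move=> mf f0.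
have mc := @measurable_consRn R n.
transitivity (\int[pushforward (mu \x lebesgue_Rn n) (@consRn R n)]_z f z) => //.
rewrite ge0_integral_pushforward//.
exact: (fubini_tonelli1 _ (measurable_consRn_l mf) (fun z => f0 _)).
Qed.

Definition dot n (x y : n.-tuple R) : R := (\sum_(i < n) tnth x i * tnth y i)%R.

Definition sqn n (x : n.-tuple R) : R := dot x x.

Definition scale n (r : R) (x : n.-tuple R) : n.-tuple R :=
  [tuple (r * tnth x i)%R | i < n].

Lemma norm2E n (x : n.-tuple R) : norm2 x = Num.sqrt (sqn x).
Proof. by rewrite /norm2 /sqn /dot; under eq_bigr do rewrite expr2. Qed.

Lemma sqn_ge0 n (x : n.-tuple R) : (0 <= sqn x)%R.
Proof. by apply: sumr_ge0 => i _; rewrite -expr2 sqr_ge0. Qed.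

Lemma norm2_sqr n (x : n.-tuple R) : (norm2 x ^+ 2 = sqn x)%R.
Proof. by rewrite norm2E sqr_sqrtr// sqn_ge0. Qed.

Lemma measurable_dot n (x : n.-tuple R) : measurable_fun setT (dot x).
Proof.
apply: measurable_sum => i; apply: measurable_funM => //.
exact: measurable_tnth.
Qed.

Lemma measurable_sqn n : measurable_fun setT (@sqn n).
Proof.
by apply: measurable_sum => i; apply: measurable_funM; exact: measurable_tnth.
Qed.

Lemma measurable_scale n r : measurable_fun setT (@scale n r).
Proof.
apply/measurable_fun_tnthP => i.
rewrite (_ : _ \o _ = fun x => (r * tnth x i)%R).
  by apply: measurable_funM => //; exact: measurable_tnth.
by apply/funext => x /=; rewrite tnth_mktuple.
Qed.

Lemma tnth_consRnS n x (y : n.-tuple R) i :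
  tnth (consRn (x, y)) (lift ord0 i) = tnth y i.
Proof. by rewrite !(tnth_nth 0%R). Qed.

Lemma dot_consRn n (a : n.+1.-tuple R) x (y : n.-tuple R) :
  dot a (consRn (x, y)) = (thead a * x + dot (behead_tuple a) y)%R.
Proof.
rewrite /dot big_ord_recl; congr (_ + _)%R.
apply: eq_bigr => i _; rewrite tnth_consRnS; congr (_ * _)%R.
by case: a => -[//|h s] hs; rewrite !(tnth_nth 0%R).
Qed.

Lemma sqn_consRn n x (y : n.-tuple R) :
  sqn (consRn (x, y)) = (x ^+ 2 + sqn y)%R.
Proof.
rewrite /sqn /dot big_ord_recl expr2; congr (_ + _)%R.
by apply: eq_bigr => i _; rewrite tnth_consRnS.
Qed.

Lemma scale_consRn n r x (y : n.-tuple R) :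
  scale r (consRn (x, y)) = consRn ((r * x)%R, scale r y).
Proof.
apply: eq_from_tnth => i; rewrite tnth_mktuple.
case: (unliftP ord0 i) => [j ->|->//].
by rewrite !tnth_consRnS tnth_mktuple.
Qed.

Lemma sqn_scale n r (x : n.-tuple R) : sqn (scale r x) = (r ^+ 2 * sqn x)%R.
Proof.
rewrite /sqn /dot mulr_sumr; apply: eq_bigr => i _.
by rewrite tnth_mktuple; ring.
Qed.

Lemma dot_scale n r (x y : n.-tuple R) : dot x (scale r y) = (r * dot x y)%R.
Proof.
rewrite /dot mulr_sumr; apply: eq_bigr => i _.
by rewrite tnth_mktuple; ring.
Qed.

Lemma integral_scale n (f : n.-tuple R -> \bar R) r : r != 0%R ->
  measurable_fun setT f -> (forall x, 0 <= f x) ->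
  (`|r| ^+ n)%:E * \int[lebesgue_Rn n]_x f (scale r x) =
  \int[lebesgue_Rn n]_x f x.
Proof.
move=> r0; elim: n f => [|n ih] f mf f0.
  rewrite expr0 mul1e; rewrite !integral_lebesgue_Rn0//.
    by congr f; apply: eq_from_tnth => -[].
  by apply: measurableT_comp => //; exact: measurable_scale.
have mfs : measurable_fun setT (fun x => f (scale r x)).
  by apply: measurableT_comp => //; exact: measurable_scale.
rewrite !integral_lebesgue_RnS//.
have mF := measurable_consRn_l mf.
pose g (x : R) := \int[lebesgue_Rn n]_y f (consRn (x, y)).
have mg : measurable_fun setT g.
  exact: (@measurable_integral_r _ _ (measurableTypeR R) _ R (lebesgue_Rn n)
    (fun x y => f (consRn (x, y)))).
have g0 x : 0 <= g x by apply: integral_ge0 => y _; exact: f0.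
rewrite -[RHS](ge0_integral_scale r0 mg g0) exprS EFinM -muleA; congr (_ * _).
rewrite -ge0_integralTZl; last 3 first.
- by nn.
- exact: (@measurable_integral_r _ _ (measurableTypeR R) _ R (lebesgue_Rn n)
    (fun x y => f (scale r (consRn (x, y)))) (measurable_consRn_l mfs)).
- by move=> x; apply: integral_ge0 => y _; exact: f0.
apply: eq_integral => x _; rewrite -[RHS]ih.
- by congr (_ * _); apply: eq_integral => y _; rewrite scale_consRn.
- exact: (measurableT_comp mF (@measurable_pair1 _ _ (measurableTypeR R) _ _)).
- by move=> y.
Qed.

End EuclideanIntegrals.

Ltac meas1 ::= first [exact: measurable_tpow | exact: measurable_sqn
  | exact: measurable_dot | exact: measurable_scale | meas1b |
  lazymatch goal with
  | |- measurable_fun _ (fun x => sqn _) => apply: (measurableT_comp (@measurable_sqn _ _))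
  | |- measurable_fun _ (fun x => dot _ _) => apply: (measurableT_comp (@measurable_dot _ _ _))
  | |- measurable_fun _ (fun x => tpow _ _) => apply: (measurableT_comp (measurable_tpow _))
  end].
Ltac nn1 ::= first [exact: tpow_ge0 | exact: sqn_ge0 | nn1b].

Section RadialIntegrals.
Context (R : realType).
Local Notation mu := (@lebesgue_measure R).

Lemma eq_integral_neq0 (f g : R -> \bar R) :
  measurable_fun setT f -> measurable_fun setT g ->
  (forall s, s != 0 -> f s = g s) -> (\int[mu]_s f s = \int[mu]_s g s)%E.
Proof.
move=> mf mg fg.
have m0 : measurable ([set: R] `\ 0) by exact: measurableD.
rewrite -(@integral_setD1 _ f 0 setT)//; last exact: measurable_funTS.
rewrite -(@integral_setD1 _ g 0 setT)//; last exact: measurable_funTS.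
by apply: eq_integral => s /[!inE] -[_ /eqP s0]; exact: fg.
Qed.

Lemma powR_sqrt_exprn (s : R) d : 0 < s -> Num.sqrt s ^+ d = s `^ (d%:R / 2).
Proof.
move=> s0; rewrite -powR12_sqrt ?ltW// -powR_mulrn ?powR_ge0//.
by rewrite -powRrM mulrC.
Qed.

(* Integrating e^-s against s |-> \int psi(s - |x|^2) H(x) dx in two ways: the
   shift s = r + |x|^2 gives the right-hand side, and the scaling
   x = sqrt(s) y gives the Gamma integral on the left. *)
Lemma radial_integral d (H : d.-tuple R -> R) (psi : R -> R) (k : nat) (q : R) :
  measurable_fun setT H -> (forall x, 0 <= H x) ->
  (forall s x, 0 < s -> H (scale (Num.sqrt s) x) = s ^+ k * H x) ->
  measurable_fun setT psi -> (forall r, 0 <= psi r) ->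
  (forall r, r < 0 -> psi r = 0) ->
  (forall s r, 0 < s -> psi (s * r) = s `^ q * psi r) ->
  0 < d%:R / 2 + k%:R + q + 1 ->
  ((Gamma (d%:R / 2 + k%:R + q + 1))%:E *
     \int[lebesgue_Rn d]_x (psi (1 - sqn x)%R * H x)%:E =
   (\int[mu]_r (psi r * expR (- r))%:E) *
     \int[lebesgue_Rn d]_x (H x * expR (- sqn x))%:E)%E.
Proof.
move=> mH H0 hH mpsi psi0 psin hpsi; set kp := _ + 1 => kp0.
have ms := @measurable_sqn R d.
have mF : measurable_fun setT (fun z : d.-tuple R * measurableTypeR R =>
    (psi (z.2 - sqn z.1) * H z.1 * expR (- z.2))%:E).
  apply/measurable_EFinP; apply: measurable_funM; last by meas.
  apply: measurable_funM; last exact: measurableT_comp.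
  apply: (measurableT_comp mpsi); apply: measurable_funB; first by meas.
  exact: (measurableT_comp ms).
have mpc (c : R) : measurable_fun setT (fun s : R => psi (s - c)).
  by apply: (measurableT_comp mpsi); exact: measurable_funB.
have mpx (c : R) : measurable_fun setT (fun x : d.-tuple R => psi (c - sqn x)).
  by apply: (measurableT_comp mpsi); exact: measurable_funB.
have F0 (x : d.-tuple R) (s : R) : (0 <= (psi (s - sqn x) * H x * expR (- s))%:E)%E.
  by nn.
transitivity (\int[mu]_s \int[lebesgue_Rn d]_x
    (psi (s - sqn x)%R * H x * expR (- s))%:E)%E; last first.
  rewrite -(@tonelli_swap _ _ _ (measurableTypeR R) R (lebesgue_Rn d) mu
    (fun x s => (psi (s - sqn x)%R * H x * expR (- s))%:E))//.
  rewrite -ge0_integralZl//; last 3 first.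
  - apply/measurable_EFinP; apply: measurable_funM => //.
    apply: (measurableT_comp (@measurable_expR R)).
    exact: (measurableT_comp (@oppr_measurable R setT)).
  - by nn.
  - by nn.
  apply: eq_integral => x _.
  rewrite muleC -ge0_integralTZl; [|by nn|by meas|by nn].
  rewrite -[LHS](@ge0_integral_shift _ _ (sqn x)); last by nn.
    apply: eq_integral => r _; rewrite -EFinM addrK opprD expRD; congr EFin.
    by ring.
  by meas.
pose I := (\int[lebesgue_Rn d]_x (psi (1 - sqn x)%R * H x)%:E)%E.
rewrite -/I -EGammaE// /EGamma -ge0_integralZr//; last 3 first.
- by meas.
- by nn.
- by rewrite /I; nn.
(* The scaling by sqrt s below needs s > 0. For s < 0 both sides vanish, and the single point s = 0
   is negligible. *)
apply: eq_integral_neq0.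
- by apply: emeasurable_funM; meas.
- apply: (@measurable_integral_r _ _ (measurableTypeR R) (d.-tuple R) R (lebesgue_Rn d)
    (fun s x => (psi (s - sqn x)%R * H x * expR (- s))%:E)); last by nn.
  exact: (measurableT_comp mF (@measurable_swap _ _ _ _)).
move=> s sn0; have [s0|s0|/eqP s0] := ltgtP 0 s; last 2 first.
- rewrite (tpow0 _ (ltW s0)) mul0r mul0e; apply/esym/integral0_eq => x _.
  rewrite psin ?mul0r//.
  by rewrite (le_lt_trans _ s0)// gerBl sqn_ge0.
- by rewrite eq_sym (negbTE sn0) in s0.
have rs0 : Num.sqrt s != 0 by rewrite gt_eqF// sqrtr_gt0.
rewrite -[RHS](integral_scale rs0)//; last by meas.
transitivity ((`|Num.sqrt s| ^+ d)%:E * \int[lebesgue_Rn d]_x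
    ((s ^+ k * s `^ q * expR (- s)) * (psi (1 - sqn x) * H x))%:E)%E; last first.
  congr (_ * _)%E; apply: eq_integral => x _; congr EFin.
  rewrite hH// sqn_scale sqr_sqrtr ?ltW//.
  rewrite (_ : s - s * sqn x = s * (1 - sqn x)); last by ring.
  by rewrite hpsi//; ring.
rewrite ge0_integralTZlR; [|by rewrite !mulr_ge0 ?exprn_ge0 ?powR_ge0 ?expR_ge0 ?ltW| |by nn]; last first.
  by have mp1 := mpx 1; apply: measurable_funM.
rewrite muleA; congr (_ * _)%E; rewrite -EFinM (tpowE _ s0); congr EFin.
rewrite ger0_norm ?sqrtr_ge0// powR_sqrt_exprn// -[s ^+ k]powR_mulrn ?ltW//.
have tD (u v : R) : s `^ (u + v) = s `^ u * s `^ v.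
  by rewrite powRD// sn0 implybT.
rewrite /kp addrK !tD; ring.
Qed.

End RadialIntegrals.

Section Heaviside.
Context (R : realType).
Local Notation mu := (@lebesgue_measure R).

(** Equal to 1 at 0, unlike [tpow 1], so that [heav (1 - sqn x)] is the indicator of the closed ball
    that appears in [sphere_prob]. *)
Definition heav (r : R) : R := if 0 <= r then 1 else 0.

Lemma heav_ge0 r : 0 <= heav r. Proof. by rewrite /heav; case: ifP. Qed.

Lemma measurable_heav : measurable_fun setT heav.
Proof. by rewrite /heav; meas. Qed.

Lemma heav_lt0 r : r < 0 -> heav r = 0.
Proof. by rewrite /heav ltNge => /negbTE ->. Qed.

Lemma heavM s r : 0 < s -> heav (s * r) = s `^ 0 * heav r.
Proof. by move=> s0; rewrite powRr0 mul1r /heav pmulr_rge0. Qed.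

End Heaviside.

Ltac nn1 ::= first [exact: tpow_ge0 | exact: sqn_ge0 | exact: heav_ge0 | nn1b].
Ltac meas1 ::= first [exact: measurable_tpow | exact: measurable_sqn
  | exact: measurable_dot | exact: measurable_scale | exact: measurable_heav | meas1b |
  lazymatch goal with
  | |- measurable_fun _ (fun x => sqn _) => apply: (measurableT_comp (@measurable_sqn _ _))
  | |- measurable_fun _ (fun x => dot _ _) => apply: (measurableT_comp (@measurable_dot _ _ _))
  | |- measurable_fun _ (fun x => tpow _ _) => apply: (measurableT_comp (measurable_tpow _))
  | |- measurable_fun _ (fun x => heav _) => apply: (measurableT_comp (@measurable_heav _))
  end].

Section GaussianMoments.
Context (R : realType).
Local Notation mu := (@lebesgue_measure R).

Lemma integral_heav_exp : (\int[mu]_r (heav r * expR (- r))%:E = 1)%E.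
Proof.
rewrite -(@EGamma1 R) /EGamma; apply: eq_integral_neq0.
- by have mh := measurable_heav; meas.
- by meas.
move=> s s0; congr (_ * _)%:E.
rewrite /heav /tpow le_eqVlt eq_sym (negbTE s0) /=; case: ifP => // _.
by rewrite subrr powRr0.
Qed.

Lemma radial_heav d (H : d.-tuple R -> R) (k : nat) :
  measurable_fun setT H -> (forall x, 0 <= H x) ->
  (forall s x, 0 < s -> H (scale (Num.sqrt s) x) = s ^+ k * H x) ->
  ((Gamma (d%:R / 2 + k%:R + 1))%:E *
     \int[lebesgue_Rn d]_x (heav (1 - sqn x)%R * H x)%:E =
     \int[lebesgue_Rn d]_x (H x * expR (- sqn x))%:E)%E.
Proof.
move=> mH H0 hH.
have kp0 : 0 < d%:R / 2 + k%:R + 0 + 1 :> R.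
  by rewrite addr0 ltr_wpDl// addr_ge0// divr_ge0.
have := radial_integral mH H0 hH (@measurable_heav R) (@heav_ge0 R) (@heav_lt0 R) (@heavM R) kp0.
by rewrite [_ + 0]addr0 integral_heav_exp mul1e.
Qed.

Lemma radial_tpow d (H : d.-tuple R -> R) (k : nat) (p : R) : 0 < p ->
  measurable_fun setT H -> (forall x, 0 <= H x) ->
  (forall s x, 0 < s -> H (scale (Num.sqrt s) x) = s ^+ k * H x) ->
  ((Gamma (d%:R / 2 + k%:R + p))%:E *
     \int[lebesgue_Rn d]_x (tpow p (1 - sqn x)%R * H x)%:E =
   (Gamma p)%:E * \int[lebesgue_Rn d]_x (H x * expR (- sqn x))%:E)%E.
Proof.
move=> p0 mH H0 hH.
have kpE : d%:R / 2 + k%:R + (p - 1) + 1 = d%:R / 2 + k%:R + p by rewrite -addrA subrK.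
have kp0 : 0 < d%:R / 2 + k%:R + (p - 1) + 1.
  by rewrite kpE ltr_wpDl// addr_ge0// divr_ge0.
have := radial_integral mH H0 hH (measurable_tpow p) (tpow_ge0 p)
  (fun r r0 => tpow0 p (ltW r0)) (@tpowM R p) kp0.
by rewrite kpE -/(EGamma p) EGammaE.
Qed.

Lemma integral_even_power k :
  (\int[mu]_x (heav (1 - x ^+ 2) * x ^+ k.*2)%:E = (2 / (k.*2.+1)%:R)%:E)%E.
Proof.
transitivity (\int[mu]_(x in `[(-1)%R, 1%R]) (x ^+ k.*2)%:E)%E.
  rewrite [RHS]integral_mkcond; apply: eq_integral => x _.
  rewrite patchE mem_setE in_itv/= /heav subr_ge0.
  rewrite -(real_normK (num_real x)) expr_le1// ler_norml.
  by case: ifP => _; rewrite ?mul1r ?mul0r.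
have k0 : (k.*2.+1)%:R != 0 :> R by rewrite pnatr_eq0.
have dF (x : R) : is_derive x 1 (fun y : R => y ^+ k.*2.+1 * (k.*2.+1)%:R^-1) (x ^+ k.*2).
  have pn : is_derive x 1 (fun y : R => y ^+ k.*2.+1) ((k.*2.+1)%:R * x ^+ k.*2).
    by split; [exact: exprn_derivable|rewrite exp_derive /GRing.scale/= mulr1].
  by apply: is_derive_eq; rewrite /GRing.scale/=; field.
rewrite (@continuous_FTC2 _ _ (fun x : R => x ^+ k.*2.+1 * (k.*2.+1)%:R^-1))//.
- rewrite -EFinB -mulrBl !expr1n exprS -mul2n exprM sqrrN !expr1n.
  by congr EFin; ring.
- apply: continuous_subspaceT => x; exact: exprn_continuous.
- have cF (x : R) : {for x, continuous (fun y : R => y ^+ k.*2.+1 * (k.*2.+1)%:R^-1)}.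
    apply/differentiable_continuous/derivable1_diffP.
    by have [] := dF x.
  split.
  + by move=> x _; have [] := dF x.
  + by apply: cvg_at_right_filter; exact: cF.
  + by apply: cvg_at_left_filter; exact: cF.
- by move=> x _; rewrite derive1E; have [_ ->] := dF x.
Qed.

Definition tup1 (x : R) : 1.-tuple R := [tuple x].

Lemma integral_lebesgue_Rn1 (f : 1.-tuple R -> \bar R) :
  measurable_fun setT f -> (forall x, 0 <= f x)%E ->
  (\int[lebesgue_Rn 1]_z f z = \int[mu]_x f (tup1 x))%E.
Proof.
move=> mf f0; rewrite integral_lebesgue_RnS//; apply: eq_integral => x _.
rewrite integral_lebesgue_Rn0.
  by congr f; exact/val_inj.
exact: (measurableT_comp (measurable_consRn_l mf)
  (@measurable_pair1 _ _ (measurableTypeR R) _ x)).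
Qed.

(** [radial_heav] in dimension one, read backwards: the integral over [-1, 1] is elementary, and its
    value 2 / (2k + 1) cancels the factor 1/2 + k of Gamma(1/2 + k + 1). *)
Lemma gauss_moment_Gamma k :
  (\int[mu]_x (x ^+ k.*2 * expR (- x ^+ 2))%:E = (Gamma (2^-1 + k%:R))%:E)%E.
Proof.
pose H (x : 1.-tuple R) := tnth x ord0 ^+ k.*2.
have mH : measurable_fun setT H by apply: measurable_funX; exact: measurable_tnth.
have H0 x : 0 <= H x by rewrite /H -mul2n exprM exprn_ge0// sqr_ge0.
have hH s x : 0 < s -> H (scale (Num.sqrt s) x) = s ^+ k * H x.
  by move=> s0; rewrite /H tnth_mktuple exprMn -{1}mul2n exprM sqr_sqrtr// ltW.
have sq1 x : sqn (tup1 x) = x ^+ 2 by rewrite /sqn /dot big_ord1 expr2.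
have := radial_heav mH H0 hH.
rewrite !integral_lebesgue_Rn1; [|by meas|by nn|by meas|by nn].
have e1 : (\int[mu]_x (H (tup1 x) * expR (- sqn (tup1 x)))%:E =
    \int[mu]_x (x ^+ k.*2 * expR (- x ^+ 2))%:E)%E.
  by apply: eq_integral => x _; rewrite sq1.
have e2 : (\int[mu]_x (heav (1 - sqn (tup1 x)) * H (tup1 x))%:E =
    (2 / (k.*2.+1)%:R)%:E)%E.
  by rewrite -integral_even_power; apply: eq_integral => x _; rewrite sq1.
rewrite e1 e2 => <-; rewrite -EFinM; congr EFin.
have hk : 0 < 2^-1 + k%:R :> R by rewrite ltr_pwDl// invr_gt0.
have := GammaS hk; rewrite (_ : 2^-1 + k%:R + 1 = 1 / 2 + k%:R + 1) ?div1r// => ->.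
have k0 : (k.*2.+1)%:R != 0 :> R by rewrite pnatr_eq0.
have k2 : (k.*2.+1)%:R = 2 * k%:R + 1 :> R by rewrite -natr1 -mul2n natrM.
rewrite k2 in k0 *; move: (Gamma _) => g; field.
by rewrite k0.
Qed.

Lemma Gamma_half : Gamma (2^-1 : R) = Num.sqrt pi.
Proof.
have := gauss_moment_Gamma 0; rewrite addr0 => E; apply: EFin_inj.
rewrite -E -integralT_gauss; apply: eq_integral => x _.
by rewrite expr0 mul1r.
Qed.

Lemma gauss_moment k :
  (\int[mu]_x (x ^+ k.*2 * expR (- x ^+ 2))%:E =
   (rising 2^-1 k * Num.sqrt pi)%:E)%E.
Proof. by rewrite gauss_moment_Gamma rising_Gamma ?Gamma_half// invr_gt0. Qed.

End GaussianMoments.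

Section EvenBinomial.
Context (R : realType).
Implicit Types a b s t : R.

Lemma sum_even k (F : nat -> R) :
  \sum_(i < k.*2.+1) (if odd i then 0 else F i) = \sum_(j < k.+1) F j.*2.
Proof.
elim: k => [|k ih]; first by rewrite !big_ord_recr !big_ord0/=.
rewrite doubleS [RHS]big_ord_recr/= -ih.
rewrite [in LHS]big_ord_recr [in LHS]big_ord_recr/=.
by rewrite !odd_double /= addr0.
Qed.

Lemma even_binomial a b k :
  2^-1 * ((a + b) ^+ k.*2 + (- a + b) ^+ k.*2) =
  \sum_(j < k.+1) a ^+ j.*2 * b ^+ (k - j).*2 *+ 'C(k.*2, j.*2).
Proof.
transitivity (\sum_(j < k.+1) a ^+ j.*2 * b ^+ (k.*2 - j.*2) *+ 'C(k.*2, j.*2)).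
  rewrite -(sum_even k (fun i => a ^+ i * b ^+ (k.*2 - i) *+ 'C(k.*2, i))).
  rewrite ![_ + b]addrC !exprDn -big_split/= mulr_sumr; apply: eq_bigr => i _.
  rewrite exprNn -signr_odd -mulrnDl; case: odd.
    by rewrite expr1 mulN1r mulrN subrr mul0rn mulr0.
  by rewrite expr0 mul1r mulrnAr; congr (_ *+ _); move: (a ^+ i) => u; field.
by apply: eq_bigr => j _; rewrite doubleB.
Qed.

Lemma rising_half j : rising 2^-1 j = (j.*2)`!%:R / (4 ^+ j * j`!%:R) :> R.
Proof.
elim: j => [|j ih]; first by rewrite rising0 fact0 expr0 mulr1 divr1.
rewrite risingS ih doubleS !factS exprS !natrM -muln2.
have := fact_neq0 R j; have : 4 ^+ j != 0 :> R by rewrite expf_neq0// pnatr_eq0.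
move: (_`!%:R) (j`!%:R) (4 ^+ j) => e f g g0 f0.
have j0 : j.+1%:R != 0 :> R by rewrite pnatr_eq0.
rewrite -!natr1 natrM in j0 *; field.
by rewrite g0 f0 j0.
Qed.

(** Since (1/2)_j = (2j)! / (4^j j!), the product of (1/2)_j, (1/2)_(k-j) and the binomial
    coefficient of 2k over 2j is (1/2)_k times that of k over j, and the binomial formula
    remains. *)
Lemma even_binomial_rising s t k :
  \sum_(j < k.+1) (rising 2^-1 j * s ^+ j) * (rising 2^-1 (k - j) * t ^+ (k - j))
     *+ 'C(k.*2, j.*2) = rising 2^-1 k * (s + t) ^+ k.
Proof.
rewrite addrC exprDn mulr_sumr; apply: eq_bigr => j _.
have jk : (j <= k)%N by rewrite -ltnS.
have jk2 : (j.*2 <= k.*2)%N by rewrite leq_double.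
have B1 := congr1 (fun n => n%:R : R) (bin_fact jk).
have B2 := congr1 (fun n => n%:R : R) (bin_fact jk2).
rewrite -doubleB !natrM in B2; rewrite !natrM in B1.
rewrite !rising_half -[LHS]mulr_natr -[X in _ = _ * X]mulr_natr.
have -> : 4 ^+ k = 4 ^+ j * 4 ^+ (k - j) :> R by rewrite -exprD subnKC.
have := fact_neq0 R j; have := fact_neq0 R (k - j); have := fact_neq0 R k.
have := fact_neq0 R j.*2; have := fact_neq0 R (k - j).*2.
have : 4 ^+ j != 0 :> R by rewrite expf_neq0// pnatr_eq0.
have : 4 ^+ (k - j) != 0 :> R by rewrite expf_neq0// pnatr_eq0.
move: B1 B2; move: (4 ^+ j) (4 ^+ (k - j)) (j`!%:R) ((k - j)`!%:R) (k`!%:R) => a b c d e.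
move: ((j.*2)`!%:R). move: (((k - j).*2)`!%:R). move: ((k.*2)`!%:R). move: ('C(k, j)%:R : R) ('C(_, _)%:R).
move: (s ^+ j) (t ^+ _) => S T u v w x y B1 B2 b0 a0 v0 u0 e0 d0 c0.
rewrite -B2 -B1 in e0 *; field.
move: e0; rewrite mulf_eq0 negb_or => /andP[v1 _].
by rewrite a0 b0 c0 d0 v1.
Qed.

End EvenBinomial.

Section GaussianMomentsRn.
Context (R : realType).
Local Notation mu := (@lebesgue_measure R).
Local Open Scope ereal_scope.

Lemma integral_symmetrize (G : R -> \bar R) : measurable_fun setT G ->
  (forall x, 0 <= G x) ->
  \int[mu]_x G x = \int[mu]_x ((2^-1)%:E * (G x + G (- x)%R)).
Proof.
move=> mG G0.
have mG' : measurable_fun setT (fun x : R => G (- x)%R).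
  by apply: (measurableT_comp mG).
rewrite ge0_integralTZl; [|by nn|by apply: emeasurable_funD|by nn].
rewrite ge0_integralD//.
have -> : \int[mu]_x G (- x)%R = \int[mu]_x G x.
  rewrite -[RHS](ge0_integral_reflect 0 mG G0).
  by apply: eq_integral => x _; rewrite sub0r.
have : 0 <= \int[mu]_x G x by nn.
case: (\int[mu]_x G x) => [r _|_|//].
  by rewrite -EFinD -EFinM; congr EFin; field.
by rewrite addye// gt0_muley// lte_fin invr_gt0.
Qed.

(** Induction on d by splitting off the first coordinate. Rotation invariance of the Gaussian is not
    invoked; [even_binomial_rising] plays its part by assembling the powers of a^2 and |xi'|^2 into
    powers of |xi|^2. *)
Lemma gauss_moment_Rn d (xi : d.-tuple R) k :
  \int[lebesgue_Rn d]_x (dot xi x ^+ k.*2 * expR (- sqn x))%:E =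
  (Num.sqrt pi ^+ d * rising 2^-1 k * sqn xi ^+ k)%:E.
Proof.
elim: d xi k => [|d ih] xi k.
  rewrite integral_lebesgue_Rn0; last by meas.
  rewrite /sqn /dot !big_ord0 oppr0 expR0 mulr1 expr0 mul1r.
  by case: k => [|k]; rewrite ?expr0 ?rising0 ?mulr1// doubleS !expr0n/= mulr0.
rewrite integral_lebesgue_RnS; [|by meas|]; last first.
  by move=> x; rewrite lee_fin mulr_ge0 ?expR_ge0// exprn_double_ge0.
set a := thead xi; set xi' := behead_tuple xi.
have sqE : sqn xi = (a ^+ 2 + sqn xi')%R.
  have xiE : xi = consRn (a, xi') by rewrite [LHS]tuple_eta; exact: val_inj.
  by rewrite {1}xiE sqn_consRn.
pose h (x : R) (y : d.-tuple R) : R :=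
  ((a * x + dot xi' y) ^+ k.*2 * expR (- (x ^+ 2 + sqn y)))%R.
pose G (x : R) := \int[lebesgue_Rn d]_y (h x y)%:E.
have h0 x y : (0 <= h x y)%R by rewrite mulr_ge0 ?expR_ge0// exprn_double_ge0.
have mh x : measurable_fun setT (h x) by rewrite /h; meas.
have mG : measurable_fun setT G.
  apply: (@measurable_integral_r _ _ (measurableTypeR R) _ R (lebesgue_Rn d)
    (fun x y => (h x y)%:E)); last by move=> x y; rewrite lee_fin.
  pose f (x : d.+1.-tuple R) := (dot xi x ^+ k.*2 * expR (- sqn x))%:E.
  have mf : measurable_fun setT f by rewrite /f; meas.
  rewrite (_ : (fun z => _) = fun z => f (consRn z)).
    exact: (measurable_consRn_l mf).
  by apply/funext => -[x y]; rewrite /f dot_consRn sqn_consRn.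
have G0 x : 0 <= G x by rewrite /G; nn.
transitivity (\int[mu]_x G x).
  apply: eq_integral => x _; apply: eq_integral => y _.
  by rewrite dot_consRn sqn_consRn.
(* In the expansion of (a x + <xi', y>)^(2k) the terms odd in x may be negative. Averaging over x
   and -x removes them, and the sum and the integrals can then be exchanged. *)
rewrite integral_symmetrize//.
pose c j : R := ((a ^+ j.*2 *+ 'C(k.*2, j.*2)) *
  (Num.sqrt pi ^+ d * rising 2^-1 (k - j) * sqn xi' ^+ (k - j)))%R.
have c0 j : (0 <= c j)%R.
  rewrite /c !mulr_ge0 ?exprn_ge0 ?sqn_ge0 ?sqrtr_ge0 ?rising_ge0//.
  by rewrite mulrn_wge0// exprn_double_ge0.
transitivity (\int[mu]_x \sum_(j < k.+1)
    ((c j)%:E * (x ^+ j.*2 * expR (- x ^+ 2))%:E)).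
  apply: eq_integral => x _.
  have mhE z : measurable_fun setT (fun y => (h z y)%:E) by exact/measurable_EFinP.
  have hE0 z y : 0 <= (h z y)%:E by rewrite lee_fin.
  rewrite /G -ge0_integralD//.
  rewrite -ge0_integralTZl; last 3 first.
  - by nn.
  - exact: emeasurable_funD.
  - by nn.
  transitivity (\int[lebesgue_Rn d]_y \sum_(j < k.+1)
     ((a ^+ j.*2 *+ 'C(k.*2, j.*2) * (x ^+ j.*2 * expR (- x ^+ 2)))%:E *
      (dot xi' y ^+ (k - j).*2 * expR (- sqn y))%:E)).
    apply: eq_integral => y _.
    rewrite /h sqrrN -EFinD -EFinM sumEFin; congr EFin.
    rewrite -mulrDl mulrA mulrN even_binomial mulr_suml; apply: eq_bigr => j _.
    rewrite opprD expRD exprMn -[X in (X * _)%R = _]mulr_natr.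
    rewrite -[X in _ = (X * _ * _)%R]mulr_natr.
    move: (expR _) (expR _) ('C(_, _)%:R : R) => u v w.
    by move: (a ^+ _)%R (x ^+ _)%R (dot _ _ ^+ _)%R => A X Y; ring.
  rewrite ge0_integral_sum//; last 2 first.
  - by move=> j; meas.
  - by move=> j y _; rewrite -EFinM lee_fin; nn.
  apply: eq_bigr => j _; rewrite ge0_integralTZl; last 3 first.
  - by nn.
  - by meas.
  - by move=> y; rewrite lee_fin; nn.
  by rewrite ih /c -!EFinM; congr EFin; move: (expR _) => u; ring.
rewrite ge0_integral_sum//; last 2 first.
- by move=> j; meas.
- by move=> j x _; apply: mule_ge0; rewrite lee_fin// mulr_ge0 ?expR_ge0// exprn_double_ge0.
under eq_bigr => j _.
  rewrite ge0_integralTZl; last 3 first.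
  - by [].
  - by meas.
  - by move=> x; rewrite lee_fin mulr_ge0 ?expR_ge0// exprn_double_ge0.
  rewrite gauss_moment -EFinM /c; over.
rewrite sumEFin sqE; congr EFin.
rewrite -[RHS]mulrA -even_binomial_rising mulr_sumr; apply: eq_bigr => j _.
rewrite -[in (a ^+ j.*2)%R]mul2n exprM [(Num.sqrt pi ^+ d.+1)%R]exprS.
rewrite -[X in (X * _ * _)%R = _]mulr_natr -[X in _ = (_ * X)%R]mulr_natr.
move: ('C(_, _)%:R : R) => C; move: (Num.sqrt pi ^+ d)%R => S; move: (Num.sqrt pi) => s.
by move: (rising _ j) (rising _ _) (_ ^+ j)%R (sqn _ ^+ _)%R => u v w z; ring.
Qed.

End GaussianMomentsRn.

(** * Moment generating functions of the ball and the sphere *)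

Section HyperbolicCosine.
Context (R : realType).
Local Open Scope ereal_scope.

(** The exponential series is taken along partial sums of even length 2n: going from n to n + 1 adds
    one even term and one odd term, and the odd ones cancel between y and -y. *)
Lemma cosh_series (y : R) :
  ((2^-1 * (expR y + expR (- y)))%R)%:E =
  \sum_(k <oo) (y ^+ k.*2 / (k.*2)`!%:R)%:E.
Proof.
pose s (z : R) n := (series (exp_coeff z) n : R).
have sE z : (s z n @[n --> \oo] --> expR z)%classic.
  exact: is_cvg_series_exp_coeff.
have s2 z : (s z n.*2 @[n --> \oo] --> expR z)%classic.
  apply: (cvg_comp _ _ _ (sE z)).
  move=> A [N _ hN]; exists N => // n /= Nn; apply: hN.
  by rewrite /= (leq_trans Nn)// -addnn leq_addr.
apply/esym/cvg_lim => //.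
have E n : (\sum_(0 <= k < n) (y ^+ k.*2 / (k.*2)`!%:R)%:E)%E =
    (2^-1 * (s y n.*2 + s (- y) n.*2))%:E.
  rewrite sumEFin big_mkord; congr EFin.
  elim: n => [|n ih].
    by rewrite big_ord0 /s /series /= !big_geq// addr0 mulr0.
  rewrite big_ord_recr /= ih doubleS /s /series /= !big_nat_recr//=.
  have Ne : ((- y) ^+ n.*2 = y ^+ n.*2)%R.
    by rewrite exprNn -signr_odd odd_double expr0 mul1r.
  have No : ((- y) ^+ n.*2.+1 = - y ^+ n.*2.+1)%R.
    by rewrite exprSr Ne exprSr mulrN.
  rewrite /exp_coeff/= Ne No mulNr.
  move: (\sum_(0 <= i < n.*2) _)%R (\sum_(0 <= i < n.*2) _)%R => a b.
  by move: (_ / _)%R (_ / _)%R => u v; field.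
under eq_fun do rewrite E.
apply: cvg_EFin; first exact: nearW.
by apply: cvgMr; apply: cvgD.
Qed.

End HyperbolicCosine.

Section EvenMGF.
Context (R : realType) (d : nat).
Local Open Scope ereal_scope.
Implicit Type F : d.-tuple R -> R.

Lemma integral_Rn_symmetrize (G : d.-tuple R -> \bar R) :
  measurable_fun setT G -> (forall x, 0 <= G x) ->
  \int[lebesgue_Rn d]_x G x =
  \int[lebesgue_Rn d]_x ((2^-1)%:E * (G x + G (scale (-1) x))).
Proof.
move=> mG G0.
have mG' : measurable_fun setT (fun x => G (scale (-1) x)).
  by apply: (measurableT_comp mG); exact: measurable_scale.
rewrite ge0_integralTZl; [|by nn|by apply: emeasurable_funD|by nn].
rewrite ge0_integralD//.
have -> : \int[lebesgue_Rn d]_x G (scale (-1) x) = \int[lebesgue_Rn d]_x G x.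
  have n1 : (-1 != 0 :> R)%R by rewrite oppr_eq0 oner_eq0.
  by rewrite -[RHS](integral_scale n1)// normrN1 expr1n mul1e.
have : 0 <= \int[lebesgue_Rn d]_x G x by nn.
case: (\int[lebesgue_Rn d]_x G x) => [r _|_|//].
  by rewrite -EFinD -EFinM; congr EFin; field.
by rewrite addye// gt0_muley// lte_fin invr_gt0.
Qed.

(** Symmetry replaces the exponential by cosh, whose series has nonnegative terms, so integration
    term by term needs no integrability. *)
Lemma even_mgf F (v : d.-tuple R -> R) :
  measurable_fun setT F -> (forall x, 0 <= F x)%R ->
  measurable_fun setT v -> (forall x, v (scale (-1) x) = - v x)%R ->
  (forall x, F (scale (-1) x) = F x) ->
  \int[lebesgue_Rn d]_x (expR (v x) * F x)%:E =
  \sum_(k <oo) ((((k.*2)`!%:R)^-1)%:E *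
    \int[lebesgue_Rn d]_x (v x ^+ k.*2 * F x)%:E).
Proof.
move=> mF F0 mv vN FN.
have mt k : measurable_fun setT (fun x => (v x ^+ k.*2 * F x)%:E).
  by apply/measurable_EFinP; apply: measurable_funM => //; exact: measurable_funX.
have t0 k x : 0 <= (v x ^+ k.*2 * F x)%:E by nn.
have f0 k : (0 <= ((k.*2)`!%:R)^-1 :> R)%R by rewrite invr_ge0.
transitivity (\int[lebesgue_Rn d]_x \sum_(k <oo)
   (((k.*2)`!%:R^-1)%:E * (v x ^+ k.*2 * F x)%:E)); last first.
  rewrite integral_nneseries//.
  - apply: eq_eseriesr => k _; rewrite ge0_integralTZl; [by []|exact: f0|exact: mt|exact: t0].
  - by move=> k; apply: emeasurable_funM; [exact: measurable_cst|exact: mt].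
  - by move=> k x _; apply: mule_ge0; [rewrite lee_fin; exact: f0|exact: t0].
rewrite integral_Rn_symmetrize; last 2 first.
- apply/measurable_EFinP; apply: measurable_funM => //.
  exact: (measurableT_comp (@measurable_expR R)).
- by nn.
apply: eq_integral => x _.
rewrite vN FN -EFinD -EFinM -mulrDl mulrA.
rewrite EFinM cosh_series muleC -nneseriesZl; last first.
  by move=> k _; rewrite lee_fin divr_ge0// exprn_double_ge0.
apply: eq_eseriesr => k _; rewrite -!EFinM; congr EFin.
by rewrite mulrC -mulrA mulrCA.
Qed.

End EvenMGF.

Section BallAndSphere.
Context (R : realType) (d : nat).
Local Notation mu := (@lebesgue_measure R).
Local Open Scope ereal_scope.
Implicit Types (xi x : d.-tuple R).

(* Up to a constant factor, sqrt(z)^(1 - c) I_(c - 1)(sqrt z), where I is the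
   modified Bessel function of the first kind. *)
Definition bessel_series (c z : R) : \bar R :=
  \sum_(k <oo) (z ^+ k / (4 ^+ k * k`!%:R * rising c k))%:E.

Lemma measurable_dotX xi k : measurable_fun setT (fun x => dot xi x ^+ k)%R.
Proof. by meas. Qed.

Lemma dotX_scale xi k s x : (0 < s)%R ->
  (dot xi (scale (Num.sqrt s) x) ^+ k.*2 = s ^+ k * dot xi x ^+ k.*2)%R.
Proof.
by move=> s0; rewrite dot_scale exprMn -{1}mul2n exprM sqr_sqrtr// ltW.
Qed.

Lemma sqn_scaleN x : sqn (scale (-1) x) = sqn x.
Proof. by rewrite sqn_scale sqrrN expr1n mul1r. Qed.

Lemma ball_moment xi k p : (0 < p)%R ->
  \int[lebesgue_Rn d]_x (dot xi x ^+ k.*2 * tpow p (1 - sqn x))%:E =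
  (Gamma p / Gamma (d%:R / 2 + p) * Num.sqrt pi ^+ d *
   (rising 2^-1 k / rising (d%:R / 2 + p) k * sqn xi ^+ k))%:E.
Proof.
move=> p0; have dp0 : (0 < d%:R / 2 + p)%R by rewrite ltr_wpDl// divr_ge0.
have := radial_tpow p0 (measurable_dotX xi k.*2)
  (fun x => exprn_double_ge0 (dot xi x) k) (dotX_scale xi k).
rewrite gauss_moment_Rn.
rewrite (_ : d%:R / 2 + k%:R + p = d%:R / 2 + p + k%:R)%R; last by ring.
rewrite rising_Gamma//.
have := Gamma_gt0 dp0; have := rising_gt0 k dp0.
move: (Gamma p) (Gamma _) (rising (_ + p) k) => g h r r0 h0.
have rh : (0 < r * h)%R by exact: mulr_gt0.
move=> E.
rewrite (_ : \int[_]_x _ = \int[lebesgue_Rn d]_x (tpow p (1 - sqn x) * dot xi x ^+ k.*2)%:E); last first.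
  by apply: eq_integral => x _; rewrite mulrC.
rewrite -[LHS]mul1e (_ : 1%E = ((r * h)^-1)%:E * (r * h)%:E); last first.
  by rewrite -EFinM mulVf// gt_eqF.
rewrite -muleA E -!EFinM; congr EFin; field.
by rewrite !gt_eqF.
Qed.

Lemma ball_mgf xi p : (0 < p)%R ->
  \int[lebesgue_Rn d]_x (expR (dot xi x) * tpow p (1 - sqn x))%:E =
  (Gamma p / Gamma (d%:R / 2 + p) * Num.sqrt pi ^+ d)%:E *
  bessel_series (d%:R / 2 + p) (sqn xi).
Proof.
move=> p0; have dp0 : (0 < d%:R / 2 + p)%R by rewrite ltr_wpDl// divr_ge0.
rewrite even_mgf; last 5 first.
- apply: (measurableT_comp (measurable_tpow _)); meas.
- by nn.
- exact: measurable_dot.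
- by move=> x; rewrite dot_scale mulN1r.
- by move=> x; rewrite sqn_scaleN.
rewrite -nneseriesZl; last first.
  move=> k _; rewrite lee_fin divr_ge0 ?exprn_ge0 ?sqn_ge0//.
  by rewrite !mulr_ge0 ?exprn_ge0// rising_ge0.
apply: eq_eseriesr => k _; rewrite ball_moment// -!EFinM; congr EFin.
rewrite rising_half.
have := rising_gt0 k dp0; have := fact_neq0 R k; have := fact_neq0 R k.*2.
have : (4 ^+ k != 0 :> R)%R by rewrite expf_neq0// pnatr_eq0.
move: (Gamma p / _ * _)%R (rising _ k) ((k.*2)`!%:R) (k`!%:R) (4 ^+ k)%R => A a b c e.
move=> e0 b0 c0 a0; field.
by rewrite e0 b0 c0 gt_eqF.
Qed.

End BallAndSphere.

Section SphereMoments.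
Context (R : realType) (d : nat).
Local Notation mu := (@lebesgue_measure R).
Implicit Types (xi x : d.-tuple R).

Lemma norm2_ge0 x : 0 <= norm2 x. Proof. by rewrite norm2E sqrtr_ge0. Qed.

Lemma norm2_scale r x : norm2 (scale r x) = `|r| * norm2 x.
Proof. by rewrite !norm2E sqn_scale sqrtrM ?sqr_ge0// sqrtr_sqr. Qed.

Lemma measurable_norm2 : measurable_fun setT (@norm2 R d).
Proof.
rewrite (_ : @norm2 R d = fun x => sqn x `^ 2^-1); last first.
  by apply/funext => x; rewrite powR12_sqrt ?sqn_ge0// norm2E.
by meas.
Qed.

Lemma measurable_normalize : measurable_fun setT (@normalize R d).
Proof.
apply/measurable_fun_tnthP => i.
rewrite (_ : _ \o _ = fun x => tnth x i * (sqn x `^ (- 2^-1))); last first.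
  apply/funext => x /=.
  by rewrite tnth_mktuple powRN powR12_sqrt ?sqn_ge0// norm2E.
by apply: measurable_funM; [exact: measurable_tnth|meas].
Qed.

Lemma normalize_scale r x : 0 < r -> normalize (scale r x) = normalize x.
Proof.
move=> r0; apply: eq_from_tnth => i.
rewrite !tnth_mktuple norm2_scale gtr0_norm//.
have [->|n0] := eqVneq (norm2 x) 0; first by rewrite mulr0 invr0 !mulr0.
by field; rewrite n0 gt_eqF.
Qed.

Lemma normalize_scaleN x : normalize (scale (-1) x) = scale (-1) (normalize x).
Proof.
apply: eq_from_tnth => i.
by rewrite !tnth_mktuple norm2_scale normrN1 mul1r mulrA.
Qed.

Lemma dot_normalize xi x : dot xi (normalize x) = dot xi x / norm2 x.
Proof.
rewrite /dot mulr_suml; apply: eq_bigr => i _.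
by rewrite tnth_mktuple mulrA.
Qed.

Lemma sqn_eq0 x : sqn x = 0 -> forall i, tnth x i = 0.
Proof.
move=> /eqP; rewrite psumr_eq0 => [/allP h i|i _]; last by rewrite -expr2 sqr_ge0.
by have := h i (mem_index_enum i); rewrite /= mulf_eq0 orbb => /eqP.
Qed.

Lemma dot_normalize_exprn xi x k :
  sqn x ^+ k * dot xi (normalize x) ^+ k.*2 = dot xi x ^+ k.*2.
Proof.
rewrite dot_normalize -norm2_sqr -exprM mul2n -exprMn.
have [n0|n0] := eqVneq (norm2 x) 0; last by rewrite mulrC divfK.
have s0 : sqn x = 0 by rewrite -norm2_sqr n0 expr0n.
rewrite n0 mul0r (_ : dot xi x = 0)// /dot big1// => i _.
by rewrite (sqn_eq0 s0) mulr0.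
Qed.

Lemma dot_normalize_le xi x :
  `|dot xi (normalize x)| <= \sum_(i < d) `|tnth xi i|.
Proof.
apply: le_trans (ler_norm_sum _ _ _) _; apply: ler_sum => i _.
rewrite normrM ler_piMr// tnth_mktuple normrM normfV.
have [n0|n0] := eqVneq (norm2 x) 0; first by rewrite n0 normr0 invr0 mulr0.
rewrite ler_pdivrMr ?normr_gt0// mul1r [leRHS]ger0_norm ?norm2_ge0//.
rewrite norm2E -sqrtr_sqr ler_sqrt ?sqn_ge0// /sqn /dot (bigD1 i)//= -expr2.
by rewrite lerDl; apply: sumr_ge0 => j _; rewrite -expr2 sqr_ge0.
Qed.

(** Up to the volume of the unit ball, this is the moment of order 2k of <xi, V> for V uniform on
    the sphere, in the form that follows from the definition by cones. *)
Definition sphere_mom xi k : \bar R :=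
  (\int[lebesgue_Rn d]_x (heav (1 - sqn x) * dot xi (normalize x) ^+ k.*2)%:E)%E.

Lemma measurable_dot_normalize xi k :
  measurable_fun setT (fun x => dot xi (normalize x) ^+ k.*2).
Proof.
apply: measurable_funX; apply: (measurableT_comp (measurable_dot xi)).
exact: measurable_normalize.
Qed.

Lemma closed_ball_moment xi k :
  (\int[lebesgue_Rn d]_x (heav (1 - sqn x) * dot xi x ^+ k.*2)%:E =
   (Num.sqrt pi ^+ d * rising 2^-1 k * sqn xi ^+ k /
     Gamma (d%:R / 2 + k%:R + 1))%:E)%E.
Proof.
have kp0 : 0 < d%:R / 2 + k%:R + 1 :> R.
  by rewrite ltr_wpDl// addr_ge0// divr_ge0.
have := radial_heav (measurable_dotX xi k.*2)
  (fun x => exprn_double_ge0 (dot xi x) k) (dotX_scale xi k).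
rewrite gauss_moment_Rn; have := Gamma_gt0 kp0.
move: (Gamma _) => g g0 E.
rewrite -[LHS]mul1e (_ : 1%E = g^-1%:E * g%:E)%E; last first.
  by rewrite -EFinM mulVf// gt_eqF.
by rewrite -muleA E -!EFinM mulrC.
Qed.

Lemma sphere_mom_fin xi k : (sphere_mom xi k < +oo)%E.
Proof.
have mn := measurable_dot_normalize xi k.
set B := \sum_(i < d) `|tnth xi i|.
have B0 : 0 <= B by apply: sumr_ge0.
apply: (@le_lt_trans _ _ (\int[lebesgue_Rn d]_x
  (B ^+ k.*2 * (heav (1 - sqn x) * dot xi x ^+ 0.*2))%:E)%E).
  apply: ge0_le_integral => //; [by nn|by meas|by meas|].
  move=> x _; rewrite lee_fin expr0 mulr1 mulrC ler_wpM2r ?heav_ge0//.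
  rewrite -[leLHS]ger0_norm ?exprn_double_ge0// normrX.
  by rewrite lerXn2r ?nnegrE ?normr_ge0// dot_normalize_le.
rewrite ge0_integralTZlR; [|by nn|by meas|by nn].
by rewrite closed_ball_moment -EFinM ltry.
Qed.

(* The identity 1 = u^k + \int_u^1 k w^(k-1) dw at u = |x|^2 <= 1, integrated
   over the ball. *)
Lemma sphere_mom_layer xi k : (0 < k)%N ->
  sphere_mom xi k =
  (\int[lebesgue_Rn d]_x (heav (1 - sqn x) * dot xi x ^+ k.*2)%:E +
   (k%:R / (k%:R + d%:R / 2))%:E * sphere_mom xi k)%E.
Proof.
move=> k0; have kR : 0 < k%:R :> R by rewrite ltr0n.
have mn := measurable_dot_normalize xi k.
pose t (w : R) := if w < 1 then k%:R * tpow k%:R w else 0.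
have mt : measurable_fun setT t by rewrite /t; meas.
have t0 w : 0 <= t w by rewrite /t; nn.
have mh (u : R) : measurable_fun setT (fun w : R => heav (w - u)).
  by apply: (measurableT_comp (@measurable_heav R)); exact: measurable_funB.
have layer (u : R) : 0 <= u ->
    (heav (1 - u))%:E = ((heav (1 - u) * u ^+ k)%:E +
      \int[mu]_w (t w * heav (w - u))%:E)%E.
  move=> u0; have mhu := mh u; have [u1|u1] := leP u 1; last first.
    rewrite heav_lt0 ?subr_lt0// mul0r add0e; apply/esym/integral0_eq => w _.
    rewrite /t; congr EFin; case: ifPn => w1; last by rewrite mul0r.
    by rewrite heav_lt0 ?mulr0// subr_lt0 (lt_trans w1).
  have -> : heav (1 - u) = 1 by rewrite /heav subr_ge0 u1.
  have -> : 1%:E = (\int[mu]_w (t w)%:E)%E :> \bar R.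
    transitivity (\int[mu]_w (k%:R * (if (w < 1)%R then tpow k%:R w else 0))%:E)%E.
      rewrite ge0_integralTZlR; [|by nn|by meas|by nn].
      by rewrite integral_tpow_lt// powR1 mul1r -EFinM divff// gt_eqF.
    by apply: eq_integral => w _; rewrite /t; case: ifP; rewrite ?mulr0.
  have -> : (1 * u ^+ k)%:E =
      (\int[mu]_w (k%:R * (if (w < u)%R then tpow k%:R w else 0))%:E)%E.
    have [u00|u00] := ltP 0 u.
      rewrite ge0_integralTZlR; [|by nn|by meas|by nn].
      rewrite integral_tpow_lt// -EFinM powR_mulrn//; congr EFin.
      by field; rewrite gt_eqF.
    have -> : u = 0 by apply/eqP; rewrite eq_le u00 u0.
    rewrite expr0n (gtn_eqF k0) mulr0; apply/esym/integral0_eq => w _.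
    by case: ifPn => w0; rewrite ?mulr0// tpow0 ?mulr0// ltW.
  rewrite -ge0_integralD//; [|by nn|by meas|by nn|by meas].
  apply: eq_integral => w _; rewrite -EFinD; congr EFin.
  rewrite /t /heav subr_ge0; case: (ltP w u) => wu.
    by rewrite (lt_le_trans wu u1) mulr0 addr0.
  by rewrite mulr0 add0r mulr1.
have mF : measurable_fun setT (fun z : d.-tuple R * measurableTypeR R =>
    (t z.2 * heav (z.2 - sqn z.1) * dot xi (normalize z.1) ^+ k.*2)%:E).
  apply/measurable_EFinP; apply: measurable_funM.
    apply: measurable_funM; first exact: measurableT_comp.
    apply: (measurableT_comp (@measurable_heav R)); apply: measurable_funB => //.
    exact: (measurableT_comp (@measurable_sqn R d)).
  exact: (measurable_comp_fst mn).
have F0 x w : (0 <= (t w * heav (w - sqn x) * dot xi (normalize x) ^+ k.*2)%:E)%E.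
  by nn.
rewrite {1}/sphere_mom.
transitivity (\int[lebesgue_Rn d]_x ((heav (1 - sqn x) * dot xi x ^+ k.*2)%:E +
   \int[mu]_w (t w * heav (w - sqn x) * dot xi (normalize x) ^+ k.*2)%:E))%E.
  apply: eq_integral => x _; have mhx := mh (sqn x).
  rewrite EFinM layer ?sqn_ge0// ge0_muleDl; [|by nn|by nn].
  rewrite -EFinM -mulrA dot_normalize_exprn; congr (_ + _)%E.
  rewrite muleC -ge0_integralTZl; [|by nn|by meas|by nn].
  by apply: eq_integral => w _; rewrite -EFinM mulrC.
rewrite ge0_integralD//; last 4 first.
- by nn.
- by meas.
- by move=> x _; apply: integral_ge0.
- exact: (@measurable_integral_r _ _ _ (measurableTypeR R) R mu
    (fun x w => (t w * heav (w - sqn x) * dot xi (normalize x) ^+ k.*2)%:E)).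
congr (_ + _)%E.
rewrite (@tonelli_swap _ _ _ (measurableTypeR R) R (lebesgue_Rn d) mu
  (fun x w => (t w * heav (w - sqn x) * dot xi (normalize x) ^+ k.*2)%:E))//.
(* At level w the ball has radius sqrt w. Scaling it to the unit ball leaves [normalize x] unchanged
   and costs w^(d/2), which combines with k w^(k - 1). *)
transitivity (\int[mu]_w ((k%:R * (if (w < 1)%R then tpow (k%:R + d%:R / 2) w else 0))%:E *
    sphere_mom xi k))%E; last first.
  rewrite ge0_integralZr//; last 3 first.
  - by meas.
  - by nn.
  - by apply: integral_ge0 => x _; rewrite lee_fin; nn.
  have kd0 : 0 < k%:R + d%:R / 2 :> R by rewrite ltr_pwDl// divr_ge0.
  rewrite ge0_integralTZlR; [|by nn|by meas|by nn].
  by rewrite integral_tpow_lt// powR1 -EFinM mul1r.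
apply: eq_integral => w _.
have [w0|w0] := ltP 0 w; last first.
  rewrite integral0_eq => [|x _]; last first.
    by rewrite /t tpow0// mulr0; case: ifP => _; rewrite !mul0r.
  by rewrite tpow0//; case: ifP => _; rewrite mulr0 mul0e.
have rw0 : Num.sqrt w != 0 by rewrite gt_eqF// sqrtr_gt0.
rewrite -(integral_scale rw0); last 2 first.
- by meas.
- by nn.
transitivity (((Num.sqrt w) ^+ d)%:E * \int[lebesgue_Rn d]_x
    (t w * (heav (1 - sqn x) * dot xi (normalize x) ^+ k.*2))%:E)%E.
  rewrite ger0_norm ?sqrtr_ge0//; congr (_ * _)%E; apply: eq_integral => x _.
  rewrite normalize_scale ?sqrtr_gt0// sqn_scale sqr_sqrtr ?ltW//.
  rewrite (_ : w - w * sqn x = w * (1 - sqn x)); last by ring.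
  by rewrite heavM// powRr0 mul1r mulrA.
rewrite ge0_integralTZlR; [|by nn|by meas|by nn].
rewrite muleA -EFinM; congr (_%:E * _)%E.
rewrite powR_sqrt_exprn// /t; case: ifP => _; last by rewrite !mulr0.
rewrite !tpowE// (_ : k%:R + d%:R / 2 - 1 = d%:R / 2 + (k%:R - 1)); last by ring.
have tD (u v : R) : w `^ (u + v) = w `^ u * w `^ v.
  by rewrite powRD// (gt_eqF w0) implybT.
rewrite (tD (d%:R / 2)); move: (w `^ _) (w `^ _) => u v; ring.
Qed.

(** For k > 0 the layer identity is a linear equation s = A + k / (k + d/2) s for the moment s, with
    A the moment of the closed ball; it can be solved because s is finite. For k = 0 the two
    integrals coincide. *)
Lemma sphere_momE xi k : (0 < d)%N ->
  sphere_mom xi k = (Num.sqrt pi ^+ d / Gamma (d%:R / 2 + 1) *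
    (rising 2^-1 k / rising (d%:R / 2) k * sqn xi ^+ k))%:E.
Proof.
move=> d0; have dR : 0 < d%:R / 2 :> R by rewrite divr_gt0// ltr0n.
have d1 : 0 < d%:R / 2 + 1 :> R by rewrite addr_gt0.
have G1 := Gamma_gt0 d1.
have E : sphere_mom xi k =
   (((k%:R + d%:R / 2) / (d%:R / 2))%:E *
   \int[lebesgue_Rn d]_x (heav (1 - sqn x) * dot xi x ^+ k.*2)%:E)%E.
  case: k => [|k].
    rewrite add0r divff ?gt_eqF// mul1e; apply: eq_integral => x _.
    by rewrite !expr0.
  have := sphere_mom_layer xi (ltn0Sn k); have := sphere_mom_fin xi k.+1.
  have : (0 <= sphere_mom xi k.+1)%E.
    by apply: integral_ge0 => x _; rewrite lee_fin; nn.
  rewrite closed_ball_moment; case: (sphere_mom _ _) => // s _ _.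
  rewrite -!EFinM -EFinD => -[h]; congr EFin.
  move: h; set A := _ / Gamma _ => h.
  have k1 : k.+1%:R + d%:R / 2 != 0 :> R by rewrite gt_eqF// addr_gt0// ltr0n.
  have -> : A = s - k.+1%:R / (k.+1%:R + d%:R / 2) * s by rewrite {1}h addrK.
  move: k1 dR; move: (d%:R / 2) (k.+1%:R : R) => e q k1 e0; field.
  by rewrite k1 gt_eqF.
rewrite E closed_ball_moment -EFinM; congr EFin.
rewrite (_ : d%:R / 2 + k%:R + 1 = d%:R / 2 + 1 + k%:R); last by ring.
rewrite rising_Gamma//.
have : rising (d%:R / 2 + 1) k = rising (d%:R / 2) k * (d%:R / 2 + k%:R) / (d%:R / 2) :> R.
  by rewrite -risingS risingSl mulrAC divff ?mul1r ?gt_eqF.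
move=> ->.
have := rising_gt0 k dR; move: G1; move: (Gamma _) (rising _ k) (sqn xi ^+ k).
move: (rising _ k) (Num.sqrt pi ^+ d) => u v g r s g0 r0.
have dk : 0 < d%:R / 2 + k%:R :> R by rewrite ltr_pwDl.
move: dk dR; move: (d%:R / 2) => e dk e0.
by field; rewrite !gt_eqF// addrC.
Qed.

End SphereMoments.

(** * Passing from image measures to integrals *)

Section Transfer.
Context (R : realType) (d1 d2 d3 : measure_display)
  (T1 : measurableType d1) (T2 : measurableType d2) (S : measurableType d3).
Local Notation mu := (@lebesgue_measure R).
Local Open Scope ereal_scope.

Lemma layer_cake (t : R) : (0 <= t)%R ->
  t%:E = \int[mu]_s (if (s < t)%R then tpow 1 s else 0%R)%:E.
Proof.
rewrite le_eqVlt => /orP[/eqP <-|t0].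
  apply/esym/integral0_eq => s _; case: ifPn => // s0.
  by rewrite tpow0// ltW.
by rewrite integral_tpow_lt// divr1 powRr1// ltW.
Qed.

Lemma integral_layer_cake d (T : measurableType d)
    (m : {sigma_finite_measure set T -> \bar R}) (X : T -> S) (g : T -> \bar R)
    (h : S -> R) : measurable_fun setT X -> measurable_fun setT g ->
  (forall x, 0 <= g x) -> measurable_fun setT h -> (forall v, 0 <= h v)%R ->
  \int[m]_x (g x * (h (X x))%:E) =
  \int[mu]_s ((tpow 1 s)%:E * \int[m]_(x in X @^-1` [set v | s < h v]%R) g x).
Proof.
move=> mX mg g0 mh h0.
have mhX : measurable_fun setT (fun x => h (X x)) by exact: measurableT_comp.
have mi : measurable_fun setT (fun z : T * measurableTypeR R =>
    (if (z.2 < h (X z.1))%R then tpow 1 z.2 else 0%R)%:E).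
  apply/measurable_EFinP; apply: measurable_fun_ifT => //.
  - by apply: measurable_fun_ltr => //; exact: (measurable_comp_fst mhX).
  - apply: (measurableT_comp (measurable_tpow 1)); exact: measurable_snd.
have i0 x (s : R) : 0 <= (if (s < h (X x))%R then tpow 1 s else 0%R)%:E by nn.
transitivity (\int[m]_x \int[mu]_s (g x * (if (s < h (X x))%R then tpow 1 s else 0%R)%:E)).
  apply: eq_integral => x _; rewrite layer_cake// ge0_integralZl//.
  by meas.
rewrite (@tonelli_swap _ _ _ (measurableTypeR R) R m mu); last 2 first.
- by apply: emeasurable_funM => //; exact: (measurable_comp_fst mg).
- by move=> x s; exact: mule_ge0.
apply: eq_integral => s _.
have mA : measurable (X @^-1` [set v | (s < h v)%R]).
  rewrite -[_ @^-1` _]setTI; apply: mX => //.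
  rewrite -[X in measurable X]setTI (_ : [set v | _] = h @^-1` `]s, +oo[%classic).
    exact: mh.
  by apply/seteqP; split => v /=; rewrite in_itv/= andbT.
rewrite [X in (_ * X)%E]integral_mkcond -ge0_integralTZl.
- apply: eq_integral => x _; rewrite patchE.
  have -> : (x \in X @^-1` [set v | (s < h v)%R]) = (s < h (X x))%R.
    by apply/idP/idP => [/set_mem//|sx]; exact/mem_set.
  by case: ifP => _; rewrite ?mule0// muleC.
- exact: tpow_ge0.
- by apply/(measurable_restrictT _ mA).1; exact: measurable_funTS.
- by move=> x; rewrite patchE; case: ifP.
Qed.

(** The layer-cake formula extends equality of two weighted image measures from sets to nonnegative
    functions. The weights cover a density on one side and, for independent families, the remaining
    factors of a product. *)
Lemma integral_transfer
    (m1 : {sigma_finite_measure set T1 -> \bar R})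
    (m2 : {sigma_finite_measure set T2 -> \bar R})
    (X : T1 -> S) (Y : T2 -> S) (g1 : T1 -> \bar R) (g2 : T2 -> \bar R)
    (h : S -> R) :
  measurable_fun setT X -> measurable_fun setT Y ->
  measurable_fun setT g1 -> measurable_fun setT g2 ->
  (forall x, 0 <= g1 x) -> (forall x, 0 <= g2 x) ->
  measurable_fun setT h -> (forall v, 0 <= h v)%R ->
  (forall A, measurable A ->
    \int[m1]_(x in X @^-1` A) g1 x = \int[m2]_(y in Y @^-1` A) g2 y) ->
  \int[m1]_x (g1 x * (h (X x))%:E) = \int[m2]_y (g2 y * (h (Y y))%:E).
Proof.
move=> mX mY mg1 mg2 g10 g20 mh h0 E.
rewrite !integral_layer_cake//; apply: eq_integral => s _; congr (_ * _).
apply: E; rewrite -[X in measurable X]setTI.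
rewrite (_ : [set v | _] = h @^-1` `]s, +oo[%classic).
  exact: mh.
by apply/seteqP; split => v /=; rewrite in_itv/= andbT.
Qed.

End Transfer.

Section Expectations.
Context (R : realType) (disp : measure_display) (T : measurableType disp)
  (P : probability T R).
Local Open Scope ereal_scope.

Lemma expectation_density n (X : {RV P >-> n.-tuple R}) f (h : n.-tuple R -> R) :
  has_density X f -> measurable_fun setT h -> (forall x, 0 <= h x)%R ->
  \int[P]_w (h (X w))%:E = \int[lebesgue_Rn n]_x (f x * h x)%:E.
Proof.
move=> [mf f0 E] mh h0.
have := @integral_transfer R _ _ _ T _ _ P (lebesgue_Rn n) X id (cst 1)
  (EFin \o f) h; move=> tr.
transitivity (\int[P]_w (cst 1 w * (h (X w))%:E)).
  by apply: eq_integral => w _; rewrite mul1e.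
rewrite tr//.
- exact/measurable_EFinP.
move=> A mA; have mXA : measurable (X @^-1` A) by rewrite -[_ @^-1` _]setTI; exact: measurable_funP.
rewrite integral_cst// mul1e; exact: E.
Qed.

End Expectations.

Section SphereMGF.
Context (R : realType) (disp : measure_display) (T : measurableType disp)
  (P : probability T R) (d : nat).
Variable V : {RV P >-> d.-tuple R}.
Hypothesis (uV : uniform_on_sphere V) (d0 : (0 < d)%N).
Local Open Scope ereal_scope.

Let omega : R := fine (lebesgue_Rn d [set x : d.-tuple R | norm2 x <= 1]%R).

(** Density of the uniform law on the punctured unit ball, whose image under [normalize] is the
    uniform law on the sphere. *)
Let g (x : d.-tuple R) : R :=
  if (0 < norm2 x)%R then (if (norm2 x <= 1)%R then omega^-1 else 0)%R else 0%R.

Let mg : measurable_fun setT g.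
Proof.
rewrite /g; apply: measurable_fun_ifT => //; last first.
  by apply: measurable_fun_ifT => //; apply: measurable_fun_ler => //;
    exact: measurable_norm2.
by apply: measurable_fun_ltr => //; exact: measurable_norm2.
Qed.

Let measurable_ball : measurable [set x : d.-tuple R | norm2 x <= 1]%R.
Proof.
rewrite -[X in measurable X]setTI.
rewrite (_ : [set x | _] = @norm2 R d @^-1` `]-oo, 1%R]%classic).
  exact: measurable_norm2.
by apply/seteqP; split => v /=; rewrite in_itv/=.
Qed.

Let norm2_le1 (x : d.-tuple R) : (norm2 x <= 1)%R = (0 <= 1 - sqn x)%R.
Proof.
by rewrite subr_ge0 -norm2_sqr expr_le1// norm2_ge0.
Qed.

Let lebesgue_ball : lebesgue_Rn d [set x : d.-tuple R | norm2 x <= 1]%R =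
  sphere_mom [tuple 0%R | _ < d] 0.
Proof.
rewrite -[LHS]mul1e -integral_cst// integral_mkcond; apply: eq_integral => x _.
rewrite patchE expr0 mulr1 /heav -norm2_le1.
have -> : (x \in [set x : d.-tuple R | norm2 x <= 1]%R) = (norm2 x <= 1)%R.
  by apply/idP/idP => [/set_mem//|?]; exact/mem_set.
by case: ifP.
Qed.

Let omegaE : omega = (Num.sqrt pi ^+ d / Gamma (d%:R / 2 + 1))%R.
Proof.
by rewrite /omega lebesgue_ball sphere_momE// expr0 !rising0 invr1 !mulr1.
Qed.

Let omega_gt0 : (0 < omega)%R.
Proof.
by rewrite omegaE divr_gt0 ?exprn_gt0 ?sqrtr_gt0 ?pi_gt0// Gamma_gt0 // ltr_wpDl// divr_ge0.
Qed.

Let g0 x : (0 <= g x)%R.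
Proof. by rewrite /g; do 2 case: ifP => // _; rewrite invr_ge0 ltW. Qed.

Let sphere_probE A : measurable A ->
  (sphere_prob A)%:E = \int[lebesgue_Rn d]_(x in @normalize R d @^-1` A) (g x)%:E.
Proof.
move=> mA.
have mnA : measurable (@normalize R d @^-1` A).
  by rewrite -[X in measurable X]setTI; exact: measurable_normalize.
have mB : measurable [set x : d.-tuple R | (0 < norm2 x <= 1)%R /\ A (normalize x)].
  rewrite (_ : [set x | _] = [set x : d.-tuple R | (norm2 x <= 1)%R] `&`
    (@norm2 R d @^-1` `]0%R, +oo[%classic `&` (@normalize R d @^-1` A))).
    apply: measurableI => //; apply: measurableI => //.
    by rewrite -[X in measurable X]setTI; exact: measurable_norm2.
  apply/seteqP; split => x /=; rewrite in_itv/= andbT.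
    by move=> [/andP[-> ->]].
  by move=> [-> [-> ]].
have finB : (lebesgue_Rn d [set x : d.-tuple R | (0 < norm2 x <= 1)%R /\ A (normalize x)] < +oo)%E.
  apply: (@le_lt_trans _ _ (lebesgue_Rn d [set x : d.-tuple R | norm2 x <= 1]%R)).
    apply: le_measure; rewrite ?inE// => x /= [/andP[]//].
  by rewrite lebesgue_ball sphere_mom_fin.
rewrite /sphere_prob -/omega mulrC EFinM fineK ?ge0_fin_numE//.
have oi0 : (0 <= omega^-1)%R by rewrite invr_ge0 ltW.
rewrite -integral_cst// integral_mkcond [RHS]integral_mkcond.
apply: eq_integral => x _; rewrite !patchE /g.
have -> : (x \in [set x : d.-tuple R | (0 < norm2 x <= 1)%R /\ A (normalize x)]) =
  [&& (0 < norm2 x)%R, (norm2 x <= 1)%R & x \in @normalize R d @^-1` A].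
  apply/idP/and3P => [/set_mem/= [/andP[-> ->] Ax]|[x0 x1 /set_mem Ax]].
    by split => //; exact/mem_set.
  by apply/mem_set; split => //; rewrite x0.
by case: (0 < norm2 x)%R; case: (norm2 x <= 1)%R; case: (x \in _).
Qed.

Lemma expectation_sphere (h : d.-tuple R -> R) :
  measurable_fun setT h -> (forall v, 0 <= h v)%R ->
  \int[P]_w (h (V w))%:E = \int[lebesgue_Rn d]_x (h (normalize x) * g x)%:E.
Proof.
move=> mh h0.
transitivity (\int[P]_w (cst 1 w * (h (V w))%:E)).
  by apply: eq_integral => w _; rewrite mul1e.
rewrite (@integral_transfer R _ _ _ T (d.-tuple R) _ P (lebesgue_Rn d) V
  (@normalize R d) (cst 1) (EFin \o g))//.
- by apply: eq_integral => x _; rewrite /= -EFinM mulrC.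
- exact: measurable_normalize.
- exact/measurable_EFinP.
move=> A mA; have mVA : measurable (V @^-1` A).
  by rewrite -[_ @^-1` _]setTI; exact: measurable_funP.
by rewrite integral_cst// mul1e; rewrite -sphere_probE// -uV.
Qed.

Lemma sphere_mgf (xi : d.-tuple R) :
  \int[P]_w (expR (dot xi (V w)))%:E = bessel_series (d%:R / 2) (sqn xi).
Proof.
rewrite (@expectation_sphere (fun v => expR (dot xi v))); last 2 first.
- by meas.
- by move=> v; exact: expR_ge0.
rewrite (@even_mgf R d g (fun x => dot xi (normalize x)))//; last 3 first.
- apply: (measurableT_comp (measurable_dot xi)); exact: measurable_normalize.
- by move=> x; rewrite normalize_scaleN dot_scale mulN1r.
- by move=> x; rewrite /g norm2_scale normrN1 mul1r.
apply: eq_eseriesr => k _.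
have dR : (0 < d%:R / 2 :> R)%R by rewrite divr_gt0// ltr0n.
have -> : \int[lebesgue_Rn d]_x (dot xi (normalize x) ^+ k.*2 * g x)%:E =
    (rising 2^-1 k / rising (d%:R / 2) k * sqn xi ^+ k)%:E.
  (* For k = 0 the origin, where [g] and the ball indicator disagree, is avoided by using that the
     law of V has mass 1. For k > 0 the origin contributes 0 on both sides, since [normalize] maps
     it to itself. *)
  case: k => [|k].
    transitivity (\int[lebesgue_Rn d]_(x in @normalize R d @^-1` setT) (g x)%:E).
      by rewrite preimage_setT; apply: eq_integral => x _; rewrite expr0 mul1r.
    by rewrite -sphere_probE// -uV// preimage_setT probability_setT !rising0 expr0 divr1 mulr1.
  have -> : (rising 2^-1 k.+1 / rising (d%:R / 2) k.+1 * sqn xi ^+ k.+1)%:E =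
      (omega^-1)%:E * sphere_mom xi k.+1.
    rewrite sphere_momE// -omegaE -EFinM; congr EFin.
    by rewrite mulrA mulVf ?mul1r// gt_eqF.
  rewrite -ge0_integralTZl; last 3 first.
  - by rewrite invr_ge0 ltW.
  - have mn := measurable_dot_normalize xi k.+1; meas.
  - by nn.
  apply: eq_integral => x _; rewrite -EFinM; congr EFin.
  rewrite /g /heav -norm2_le1; case: ifPn => [x0|].
    by case: ifP => _; rewrite ?mul1r ?mul0r ?mulr0// mulrC.
  rewrite -leNgt => x0.
  have n0 : norm2 x = 0%R by apply/eqP; rewrite eq_le x0 norm2_ge0.
  by rewrite dot_normalize n0 invr0 !mulr0 doubleS expr0n /= !mulr0.
rewrite -EFinM; congr EFin; rewrite rising_half.
have := rising_gt0 k dR; have := fact_neq0 R k; have := fact_neq0 R k.*2.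
have : (4 ^+ k != 0 :> R)%R by rewrite expf_neq0// pnatr_eq0.
move: (rising _ k) ((k.*2)`!%:R) (k`!%:R) (4 ^+ k)%R => a b c e.
move=> e0 b0 c0 a0; field.
by rewrite e0 b0 c0 gt_eqF.
Qed.

End SphereMGF.

(** * Dirichlet intertimes *)

Section SimplexIntegrals.
Context (R : realType).
Local Notation mu := (@lebesgue_measure R).
Local Open Scope ereal_scope.

Fixpoint convs (g : nat -> R -> \bar R) n : R -> \bar R :=
  if n is n'.+1 then conv (g 0%N) (convs (fun k => g k.+1) n') else g 0%N.

Lemma convs_ge0 g n t : (forall k x, 0 <= g k x) -> 0 <= convs g n t.
Proof.
elim: n g t => [|n ih] g t g0; first exact: g0.
by apply: conv_ge0 => x; [exact: g0|apply: ih => k y; exact: g0].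
Qed.

Lemma measurable_convs g n : (forall k x, 0 <= g k x) ->
  (forall k, measurable_fun setT (g k)) -> measurable_fun setT (convs g n).
Proof.
elim: n g => [|n ih] g g0 mg; first exact: mg.
apply: measurable_conv => [||x|x]; [exact: mg| |exact: g0|].
- by apply: ih => [k x|k]; [exact: g0|exact: mg].
- by apply: convs_ge0 => k y; exact: g0.
Qed.

Lemma emeasurable_prod d (T : measurableType d) n (h : 'I_n -> T -> \bar R) :
  (forall k, measurable_fun setT (h k)) ->
  measurable_fun setT (fun x => \prod_(k < n) h k x).
Proof.
elim: n h => [|n ih] h mh.
  by rewrite (_ : (fun x => _) = cst 1)//; apply/funext => x; rewrite big_ord0.
rewrite (_ : (fun x => _) = fun x => h ord0 x * \prod_(k < n) h (lift ord0 k) x).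
  by apply: emeasurable_funM => //; apply: ih.
by apply/funext => x; rewrite big_ord_recl.
Qed.

Lemma intertime_consRn0 n t x (y : n.-tuple R) :
  intertime t (consRn (x, y)) ord0 = x.
Proof. by []. Qed.

Lemma intertime_consRnS n t x (y : n.-tuple R) k :
  intertime t (consRn (x, y)) (lift ord0 k) = intertime (t - x) y k.
Proof. by rewrite /intertime /= big_cons opprD addrA. Qed.

Lemma intertimeE n t (x : n.-tuple R) (k : 'I_n.+1) :
  intertime t x k =
  (if unlift ord_max k is Some j then tnth x j else t - \sum_(i < n) tnth x i)%R.
Proof.
rewrite /intertime; case: unliftP => [j ->|->].
  rewrite (tnth_nth (t - \sum_(s <- x) s)%R) /=; congr nth.
  by rewrite /bump leqNgt ltn_ord.
rewrite nth_default ?size_tuple//; congr (_ - _)%R.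
by rewrite big_tuple.
Qed.

Lemma measurable_intertime n t (k : 'I_n.+1) :
  measurable_fun setT (fun x : n.-tuple R => intertime t x k).
Proof.
rewrite (_ : (fun x => _) = fun x : n.-tuple R =>
  if unlift ord_max k is Some j then tnth x j else t - \sum_(i < n) tnth x i)%R.
  case: unlift => [j|]; first exact: measurable_tnth.
  by apply: measurable_funB => //; apply: measurable_sum => i; exact: measurable_tnth.
by apply/funext => x; rewrite intertimeE.
Qed.

Lemma measurable_prod_intertimes n (g : nat -> R -> \bar R) t :
  (forall k, measurable_fun setT (g k)) ->
  measurable_fun setT (fun x : n.-tuple R => \prod_(k < n.+1) g k (intertime t x k)).
Proof.
move=> mg; apply: emeasurable_prod => k; apply: (measurableT_comp (mg k)).
exact: measurable_intertime.
Qed.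

(** Once the first intertime is x, the others are the intertimes for the duration t - x, so
    integrating over x is a convolution. The restriction to the simplex is left to the [g k], which
    vanish on nonpositive arguments in the applications. *)
Lemma integral_intertimes n (g : nat -> R -> \bar R) t :
  (forall k x, 0 <= g k x) -> (forall k, measurable_fun setT (g k)) ->
  \int[lebesgue_Rn n]_x \prod_(k < n.+1) g k (intertime t x k) = convs g n t.
Proof.
elim: n g t => [|n ih] g t g0 mg.
  rewrite integral_lebesgue_Rn0; last exact: measurable_prod_intertimes.
  by rewrite big_ord1 /intertime /= big_nil subr0.
have mp := measurable_prod_intertimes (n := n.+1) t mg.
rewrite integral_lebesgue_RnS//; last by move=> x; apply: prode_ge0 => k _; exact: g0.
rewrite [RHS]/= /conv; apply: eq_integral => x _.
rewrite -ih => [|k y|k]; [|exact: g0|exact: mg].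
rewrite -ge0_integralZl//; last 2 first.
- exact: (measurable_prod_intertimes _ (fun k => mg k.+1)).
- by move=> y _; apply: prode_ge0 => k _; exact: g0.
apply: eq_integral => y _; rewrite big_ord_recl intertime_consRn0; congr (_ * _).
by apply: eq_bigr => k _; rewrite intertime_consRnS.
Qed.

(** The upper bound at the last index says that t_(n+1) is positive, and by positivity of the
    entries it implies the bounds at the earlier indices. For n = 0 the only intertime is t
    itself. *)
Lemma simplexP n (t : R) (x : n.-tuple R) : (0 < t)%R ->
  simplex t x <-> forall k, (0 < intertime t x k)%R.
Proof.
move=> t0; split=> [sx k|h j].
  rewrite intertimeE; case: unliftP => [j _|_]; first by have /andP[] := sx j.
  case: n x sx k => [|n] x sx k; first by rewrite big_ord0 subr0.
  have E : (\sum_(k < n.+1 | (k < @ord_max n)%N) tnth x k =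
      \sum_(i < n) tnth x (widen_ord (leqnSn n) i))%R.
    rewrite big_mkcond big_ord_recr/= ltnn addr0.
    by apply: eq_bigr => i _; rewrite ltn_ord.
  have /andP[_] := sx ord_max; rewrite big_ord_recr/= -E; lra.
have x0 i : (0 < tnth x i)%R.
  by have := h (lift ord_max i); rewrite intertimeE liftK.
rewrite x0/=; have := h ord_max; rewrite intertimeE unlift_none subr_gt0 => xt.
rewrite ltrBrDr; apply: le_lt_trans xt.
rewrite [leRHS](bigD1 j)//= lerD2l [leRHS](bigID (fun k : 'I_n => (k < j)%N))/=.
rewrite [X in (_ <= X + _)%R](eq_bigl (fun k : 'I_n => (k < j)%N)).
  by rewrite lerDl; apply: sumr_ge0 => k _; exact/ltW/x0.
by move=> k; rewrite andb_idl// => kj; rewrite neq_ltn kj.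
Qed.

(** The truncated powers absorb the indicator: off the simplex some intertime is not positive and
    its factor vanishes. *)
Lemma dirichlet_pdfE n (t a : R) (x : n.-tuple R) : (0 < t)%R ->
  dirichlet_pdf t a x =
  (Gamma (n.+1%:R * a) / Gamma a ^+ n.+1 / t `^ (n.+1%:R * a - 1) *
   \prod_(k < n.+1) tpow a (intertime t x k))%R.
Proof.
move=> t0; suff E : (\prod_(k < n.+1) intertime t x k `^ (a - 1) * \1_(simplex t) x =
    \prod_(k < n.+1) tpow a (intertime t x k))%R.
  rewrite /dirichlet_pdf -E.
  by move: (Gamma _) (Gamma _) (\prod_(k < n.+1) _)%R => ? ? ?; ring.
have [sx|sx] := pselect (simplex t x).
  rewrite indicE mem_set// mulr1; apply: eq_bigr => k _.
  by rewrite tpowE//; move: (simplexP x t0).1; apply.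
rewrite indicE memNset// mulr0.
have [k hk] : exists k, ~ (0 < intertime t x k)%R.
  by apply/existsNP => h; apply: sx; apply/simplexP.
by rewrite (bigD1 k)//= tpow0 ?mul0r// leNgt; exact/negP.
Qed.

End SimplexIntegrals.

Section DirichletMGF.
Context (R : realType).
Local Notation mu := (@lebesgue_measure R).
Local Open Scope ereal_scope.
Variable Phi : R -> nat -> R.
Hypothesis Phi0 : forall x k, (0 < x)%R -> (0 <= Phi x k)%R.
Hypothesis PhiD : forall x y N, cauchy_prod (Phi x) (Phi y) N = Phi (x + y)%R N.

(** [Phi x] stands for the coefficients of the x-th power of one fixed series, so [PhiD] adds
    exponents, in step with the addition of the parameters of the kernels [gpow]. *)
Lemma convs_gseries n (a z t : R) : (0 < a)%R -> (0 <= z)%R ->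
  convs (fun=> gseries (Phi a) a z) n t =
  gseries (Phi (n.+1%:R * a)) (n.+1%:R * a) z t.
Proof.
move=> a0 z0; elim: n t => [|n ih] t; first by rewrite mul1r.
have na : (0 < n.+1%:R * a)%R by rewrite mulr_gt0 ?ltr0n.
rewrite [LHS]/= (_ : convs _ n = gseries (Phi (n.+1%:R * a)) (n.+1%:R * a) z); last first.
  by apply/funext => s; rewrite -ih.
rewrite (conv_gseries _ (fun k => Phi0 k a0) (fun k => Phi0 k na) a0 na z0).
have -> : cauchy_prod (Phi a) (Phi (n.+1%:R * a)) = Phi (a + n.+1%:R * a)%R.
  by apply/funext => N; exact: PhiD.
by have -> : (n.+2%:R * a = a + n.+1%:R * a)%R by rewrite -[n.+2%:R]natr1; ring.
Qed.

Lemma tpowD (b s : R) k : (tpow (b + k%:R) s = tpow b s * s ^+ k)%R.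
Proof.
rewrite /tpow; case: ifPn => s0; last by rewrite mul0r.
rewrite -powR_mulrn ?ltW// -powRD ?(gt_eqF s0) ?implybT//.
by congr (_ `^ _)%R; ring.
Qed.

Lemma gpow_rising (a t : R) k : (0 < a)%R ->
  gpow (a + 2 * k%:R) t = (tpow a t * t ^+ k.*2 / (rising a k.*2 * Gamma a))%:E.
Proof.
move=> a0; rewrite /gpow (_ : a + 2 * k%:R = a + k.*2%:R)%R.
  by rewrite tpowD rising_Gamma.
by rewrite -mul2n natrM.
Qed.

Lemma prode_mulr_const n (c : R) (h : 'I_n -> \bar R) :
  \prod_(k < n) (c%:E * h k) = (c ^+ n)%:E * \prod_(k < n) h k.
Proof.
elim: n h => [|n ih] h; first by rewrite !big_ord0 mul1e.
by rewrite !big_ord_recr/= ih muleACA -EFinM exprSr.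
Qed.

(** The prefactor is the reciprocal of [gpow A t]; what is left of Gamma(A + 2k) is a rising
    factorial of even length. *)
Lemma gseries_normalized (phi : nat -> R) (A t z : R) :
  (forall k, 0 <= phi k)%R -> (0 < A)%R -> (0 < t)%R -> (0 <= z)%R ->
  (Gamma A / t `^ (A - 1))%:E * gseries phi A z t =
  \sum_(k <oo) (phi k / rising A k.*2 * (t ^+ 2 * z) ^+ k)%:E.
Proof.
move=> phi0 A0 t0 z0; have GA := Gamma_gt0 A0.
have tA : (0 < t `^ (A - 1))%R by rewrite powR_gt0.
rewrite /gseries -nneseriesZl; last first.
  move=> k _; apply: mule_ge0; first by rewrite lee_fin mulr_ge0 ?exprn_ge0.
  by apply: gpow_ge0; rewrite ltr_wpDr// mulr_ge0.
apply: eq_eseriesr => k _; rewrite gpow_rising// -!EFinM; congr EFin.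
rewrite (tpowE _ t0) exprMn -exprM mul2n.
have := rising_gt0 k.*2 A0; move: GA tA.
move: (Gamma A) (t `^ _)%R (rising A _) (phi k) (t ^+ _)%R (z ^+ _)%R.
move=> g p r f u v g0 p0 r0.
by field; rewrite !gt_eqF.
Qed.

Variables (a c : R).
Hypotheses (a0 : (0 < a)%R) (c0 : (0 < c)%R).
Hypothesis PhiE : forall k,
  Phi a k = (rising a k.*2 / (4 ^+ k * k`!%:R * rising c k))%R.

(** Here the Dirichlet parameter a is tied to the dimension through c: the factor t^(2k) is absorbed
    into the kernel at the cost of (a)_(2k), and [PhiE] says that the Bessel coefficients then
    become [Phi a]. *)
Lemma tpow_bessel_series z s : (0 <= z)%R ->
  (tpow a s)%:E * bessel_series c (s ^+ 2 * z) =
  (Gamma a)%:E * gseries (Phi a) a z s.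
Proof.
move=> z0; have b0 k : 0 <= ((s ^+ 2 * z) ^+ k / (4 ^+ k * k`!%:R * rising c k))%:E.
  rewrite lee_fin; apply: divr_ge0; first by rewrite exprn_ge0// mulr_ge0// sqr_ge0.
  by rewrite !mulr_ge0 ?exprn_ge0 ?rising_ge0.
have g0 k : 0 <= (Phi a k * z ^+ k)%:E * gpow (a + 2 * k%:R) s.
  apply: mule_ge0; first by rewrite lee_fin mulr_ge0 ?Phi0 ?exprn_ge0.
  by apply: gpow_ge0; rewrite ltr_wpDr// mulr_ge0.
rewrite /bessel_series /gseries -nneseriesZl; last by move=> k _; exact: b0.
rewrite -nneseriesZl; last by move=> k _; exact: g0.
apply: eq_eseriesr => k _; rewrite gpow_rising// PhiE -!EFinM; congr EFin.
rewrite exprMn -exprM mul2n.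
have := Gamma_gt0 a0; have := rising_gt0 k.*2 a0; have := rising_gt0 k c0.
have := fact_neq0 R k.
have : (4 ^+ k != 0 :> R)%R by rewrite expf_neq0// pnatr_eq0.
move: (Gamma a) (rising a _) (rising c k) (k`!%:R) (4 ^+ k)%R (s ^+ _)%R (z ^+ _)%R (tpow a s).
move=> g r1 r2 f e u v w e0 f0 r20 r10 gp.
by field; rewrite e0 f0 !gt_eqF.
Qed.

Lemma dirichlet_mgf n (t z : R) : (0 < t)%R -> (0 <= z)%R ->
  \int[lebesgue_Rn n]_x ((dirichlet_pdf t a x)%:E *
     \prod_(k < n.+1) bessel_series c (intertime t x k ^+ 2 * z)) =
  \sum_(k <oo) (Phi (n.+1%:R * a) k / rising (n.+1%:R * a) k.*2 * (t ^+ 2 * z) ^+ k)%:E.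
Proof.
move=> t0 z0; set A := (n.+1%:R * a)%R.
have A0 : (0 < A)%R by rewrite mulr_gt0 ?ltr0n.
have Ga := Gamma_gt0 a0; have GA := Gamma_gt0 A0.
have tA : (0 < t `^ (A - 1))%R by rewrite powR_gt0.
set K := (Gamma A / t `^ (A - 1))%R.
have K0 : (0 <= K)%R by rewrite divr_ge0 ?ltW.
transitivity (\int[lebesgue_Rn n]_x (K%:E *
    \prod_(k < n.+1) gseries (Phi a) a z (intertime t x k))).
  apply: eq_integral => x _; rewrite dirichlet_pdfE// -/A.
  rewrite EFinM -muleA -prodEFin -big_split/=.
  under eq_bigr do rewrite tpow_bessel_series//.
  rewrite prode_mulr_const muleA -EFinM; congr (_%:E * _).
  have : (Gamma a ^+ n.+1 != 0)%R by rewrite expf_neq0// gt_eqF.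
  move: tA; rewrite /K.
  move: (Gamma A) (Gamma a ^+ _)%R (t `^ _)%R => g1 g2 g3 g30 g20.
  by field; rewrite g20 gt_eqF.
rewrite ge0_integralTZl//; last 2 first.
- apply: (@measurable_prod_intertimes R n (fun=> gseries (Phi a) a z)) => k.
  apply: measurable_gseries => //.
  by move=> j; exact: Phi0.
- move=> x; apply: prode_ge0 => k _; apply: gseries_ge0 => //.
  by move=> j; exact: Phi0.
rewrite (integral_intertimes _ (g := fun=> gseries (Phi a) a z)); last 2 first.
- by move=> _ x; apply: gseries_ge0 => // j; exact: Phi0.
- by move=> _; apply: measurable_gseries => // j; exact: Phi0.
by rewrite convs_gseries// -/A gseries_normalized// => j; exact: Phi0.
Qed.

End DirichletMGF.

(** * Independence *)

Section IndependentPair.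
Context (R : realType) (disp d1 d2 : measure_display) (T : measurableType disp)
  (S1 : measurableType d1) (S2 : measurableType d2) (P : probability T R).
Local Open Scope ereal_scope.

(** The law of (X, Y) and the product of the laws agree on rectangles, hence everywhere. The
    iterated form allows the inner integral to be evaluated with Y frozen. *)
Lemma expectation_independent (X : T -> S1) (Y : T -> S2) (F : S1 -> S2 -> \bar R) :
  measurable_fun setT X -> measurable_fun setT Y -> independent P X Y ->
  measurable_fun setT (fun z : S1 * S2 => F z.1 z.2) ->
  (forall x y, 0 <= F x y) ->
  \int[P]_w F (X w) (Y w) = \int[P]_v \int[P]_w F (X w) (Y v).
Proof.
move=> mX mY XY mF F0.
pose Xm : {mfun T >-> S1} := HB.pack X (isMeasurableFun.Build _ _ _ _ _ mX).
pose Ym : {mfun T >-> S2} := HB.pack Y (isMeasurableFun.Build _ _ _ _ _ mY).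
pose PX := distribution P Xm; pose PY := distribution P Ym.
have mXY : measurable_fun setT (fun w => (X w, Y w)) by exact: measurable_fun_pair.
pose Z : {mfun T >-> (S1 * S2)%type} :=
  HB.pack (fun w => (X w, Y w)) (isMeasurableFun.Build _ _ _ _ _ mXY).
have PZ (A : set (S1 * S2)) : measurable A ->
    (PX \x PY) A = distribution P Z A.
  apply: product_measure_unique => A1 A2 mA1 mA2.
  by rewrite /= /pushforward -XY.
pose G (z : S1 * S2) := F z.1 z.2.
have mG : measurable_fun setT G by [].
have G0 z : 0 <= G z by exact: F0.
transitivity (\int[distribution P Z]_z G z).
  by rewrite ge0_integral_pushforward.
transitivity (\int[PX \x PY]_z G z).
  by apply: eq_measure_integral => A mA _; first [exact: PZ|exact/esym/PZ].
rewrite fubini_tonelli2// ge0_integral_pushforward//; last 2 first.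
- exact: (measurable_fun_fubini_tonelli_G _ mG G0).
- by move=> y _; apply: integral_ge0.
rewrite preimage_setT; apply: eq_integral => v _ /=.
rewrite /fubini_G ge0_integral_pushforward//.
exact: (measurableT_comp mG (@measurable_pair2 _ _ _ _ (Y v))).
Qed.

End IndependentPair.

Section IndependentFamily.
Context (R : realType) (disp d : measure_display) (T : measurableType disp)
  (S : measurableType d) (P : probability T R) (I : finType) (V : I -> T -> S).
Hypothesis mV : forall i, measurable_fun setT (V i).
Hypothesis indV : mutually_independent P V.
Local Open Scope ereal_scope.
Variable h : I -> S -> R.
Hypothesis mh : forall i, measurable_fun setT (h i).
Hypothesis h0 : forall i v, (0 <= h i v)%R.

Lemma emeasurable_prod_seq d' (T' : measurableType d') (J : Type) (s : seq J)
    (Q : pred J) (f : J -> T' -> \bar R) : (forall j, measurable_fun setT (f j)) ->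
  measurable_fun setT (fun x => \prod_(j <- s | Q j) f j x).
Proof.
move=> mf; elim: s => [|j s ih].
  by rewrite (_ : (fun x => _) = cst 1)//; apply/funext => x; rewrite big_nil.
rewrite (_ : (fun x => _) = fun x =>
  if Q j then f j x * \prod_(j <- s | Q j) f j x else \prod_(j <- s | Q j) f j x).
  by case: (Q j) => //; exact: emeasurable_funM.
by apply/funext => x; rewrite big_cons.
Qed.

(* The factors h_i(V_i), i in s, are introduced one at a time, the others being
   kept as indicators of arbitrary measurable sets. *)
Lemma expectation_prod_indic (s : seq I) (A : I -> set S) : uniq s ->
  (forall i, measurable (A i)) ->
  \int[P]_w ((\prod_(i | i \notin s) (\1_(A i) (V i w))%:E) *
             \prod_(i <- s) (h i (V i w))%:E) =
  (\prod_(i | i \notin s) P (V i @^-1` A i)) *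
    \prod_(i <- s) \int[P]_w (h i (V i w))%:E.
Proof.
elim: s A => [|j s ih] A.
  move=> _ mA; have mVA i : measurable (V i @^-1` A i).
    by rewrite -[_ @^-1` _]setTI; exact: mV.
  rewrite big_nil mule1; under eq_integral do rewrite big_nil mule1.
  have := indV [set: I]%SET mA; set B := \bigcap_(i in _) _ => PB.
  have mB : measurable B by apply: fin_bigcap_measurable => // i _.
  transitivity (\int[P]_w (\1_B w)%:E).
    apply: eq_integral => w _; have [wB|wB] := pselect (B w).
      rewrite indicE mem_set// big1// => i _.
      by rewrite indicE mem_set//; apply: wB => /=; rewrite inE.
    rewrite indicE memNset//.
    have [i /not_implyP[_ wi]] : exists i, ~ (True -> (V i @^-1` A i) w).
      by apply/existsNP => wi; apply: wB => i _; exact: wi.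
    by rewrite (bigD1 i)//= indicE memNset// mul0e.
  rewrite integral_indic// setIT; apply: (etrans PB); apply: eq_bigl => i.
  by rewrite !inE.
move=> /= /andP[js us] mA.
pose g w : \bar R := (\prod_(i | i \notin j :: s) (\1_(A i) (V i w))%:E) *
  \prod_(i <- s) (h i (V i w))%:E.
have mg : measurable_fun setT g.
  apply: emeasurable_funM; apply: emeasurable_prod_seq => i; apply/measurable_EFinP.
    apply: (measurableT_comp _ (mV i)); exact: measurable_indic.
  exact: (measurableT_comp (mh i) (mV i)).
have g0 w : 0 <= g w.
  by apply: mule_ge0; apply: prode_ge0 => i _; rewrite lee_fin.
set C := (\prod_(i | i \notin j :: s) P (V i @^-1` A i)) *
    \prod_(i <- s) \int[P]_w (h i (V i w))%:E.
have C0 : 0 <= C.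
  apply: mule_ge0; apply: prode_ge0 => i _ //.
  by apply: integral_ge0 => w _; rewrite lee_fin.
have pred_j i : (i \notin s) && (i != j) = (i \notin j :: s).
  by rewrite inE negb_or andbC.
have split_j (f : I -> \bar R) :
    \prod_(i | i \notin s) f i = f j * \prod_(i | i \notin j :: s) f i.
  by rewrite (bigD1 j)//=; congr (_ * _); apply: eq_bigl.
have mVj B : measurable B -> measurable (V j @^-1` B).
  by move=> mB; rewrite -[_ @^-1` _]setTI; exact: mV.
(* The induction hypothesis, applied to the family with B placed at j, says that under the weight
   [g] the variable V_j has C times its own law; [integral_transfer] then replaces the indicator of
   B by h_j. *)
have E (B : set S) : measurable B ->
    \int[P]_(w in V j @^-1` B) g w = \int[P]_(w in V j @^-1` B) C.
  move=> mB; rewrite integral_cst; last exact: mVj.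
  pose A' i := if i == j then B else A i.
  have mA' i : measurable (A' i) by rewrite /A'; case: ifP.
  have := ih A' us mA'; rewrite !split_j.
  have A'j : A' j = B by rewrite /A' eqxx.
  have A'i i : i \notin j :: s -> A' i = A i.
    by rewrite inE negb_or /A' => /andP[/negbTE ->].
  rewrite A'j (eq_bigr (fun i => P (V i @^-1` A i))) => [|i ij]; last by rewrite A'i.
  rewrite -muleA -/C muleC => <-.
  rewrite integral_mkcond; apply: eq_integral => w _.
  rewrite split_j A'j patchE -muleA.
  rewrite (eq_bigr (fun i => (\1_(A i) (V i w))%:E)) => [|i ij]; last by rewrite A'i.
  rewrite -/(g w) indicE.
  have -> : (V j w \in B) = (w \in V j @^-1` B).
    by apply/idP/idP => /set_mem ?; exact/mem_set.
  by case: ifP => _; rewrite ?mul1e ?mul0e.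
have := @integral_transfer R _ _ _ T T S P P (V j) (V j) g (cst C) (h j)
  (mV j) (mV j) mg (measurable_cst _) g0 (fun=> C0) (mh j) (h0 j) E.
rewrite ge0_integralZl//; last 2 first.
- by apply/measurable_EFinP; exact: (measurableT_comp (mh j) (mV j)).
- by move=> w _; rewrite lee_fin.
rewrite big_cons muleCA -/C muleC => <-.
by apply: eq_integral => w _; rewrite big_cons /g muleCA muleC.
Qed.

Lemma expectation_prod_independent :
  \int[P]_w \prod_i (h i (V i w))%:E = \prod_i \int[P]_w (h i (V i w))%:E.
Proof.
have := @expectation_prod_indic (enum I) (fun=> setT) (enum_uniq _) (fun=> measurableT).
have e i : (i \notin enum I) = false by rewrite mem_enum.
rewrite (big_pred0 _ _ _ _ e) mul1e big_enum/= => <-; apply: eq_integral => w _.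
by rewrite (big_pred0 _ _ _ _ e) mul1e big_enum.
Qed.

End IndependentFamily.

(** * Determination of a law by its moment generating function *)

Section RayApproximation.
Context (R : realType).

Definition ray (a y : R) : R := if y <= a then 1 else 0.

Lemma ray_ge0 a y : 0 <= ray a y. Proof. by rewrite /ray; case: ifP. Qed.

Lemma ray_le1 a y : ray a y <= 1. Proof. by rewrite /ray; case: ifP. Qed.

Lemma measurable_ray a : measurable_fun setT (ray a).
Proof. by rewrite /ray; meas; apply: measurable_fun_ler. Qed.

(* Near y = a the product (1 - y^N)^K passes from 1 to 0 at K = y^-N; the extra
   factor 1/N makes the limit at y = a equal to 1. *)
Definition ray_exp (a : R) (N : nat) : nat := Num.truncn (a ^- N / N%:R).

Definition ray_approx (a : R) (N : nat) (y : R) : R :=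
  (1 - y ^+ N) ^+ ray_exp a N.

Lemma ray_approx_ge0 a N y : 0 <= y <= 1 -> 0 <= ray_approx a N y.
Proof.
move=> /andP[y0 y1]; rewrite exprn_ge0// subr_ge0.
exact: exprn_ile1.
Qed.

Lemma ray_approx_le1 a N y : 0 <= y <= 1 -> ray_approx a N y <= 1.
Proof.
move=> /andP[y0 y1]; apply: exprn_ile1; last by rewrite gerBl exprn_ge0.
by rewrite subr_ge0 exprn_ile1.
Qed.

Lemma bernoulli (x : R) n : -1 <= x -> 1 + n%:R * x <= (1 + x) ^+ n.
Proof.
move=> x1; elim: n => [|n ih]; first by rewrite mul0r addr0 expr0.
rewrite exprS; apply: (@le_trans _ _ ((1 + x) * (1 + n%:R * x))).
  rewrite -natr1 -subr_ge0.
  rewrite (_ : _ - _ = n%:R * x ^+ 2); last by ring.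
  by rewrite mulr_ge0// sqr_ge0.
by rewrite ler_wpM2l//; lra.
Qed.

Lemma ray_approx_cvg a y : 0 < a -> 0 < y <= 1 ->
  ray_approx a N.+1 y @[N --> \oo] --> ray a y.
Proof.
move=> a0 /andP[y0 y1]; have yN N : y ^+ N <= 1 by rewrite exprn_ile1 // ltW.
have yN0 N : 0 < y ^+ N by rewrite exprn_gt0.
have aN0 N : 0 < a ^- N by rewrite invr_gt0 exprn_gt0.
have [ya|ya] := leP y a; rewrite /ray.
  (* By Bernoulli the power is at least 1 - K y^N, and K y^N <= (y / a)^N / N <= 1 / N. *)
  rewrite ya; apply: (@squeeze_cvgr _ _ _ _ (fun N => 1 - N.+1%:R^-1) (fun=> 1)).
  - apply: nearW => N; rewrite ray_approx_le1 ?(ltW y0)// andbT.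
    set K := ray_exp a N.+1.
    have := @bernoulli (- y ^+ N.+1) K; rewrite lerN2 => /(_ (yN _)).
    apply: le_trans; rewrite mulrN lerD2l lerN2.
    apply: (@le_trans _ _ (a ^- N.+1 / N.+1%:R * y ^+ N.+1)).
      by apply: ler_wpM2r; [exact: ltW|rewrite /K /ray_exp truncn_le divr_ge0// ltW].
    rewrite mulrAC ler_piMl// -exprVn -exprMn exprn_ile1//.
      by rewrite mulr_ge0 ?invr_ge0 ?ltW.
    by rewrite mulrC ler_pdivrMr// mul1r.
  - rewrite -[X in _ --> X]subr0; apply: cvgB; first exact: cvg_cst.
    exact: cvg_harmonic.
  - exact: cvg_cst.
rewrite leNgt ya /=.
(* The power is at most 1 / (1 + y^N)^K, because (1 - y^N)(1 + y^N) <= 1. Bernoulli bounds that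
   denominator below by (K + 1) y^N >= s^(2N) / N; one factor s^N absorbs the 1 / N, as s^N >= N (s
   - 1), and the other yields geometric decay. *)
pose s := Num.sqrt (y / a).
have s1 : 1 < s by rewrite -sqrtr1 ltr_sqrt ?divr_gt0// ltr_pdivlMr// mul1r.
have s0 : 0 < s by apply: lt_trans s1.
have s2 : s ^+ 2 = y / a by rewrite sqr_sqrtr// divr_ge0 ?ltW.
have sa : 0 < s - 1 by rewrite subr_gt0.
apply: (@squeeze_cvgr _ _ _ _ (fun=> 0) (fun N => (s - 1)^-1 * s^-1 ^+ N.+1)).
- apply: nearW => N; rewrite ray_approx_ge0 ?(ltW y0)//=.
  set K := ray_exp a N.+1; rewrite /ray_approx -/K.
  have h1 : (1 - y ^+ N.+1) ^+ K * (1 + y ^+ N.+1) ^+ K <= 1.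
    rewrite -exprMn exprn_ile1//.
      by rewrite mulr_ge0 ?subr_ge0// addr_ge0// ltW.
    rewrite (_ : _ * _ = 1 - (y ^+ N.+1) ^+ 2); last by ring.
    by rewrite gerBl sqr_ge0.
  have h2 : (s - 1) * s ^+ N.+1 <= (1 + y ^+ N.+1) ^+ K.
    have b1 := @bernoulli (y ^+ N.+1) K.
    apply: le_trans (b1 _); last first.
      by rewrite (le_trans _ (ltW (yN0 _)))// lerN10.
    have b2 := @bernoulli (s - 1) N.+1.
    have {b2} b2 : N.+1%:R * (s - 1) <= s ^+ N.+1.
      rewrite (_ : s = 1 + (s - 1)); last by ring.
      by apply: le_trans (b2 _); rewrite ?lerDr//; lra.
    have Kt : a ^- N.+1 / N.+1%:R <= K%:R + 1.
      by rewrite natr1 ltW// /K /ray_exp truncnS_gt.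
    have N0 : 0 < N.+1%:R :> R by rewrite ltr0n.
    have c1 : (a ^- N.+1 / N.+1%:R) * y ^+ N.+1 = (s ^+ N.+1 * s ^+ N.+1) / N.+1%:R.
      rewrite mulrAC -exprVn -exprMn [a^-1 * y]mulrC -s2.
      by rewrite -exprM mulnC exprM expr2.
    have c2 : (s - 1) * s ^+ N.+1 <= (s ^+ N.+1 * s ^+ N.+1) / N.+1%:R.
      rewrite ler_pdivlMr// mulrAC ler_wpM2r ?exprn_ge0 ?(ltW s0)//.
      by rewrite mulrC.
    apply: (le_trans c2); rewrite -c1.
    apply: (@le_trans _ _ ((K%:R + 1) * y ^+ N.+1)).
      by apply: ler_wpM2r; [exact: ltW|].
    by rewrite mulrDl mul1r addrC lerD2r.
  have p0 : 0 < (s - 1) * s ^+ N.+1 by rewrite mulr_gt0// exprn_gt0.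
  rewrite exprVn -invfM -[leRHS]mul1r ler_pdivlMr//.
  apply: le_trans h1; rewrite ler_wpM2l// exprn_ge0// subr_ge0//.
- exact: cvg_cst.
- rewrite -[X in _ --> X](mulr0 (s - 1)^-1); apply: cvgMr.
  have sV : `|s^-1| < 1 by rewrite ger0_norm ?invr_ge0 ?ltW// invf_lt1.
  have := cvg_expr sV; rewrite -cvg_shiftS; apply.
Qed.

End RayApproximation.

Section MomentDeterminacy.
Context (R : realType) (d1 d2 : measure_display)
  (T1 : measurableType d1) (T2 : measurableType d2)
  (m1 : {measure set T1 -> \bar R}) (m2 : {measure set T2 -> \bar R}).
Local Open Scope ereal_scope.

(** The binomial expansion of (1 - y^N)^K has terms of both signs; this recursion in K involves
    nonnegative integrals only, and one of them is cancelled in [moments_poly] because it is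
    finite. *)
Lemma weighted_integral_split d (T : measurableType d)
    (m : {measure set T -> \bar R}) (g : T -> \bar R) (y : T -> R) k N K :
  measurable_fun setT g -> (forall x, 0 <= g x) ->
  measurable_fun setT y -> (forall x, 0 < y x <= 1)%R ->
  \int[m]_x (g x * (y x ^+ k * (1 - y x ^+ N) ^+ K.+1)%:E) +
  \int[m]_x (g x * (y x ^+ (k + N) * (1 - y x ^+ N) ^+ K)%:E) =
  \int[m]_x (g x * (y x ^+ k * (1 - y x ^+ N) ^+ K)%:E).
Proof.
move=> mg g0 my y01.
have y0 x : (0 <= y x)%R by have /andP[/ltW] := y01 x.
have yN x : (0 <= 1 - y x ^+ N)%R.
  by rewrite subr_ge0 exprn_ile1//; have /andP[_] := y01 x.
rewrite -ge0_integralD//; [|by nn|by meas|by nn|by meas].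
apply: eq_integral => x _; rewrite -ge0_muleDr; [|by nn|by nn].
by rewrite -EFinD; congr (_ * _%:E); rewrite exprD !exprS; ring.
Qed.

Lemma gee_pmulr (x : \bar R) (r : R) :
  0 <= x -> (r <= 1)%R -> x * r%:E <= x.
Proof. by move=> x0 r1; rewrite -[leRHS]mule1; apply: lee_wpmul2l => //; rewrite lee_fin. Qed.

Lemma weighted_integral_le d (T : measurableType d)
    (m : {measure set T -> \bar R}) (g : T -> \bar R) (f : T -> R) :
  measurable_fun setT g -> (forall x, 0 <= g x) ->
  measurable_fun setT f -> (forall x, 0 <= f x <= 1)%R ->
  \int[m]_x g x < +oo -> \int[m]_x (g x * (f x)%:E) < +oo.
Proof.
move=> mg g0 mf f01 goo; apply: le_lt_trans goo.
have f0 x : (0 <= f x)%R by have /andP[] := f01 x.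
apply: ge0_le_integral => //; [by nn|by meas|].
by move=> x _; apply: gee_pmulr => //; have /andP[] := f01 x.
Qed.

Variables (g1 : T1 -> \bar R) (g2 : T2 -> \bar R) (y1 : T1 -> R) (y2 : T2 -> R).
Hypotheses (mg1 : measurable_fun setT g1) (mg2 : measurable_fun setT g2).
Hypotheses (g10 : forall x, 0 <= g1 x) (g20 : forall x, 0 <= g2 x).
Hypotheses (g1oo : \int[m1]_x g1 x < +oo) (g2oo : \int[m2]_x g2 x < +oo).
Hypotheses (my1 : measurable_fun setT y1) (my2 : measurable_fun setT y2).
Hypotheses (y101 : forall x, (0 < y1 x <= 1)%R) (y201 : forall x, (0 < y2 x <= 1)%R).
Hypothesis moments : forall k,
  \int[m1]_x (g1 x * (y1 x ^+ k)%:E) = \int[m2]_x (g2 x * (y2 x ^+ k)%:E).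

Lemma moments_poly k N K :
  \int[m1]_x (g1 x * (y1 x ^+ k * (1 - y1 x ^+ N) ^+ K)%:E) =
  \int[m2]_x (g2 x * (y2 x ^+ k * (1 - y2 x ^+ N) ^+ K)%:E).
Proof.
elim: K k => [|K ih] k.
  under eq_integral do rewrite expr0 mulr1.
  by under [RHS]eq_integral do rewrite expr0 mulr1.
have fin1 k' : \int[m1]_x (g1 x * (y1 x ^+ k' * (1 - y1 x ^+ N) ^+ K)%:E) \is a fin_num.
  rewrite ge0_fin_numE.
    apply: weighted_integral_le => //; first by meas.
    move=> x; have /andP[/ltW y0 y1'] := y101 x.
    rewrite mulr_ge0 ?exprn_ge0 ?subr_ge0 ?exprn_ile1//=.
    rewrite mulr_ile1 ?exprn_ge0 ?exprn_ile1 ?subr_ge0 ?exprn_ile1//.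
    by rewrite gerBl exprn_ge0.
  apply: integral_ge0 => x _; apply: mule_ge0 => //; rewrite lee_fin.
  have /andP[/ltW y0 y1'] := y101 x.
  by rewrite mulr_ge0 ?exprn_ge0 ?subr_ge0 ?exprn_ile1.
have := weighted_integral_split m1 k N K mg1 g10 my1 y101.
have := weighted_integral_split m2 k N K mg2 g20 my2 y201.
rewrite -!ih => <-.
move: (fin1 (k + N)%N); move: (\int[m1]_x (g1 x * (y1 x ^+ (k + N) * _)%:E)) => B Bf.
by move=> E; rewrite -[LHS](addeK _ Bf) E addeK.
Qed.

Lemma ray_limit d (T : measurableType d) (m : {measure set T -> \bar R})
    (g : T -> \bar R) (y : T -> R) a : (0 < a)%R ->
  measurable_fun setT g -> (forall x, 0 <= g x) -> \int[m]_x g x < +oo ->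
  measurable_fun setT y -> (forall x, 0 < y x <= 1)%R ->
  \int[m]_x (g x * (ray_approx a N.+1 (y x))%:E) @[N --> \oo] -->
  \int[m]_x (g x * (ray a (y x))%:E).
Proof.
move=> a0 mg g0 goo my y01.
have y01' x : (0 <= y x <= 1)%R by have /andP[/ltW -> ->] := y01 x.
have mr : measurable_fun setT (fun x => ray a (y x)).
  exact: (measurableT_comp (measurable_ray a)).
have gi : m.-integrable setT g.
  apply/integrableP; split => //.
  by under eq_integral do rewrite gee0_abs//.
have := @dominated_convergence _ _ _ m setT measurableT
  (fun N x => g x * (ray_approx a N.+1 (y x))%:E)
  (fun x => g x * (ray a (y x))%:E) g.
case => //.
- by move=> N; rewrite /ray_approx; meas.
- by meas.
(* Convergence of the products is claimed only where g is finite; g may be infinite on a null set,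
   where multiplication by g need not be continuous. *)
- have [N [mN N0 hN]] := integrable_ae measurableT gi.
  exists N; split => // x; apply: contra_notP => Nx _.
  have gf : g x \is a fin_num by apply: contra_notT Nx => gx; apply: hN => /(_ I); exact/negP.
  rewrite -(fineK gf); under eq_fun do rewrite -EFinM.
  rewrite -EFinM; apply: cvg_EFin; first exact: nearW.
  by apply: cvgMr; exact: ray_approx_cvg.
- apply: aeW => x N _; rewrite gee0_abs ?mule_ge0//; last first.
    by rewrite lee_fin ray_approx_ge0.
  by apply: gee_pmulr => //; exact: ray_approx_le1.
Qed.

Lemma ray_of_moments a :
  \int[m1]_x (g1 x * (ray a (y1 x))%:E) = \int[m2]_x (g2 x * (ray a (y2 x))%:E).
Proof.
have [a0|a0] := leP a 0%R.
  rewrite !integral0_eq// => x _.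
    have /andP[yp _] := y201 x.
    by rewrite /ray leNgt (le_lt_trans a0 yp)/= mule0.
  have /andP[yp _] := y101 x.
  by rewrite /ray leNgt (le_lt_trans a0 yp)/= mule0.
have l1 := ray_limit a0 mg1 g10 g1oo my1 y101.
have l2 := ray_limit a0 mg2 g20 g2oo my2 y201.
have e : (fun N => \int[m1]_x (g1 x * (ray_approx a N.+1 (y1 x))%:E)) =
  (fun N => \int[m2]_x (g2 x * (ray_approx a N.+1 (y2 x))%:E)).
  apply/funext => N; have := moments_poly 0 N.+1 (ray_exp a N.+1).
  under eq_integral do rewrite expr0 mul1r.
  by under [X in _ = X -> _]eq_integral do rewrite expr0 mul1r.
by rewrite e in l1; apply: (cvg_unique _ l1 l2).
Qed.

End MomentDeterminacy.

Section JointMoments.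
Context (R : realType) (d1 d2 : measure_display)
  (T1 : measurableType d1) (T2 : measurableType d2)
  (m1 : {measure set T1 -> \bar R}) (m2 : {measure set T2 -> \bar R})
  (I : finType).
Local Open Scope ereal_scope.
Variables (g1 : T1 -> \bar R) (g2 : T2 -> \bar R)
  (c1 : I -> T1 -> R) (c2 : I -> T2 -> R).
Hypotheses (mg1 : measurable_fun setT g1) (mg2 : measurable_fun setT g2).
Hypotheses (g10 : forall x, 0 <= g1 x) (g20 : forall x, 0 <= g2 x).
Hypotheses (g1oo : \int[m1]_x g1 x < +oo) (g2oo : \int[m2]_x g2 x < +oo).
Hypotheses (mc1 : forall i, measurable_fun setT (c1 i))
  (mc2 : forall i, measurable_fun setT (c2 i)).
Hypotheses (c101 : forall i x, (0 < c1 i x <= 1)%R)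
  (c201 : forall i x, (0 < c2 i x <= 1)%R).

Lemma prodr_ge0_le1 (J : Type) (s : seq J) (Q : pred J) (f : J -> R) :
  (forall j, 0 <= f j <= 1)%R -> (0 <= \prod_(j <- s | Q j) f j <= 1)%R.
Proof.
move=> f01; elim/big_rec: _ => [|j x Qj /andP[x0 x1]]; first by rewrite ler01 lexx.
by have /andP[f0 f1] := f01 j; rewrite mulr_ge0//= mulr_ile1.
Qed.

Lemma measurable_prod_cond d (T : measurableType d) (J : eqType) (s : seq J) (Q : pred J)
    (f : J -> T -> R) : (forall j, measurable_fun setT (f j)) ->
  measurable_fun setT (fun x => \prod_(j <- s | Q j) f j x)%R.
Proof.
move=> mf; under eq_fun do rewrite -big_filter.
by apply: measurable_prod => j _; exact: mf.
Qed.

Hypothesis joint_moments : forall k : I -> nat,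
  \int[m1]_x (g1 x * (\prod_i c1 i x ^+ k i)%:E) =
  \int[m2]_x (g2 x * (\prod_i c2 i x ^+ k i)%:E).

(** Intermediate integrand of the induction: the variables with index in s have already become
    indicators of rays, the others are still powers. *)
Let weight d (T : measurableType d) (g : T -> \bar R) (c : I -> T -> R)
    (s : seq I) (k : I -> nat) (b : I -> R) (x : T) :=
  g x * ((\prod_(i | i \notin s) c i x ^+ k i) * \prod_(i <- s) ray (b i) (c i x))%:E.

Let measurable_weight d (T : measurableType d) (g : T -> \bar R) (c : I -> T -> R)
    s k b : measurable_fun setT g -> (forall i, measurable_fun setT (c i)) ->
  measurable_fun setT (weight g c s k b).
Proof.
move=> mg mc; apply: emeasurable_funM => //; apply/measurable_EFinP.
apply: measurable_funM; apply: measurable_prod_cond => i.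
  exact: measurable_funX.
exact: (measurableT_comp (measurable_ray (b i))).
Qed.

Let factor01 d (T : measurableType d) (c : I -> T -> R) s k (b : I -> R) x :
  (forall i x, (0 < c i x <= 1)%R) ->
  (0 <= (\prod_(i | i \notin s) c i x ^+ k i) * \prod_(i <- s) ray (b i) (c i x) <= 1)%R.
Proof.
move=> c01; have /andP[p0 p1] : (0 <= \prod_(i | i \notin s) c i x ^+ k i <= 1)%R.
  apply: prodr_ge0_le1 => i; have /andP[/ltW ci0 ci1] := c01 i x.
  by rewrite exprn_ge0 ?exprn_ile1.
have /andP[q0 q1] : (0 <= \prod_(i <- s) ray (b i) (c i x) <= 1)%R.
  by apply: prodr_ge0_le1 => i; rewrite ray_ge0 ray_le1.
by rewrite mulr_ge0 ?mulr_ile1.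
Qed.

Let weight_ge0 d (T : measurableType d) (g : T -> \bar R) (c : I -> T -> R)
    s k b x : (forall x, 0 <= g x) -> (forall i x, (0 < c i x <= 1)%R) ->
  0 <= weight g c s k b x.
Proof.
move=> g0 c01; apply: mule_ge0 => //; rewrite lee_fin.
by have /andP[] := @factor01 _ _ c s k b x c01.
Qed.

Let weight_fin d (T : measurableType d) (m : {measure set T -> \bar R})
    (g : T -> \bar R) (c : I -> T -> R) s k b :
  measurable_fun setT g -> (forall i, measurable_fun setT (c i)) ->
  (forall x, 0 <= g x) -> (forall i x, (0 < c i x <= 1)%R) ->
  \int[m]_x g x < +oo -> \int[m]_x weight g c s k b x < +oo.
Proof.
move=> mg mc g0 c01; apply: weighted_integral_le => // [|x]; last exact: factor01.
apply: measurable_funM; apply: measurable_prod_cond => i.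
  exact: measurable_funX.
exact: (measurableT_comp (measurable_ray (b i))).
Qed.

Lemma joint_rays_seq s k b : uniq s ->
  \int[m1]_x weight g1 c1 s k b x = \int[m2]_x weight g2 c2 s k b x.
Proof.
elim: s k => [|j s ih] k.
  move=> _; rewrite /weight; under eq_integral do rewrite big_nil mulr1.
  by under [RHS]eq_integral do rewrite big_nil mulr1; exact: joint_moments.
move=> /= /andP[js us].
(* The variable j is about to change from a power to a ray. Exponent l at j produces its moments
   against the product of all the other factors, and l = 0 is that product itself, used as the
   weight in [ray_of_moments]. *)
pose k' l i := if i == j then l else if i \in s then 0%N else k i.
have split_j (f : I -> R) : (\prod_(i | i \notin s) f i =
    f j * \prod_(i | i \notin j :: s) f i)%R.
  rewrite (bigD1 j)//=; congr (_ * _)%R; apply: eq_bigl => i.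
  by rewrite inE negb_or andbC.
have weight_consM d (T : measurableType d) (g : T -> \bar R) (c : I -> T -> R) l x :
    weight g c s (k' l) b x = g x * ((\prod_(i | i \notin j :: s) c i x ^+ k i) *
      \prod_(i <- s) ray (b i) (c i x))%:E * (c j x ^+ l)%:E.
  rewrite /weight split_j /k' eqxx -muleA -EFinM; congr (_ * _%:E).
  rewrite -mulrA mulrC; congr (_ * _ * _)%R; apply: eq_bigr => i.
  by rewrite inE negb_or => /andP[/negbTE -> /negbTE ->].
have weight_consR d (T : measurableType d) (g : T -> \bar R) (c : I -> T -> R) x :
    weight g c (j :: s) k b x = g x * ((\prod_(i | i \notin j :: s) c i x ^+ k i) *
      \prod_(i <- s) ray (b i) (c i x))%:E * (ray (b j) (c j x))%:E.
  rewrite /weight big_cons -muleA -EFinM; congr (_ * _%:E).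
  by rewrite [in LHS]mulrCA mulrC.
have e0 d (T : measurableType d) (g : T -> \bar R) (c : I -> T -> R) x :
    g x * ((\prod_(i | i \notin j :: s) c i x ^+ k i) *
      \prod_(i <- s) ray (b i) (c i x))%:E = weight g c s (k' 0%N) b x.
  by rewrite weight_consM expr0 mule1.
under eq_integral do rewrite weight_consR e0.
under [RHS]eq_integral do rewrite weight_consR e0.
apply: ray_of_moments => //.
- exact: measurable_weight.
- exact: measurable_weight.
- by move=> x; exact: weight_ge0.
- by move=> x; exact: weight_ge0.
- exact: weight_fin.
- exact: weight_fin.
move=> l; under eq_integral do rewrite -e0 -weight_consM.
under [RHS]eq_integral do rewrite -e0 -weight_consM.
exact: ih.
Qed.

Lemma joint_rays b :
  \int[m1]_x (g1 x * (\prod_i ray (b i) (c1 i x))%:E) =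
  \int[m2]_x (g2 x * (\prod_i ray (b i) (c2 i x))%:E).
Proof.
have := @joint_rays_seq (enum I) (fun=> 0%N) b (enum_uniq _); rewrite /weight.
have e i : (i \notin enum I) = false by rewrite mem_enum.
have E (f g : I -> R) : ((\prod_(i | i \notin enum I) f i) * \prod_(i <- enum I) g i =
    \prod_i g i)%R by rewrite (big_pred0 _ _ _ _ e) mul1r big_enum.
under eq_integral do rewrite E.
by under [X in _ = X -> _]eq_integral do rewrite E.
Qed.

End JointMoments.

Section Boxes.
Context (R : realType) (d : nat).
Local Open Scope ereal_scope.

Definition box (b : 'I_d -> R) : set (d.-tuple R) :=
  [set x | forall i, tnth x i <= b i]%R.

Definition boxes : set (set (d.-tuple R)) := range box.

Lemma boxE b : box b = \bigcap_(i in setT) ((fun x : d.-tuple R => tnth x i) @^-1` `]-oo, b i]).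
Proof.
apply/seteqP; split => x /= bx i; last by have := bx i I; rewrite /= in_itv.
by move=> _; rewrite /= in_itv /=; exact: bx.
Qed.

Lemma measurable_box b : measurable (box b).
Proof.
rewrite boxE; apply: fin_bigcap_measurable => // i _.
rewrite -[X in measurable X]setTI; apply: measurable_tnth => //.
Qed.

Lemma boxes_setI_closed : setI_closed boxes.
Proof.
move=> _ _ [b1 _ <-] [b2 _ <-]; exists (fun i => Num.min (b1 i) (b2 i)) => //.
apply/seteqP; split => [x bx|x [b1x b2x] i]; last by rewrite le_min b1x b2x.
by split => i; have := bx i; rewrite le_min => /andP[].
Qed.

Lemma natr_box_cover : \bigcup_k box (fun=> k%:R) = setT.
Proof.
apply/seteqP; split => // x _.
exists (\max_(i < d) (Num.truncn (tnth x i)).+1)%N => // i /=.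
apply: (@le_trans _ _ (Num.truncn (tnth x i)).+1%:R); first by rewrite ltW// truncnS_gt.
by rewrite ler_nat; exact: leq_bigmax.
Qed.

Lemma sigma_boxes : (@measurable _ (d.-tuple R)) = <<s boxes >>.
Proof.
apply/seteqP; split; last first.
  by apply: smallest_sub; [exact: sigma_algebra_measurable|move=> _ [b _ <-]; exact: measurable_box].
move=> A mA.
have mid : measurable_fun setT (fun x : g_sigma_algebraType boxes => x : d.-tuple R).
  apply/measurable_fun_tnthP => i.
  apply: (measurability _ (RGenOInfty.measurableE R)) => _ [_ [a ->] <-].
  rewrite setTI.
  (* The half-space x_i > a is the complement of a countable union of boxes, with bound a in
     direction i and a bound k growing to infinity in the others. *)
  suff -> : (fun x : g_sigma_algebraType boxes => tnth (x : d.-tuple R) i) @^-1` `]a, +oo[ =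
      ~` \bigcup_k box (fun j => if j == i then a else k%:R).
    apply: measurableC; apply: bigcup_measurable => k _.
    by apply: sub_sigma_algebra; exists (fun j => if j == i then a else k%:R).
  apply/seteqP; split => x /=; rewrite in_itv/= andbT.
    by move=> ax [k _ /(_ i)]; rewrite eqxx leNgt ax.
  move=> nb; rewrite ltNge; apply/negP => xa; apply: nb.
  have [k _ xk] : (\bigcup_k box (fun=> k%:R)) x by rewrite natr_box_cover.
  by exists k => // j; case: eqP => [->//|_]; exact: xk.
by have := mid measurableT A mA; rewrite setTI.
Qed.

End Boxes.

Section DensityMeasure.
Context d (T : measurableType d) (R : realType) (m : {measure set T -> \bar R})
  (u : T -> R) (mu : measurable_fun setT u) (u0 : forall x, 0 <= u x).
Local Open Scope ereal_scope.

(* The hypotheses on u are arguments so that the measure structure can be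
   inferred from the term. *)
Definition density_measure of measurable_fun setT u & (forall x, 0 <= u x)%R :=
  fun A : set T => \int[m]_(x in A) (u x)%:E.

Local Notation dm := (density_measure mu u0).

Let density_measure0 : dm set0 = 0.
Proof. exact: integral_set0. Qed.

Let density_measure_ge0 A : 0 <= dm A.
Proof. by apply: integral_ge0 => x _; rewrite lee_fin. Qed.

Let density_measure_sigma_additive : semi_sigma_additive dm.
Proof.
move=> F mF tF mUF; rewrite /density_measure; apply: cvg_toP.
  apply: ereal_nondecreasing_is_cvgn => a b ab; apply: lee_sum_nneg_natr => // k _ _.
  by apply: integral_ge0 => x _; rewrite lee_fin.
rewrite ge0_integral_bigcup//.
  by apply: measurable_funTS; apply/measurable_EFinP.
by move=> x _; rewrite lee_fin.
Qed.

HB.instance Definition _ := isMeasure.Build _ _ _ dm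
  density_measure0 density_measure_ge0 density_measure_sigma_additive.

End DensityMeasure.

Section MGFUnique.
Context (R : realType) (disp : measure_display) (T : measurableType disp)
  (P : probability T R) (d : nat) (X : {RV P >-> d.-tuple R}).
Variables (u : d.-tuple R -> R) (M : R).
Hypotheses (mu : measurable_fun setT u) (u0 : forall x, 0 <= u x)
  (uM : forall x, u x != 0 -> forall i, tnth x i <= M).
Local Open Scope ereal_scope.
Hypothesis mgf : forall xi : d.-tuple R, \int[P]_w (expR (dot xi (X w)))%:E =
  \int[lebesgue_Rn d]_x (expR (dot xi x) * u x)%:E.

Let mX : measurable_fun setT (X : T -> d.-tuple R). Proof. exact: measurable_funPT. Qed.

Let mXi i : measurable_fun setT (fun w => tnth (X w) i).
Proof. exact: (measurableT_comp (measurable_tnth i) mX). Qed.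

Lemma mgf_density_mass1 : \int[lebesgue_Rn d]_x (u x)%:E = 1.
Proof.
have dot0 x : dot [tuple (0 : R)%R | i < d] x = 0%R.
  by rewrite /dot big1// => i _; rewrite tnth_mktuple mul0r.
have := mgf [tuple (0 : R)%R | i < d].
under eq_integral do rewrite dot0 expR0.
under [in X in _ = X -> _]eq_integral do rewrite dot0 expR0 mul1r.
move=> <-; rewrite integral_cst//. by rewrite mul1e; exact: probability_setT.
Qed.

Let measurable_overflow i : measurable [set w | M + 1 <= tnth (X w) i]%R.
Proof.
rewrite (_ : mkset _ = setT `&` (fun w => tnth (X w) i) @^-1` `[(M + 1)%R, +oo[).
  exact: mXi.
by rewrite setTI; apply/seteqP; split => w; rewrite /= in_itv/= andbT.
Qed.

(** Markov's inequality for exp(N X_i): by the equality of transforms its expectation is an integral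
    against u, at most exp(N M) by the bound on the support. The margin 1 beyond M leaves exp(-
    N). *)
Lemma chernoff i N :
  P [set w | M + 1 <= tnth (X w) i]%R <= (expR (- N%:R))%:E.
Proof.
pose xi : d.-tuple R := [tuple ((j == i)%:R * N%:R)%R | j < d].
have dotxi x : dot xi x = (N%:R * tnth x i)%R.
  rewrite /dot (bigD1 i)//= big1 ?addr0 => [|j /negbTE ji].
    by rewrite tnth_mktuple eqxx mul1r.
  by rewrite tnth_mktuple ji !mul0r.
have mE : measurable_fun setT (fun w => (expR (dot xi (X w)))%:E).
  apply/measurable_EFinP; apply: measurableT_comp; first exact: measurable_expR.
  exact: (measurableT_comp (measurable_dot xi) mX).
have := measurable_overflow i; set A := [set w | _] => mA.
rewrite -(@lee_pmul2l _ (expR (N%:R * (M + 1)))%:E); [|by []|by rewrite lte_fin expR_gt0].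
rewrite -EFinM -expRD (_ : N%:R * (M + 1) + - N%:R = N%:R * M)%R; last by ring.
apply: (@le_trans _ _ (\int[P]_w (expR (dot xi (X w)))%:E)).
  rewrite -integral_cst//; apply: (@le_trans _ _ (\int[P]_(w in A) (expR (dot xi (X w)))%:E)).
    apply: ge0_le_integral => //; [by nn|exact: measurable_funTS|].
    by move=> w Aw; rewrite lee_fin ler_expR dotxi ler_wpM2l.
  by apply: ge0_subset_integral => //; by nn.
rewrite mgf -[leRHS]mule1 -mgf_density_mass1 -ge0_integralTZl; [|by nn|by meas|by nn].
apply: ge0_le_integral => //; [by nn|by meas|by meas|].
move=> x _; rewrite -EFinM lee_fin; have [->|ux] := eqVneq (u x) 0%R; first by rewrite !mulr0.
by rewrite ler_wpM2r// ler_expR dotxi ler_wpM2l// uM.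
Qed.

Lemma mgf_null i : P [set w | M + 1 <= tnth (X w) i]%R = 0.
Proof.
set p := P _; have p0 : 0 <= p by exact: measure_ge0.
have pf : p \is a fin_num by apply: fin_num_measure; exact: measurable_overflow.
apply/eqP; rewrite eq_le p0 andbT leNgt; apply/negP.
rewrite -(fineK pf) lte_fin => fp0; set q := fine p in fp0.
(* With N > 1 / q, the inequality exp(N) >= 1 + N > 1 / q contradicts q <= exp(- N). *)
have := @chernoff i (Num.truncn q^-1).+1; rewrite -/p -(fineK pf) -/q lee_fin.
apply/negP; rewrite -ltNge expRN invf_plt ?posrE ?expR_gt0//.
apply: lt_le_trans (expR_ge1Dx _); apply: lt_trans (truncnS_gt _) _.
by rewrite ltrDr.
Qed.

Lemma mgf_bounded : {ae P, forall w, forall i, (tnth (X w) i <= M + 1)%R}.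
Proof.
apply: filter_forall => i; exists [set w | M + 1 <= tnth (X w) i]%R; split.
- exact: measurable_overflow.
- exact: mgf_null.
- by move=> w /= /negP; rewrite -ltNge => /ltW.
Qed.

(* On the support this is exp(y - (M + 1)), an element of (0, 1]. *)
Let clip (y : R) : R := expR (if (y <= M + 1)%R then y - (M + 1) else 0)%R.

Let measurable_clip : measurable_fun setT clip.
Proof. by apply: measurableT_comp; [exact: measurable_expR|meas]. Qed.

Let clip01 y : (0 < clip y <= 1)%R.
Proof.
by rewrite /clip expR_gt0 /= -[leRHS]expR0 ler_expR; case: ifP => // yM; rewrite subr_le0.
Qed.

Let prod_clip (k : 'I_d -> nat) : exists xi : d.-tuple R, exists2 C : R, (0 <= C)%R &
  forall x : d.-tuple R, (forall i, tnth x i <= M + 1)%R ->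
  (\prod_i clip (tnth x i) ^+ k i = C * expR (dot xi x))%R.
Proof.
(* On the support the k_i-th power of the clipped coordinate is exp(k_i x_i - k_i (M + 1)); C
   collects the constant parts. *)
exists [tuple (k i)%:R | i < d], (expR (- \sum_i ((k i)%:R * (M + 1)))%R).
  exact: expR_ge0.
move=> x xM; rewrite -expRD /dot addrC -sumrB expR_sum; apply: eq_bigr => i _.
by rewrite /clip xM tnth_mktuple -mulrBr expRM_natl.
Qed.

Let prod_ray (b : 'I_d -> R) (x : d.-tuple R) : (forall i, tnth x i <= M + 1)%R ->
  (\prod_i ray (expR (b i - (M + 1))) (clip (tnth x i)) = \1_(box b) x)%R.
Proof.
move=> xM; have rayE i :
    ray (expR (b i - (M + 1))) (clip (tnth x i)) = (tnth x i <= b i)%R%:R.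
  by rewrite /ray /clip xM ler_expR lerD2r; case: ifP.
rewrite indicE; under eq_bigr do rewrite rayE.
have [xb|xb] := pselect (box b x).
  by rewrite mem_set// big1// => i _; rewrite xb.
have [i ib] : exists i, ~ (tnth x i <= b i)%R by apply/existsNP.
by rewrite memNset// (bigD1 i)//= (negbTE (introN idP ib)) mul0r.
Qed.

Let support_clip x (f g : R) : ((forall i, tnth x i <= M + 1) -> f = g)%R ->
  ((u x)%:E * f%:E = (u x)%:E * g%:E).
Proof.
move=> fg; have [->|ux] := eqVneq (u x) 0%R; first by rewrite !mul0e.
by rewrite fg// => i; apply: le_trans (uM ux i) _; rewrite lerDl.
Qed.

Lemma mgf_box b : P (X @^-1` box b) = \int[lebesgue_Rn d]_(x in box b) (u x)%:E.
Proof.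
have mXE (xi : d.-tuple R) : measurable_fun setT (fun w => expR (dot xi (X w))).
  apply: measurableT_comp; first exact: measurable_expR.
  exact: (measurableT_comp (measurable_dot xi) mX).
have mc1 i : measurable_fun setT (fun w => clip (tnth (X w) i)).
  exact: (measurableT_comp measurable_clip (mXi i)).
have mc2 i : measurable_fun setT (fun x : d.-tuple R => clip (tnth x i)).
  exact: (measurableT_comp measurable_clip (measurable_tnth i)).
have muE : measurable_fun setT (fun x => (u x)%:E) by apply/measurable_EFinP.
(* The clipped variables are genuine exponentials only where all x_i <= M + 1. On the side of X this
   holds almost surely, which is what [ae_X] uses; on the side of u the other points have u = 0,
   which is what [support_clip] uses. *)
have ae_X (f g : d.-tuple R -> R) : measurable_fun setT (fun w => f (X w)) ->
    measurable_fun setT (fun w => g (X w)) ->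
    (forall x, (forall i, tnth x i <= M + 1)%R -> f x = g x) ->
    \int[P]_w (f (X w))%:E = \int[P]_w (g (X w))%:E.
  move=> mf mg fg; apply: ae_eq_integral => //; [exact/measurable_EFinP|exact/measurable_EFinP|].
  by apply: filterS mgf_bounded => w wM _; congr _%:E; exact: fg.
have mr a i : measurable_fun setT (fun w => ray (a i) (clip (tnth (X w) i))).
  exact: (measurableT_comp (measurable_ray (a i)) (mc1 i)).
have mXb : measurable (X @^-1` box b).
  by rewrite -[X in measurable X]setTI; apply: mX => //; exact: measurable_box.
have iE w : \1_(box b) (X w) = \1_(X @^-1` box b) w :> R.
  by rewrite !indicE; congr ((_ : bool)%:R)%R; apply/idP/idP => /set_mem ?; exact/mem_set.
have E : \int[P]_w (cst 1 w * (\prod_i ray (expR (b i - (M + 1))) (clip (tnth (X w) i)))%:E)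
    = \int[lebesgue_Rn d]_x ((u x)%:E *
        (\prod_i ray (expR (b i - (M + 1))) (clip (tnth x i)))%:E).
  apply: joint_rays => //.
  - by rewrite integral_cst// mul1e; apply: le_lt_trans (ltry 1); exact: probability_le1.
  - by rewrite mgf_density_mass1 ltry.
  move=> k; under eq_integral do rewrite mul1e.
  have [xi [C C0 CE]] := prod_clip k.
  transitivity (\int[P]_w (C%:E * (expR (dot xi (X w)))%:E)).
    apply: (ae_X (fun x => \prod_i clip (tnth x i) ^+ k i)%R
      (fun x => C * expR (dot xi x))%R _ _ CE).
      by apply: measurable_prod => i _; apply: measurable_funX; exact: mc1.
    by apply: measurable_funM.
  rewrite ge0_integralTZl; [|exact: C0|exact/measurable_EFinP|by nn].
  rewrite mgf -ge0_integralTZl; last 3 first.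
  - exact: C0.
  - apply/measurable_EFinP; apply: measurable_funM => //.
    apply: measurableT_comp; [exact: measurable_expR|exact: measurable_dot].
  - by move=> x; rewrite lee_fin; apply: mulr_ge0 => //; exact: expR_ge0.
  apply: eq_integral => x _; rewrite (support_clip (CE x)).
  by rewrite -!EFinM; congr _%:E; move: (expR _) => e; ring.
move: E; under eq_integral do rewrite mul1e.
rewrite (_ : \int[P]_w _ = \int[P]_w (\1_(box b) (X w))%:E); last first.
  apply: (ae_X (fun x => \prod_i ray (expR (b i - (M + 1))) (clip (tnth x i)))%R
    (fun x => \1_(box b) x) _ _ (@prod_ray b)).
    by apply: measurable_prod => i _; exact: (mr (fun i => expR (b i - (M + 1)))%R).
  by rewrite (_ : (fun w => _) = \1_(X @^-1` box b)); [exact: measurable_indic|exact/funext].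
under eq_integral do rewrite iE.
rewrite integral_indic// setIT => ->.
rewrite [RHS]integral_mkcond; apply: eq_integral => x _.
rewrite (support_clip (prod_ray b (x := x))) patchE indicE.
by case: ifP; rewrite ?mule1 ?mule0.
Qed.

(** The boxes are closed under intersection and generate the sigma-algebra, and those with all
    bounds equal to k exhaust the space with finite measure, so agreement on boxes suffices. *)
Lemma mgf_unique : has_density X u.
Proof.
have E : forall A, measurable A ->
    distribution P X A = density_measure (lebesgue_Rn d) mu u0 A.
  pose m1 : {measure set (d.-tuple R) -> \bar R} := distribution P X.
  pose m2 : {measure set (d.-tuple R) -> \bar R} := density_measure (lebesgue_Rn d) mu u0.
  move=> A mA; apply: (@measure_unique _ R _ (@boxes R d) (fun k => box (fun=> k%:R))
    (sigma_boxes R d) (@boxes_setI_closed R d) _ _ m1 m2 _ _ A mA).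
  - by move=> k; exists (fun=> k%:R).
  - exact: natr_box_cover.
  - by move=> _ [b _ <-]; exact: mgf_box.
  - move=> k; apply: (@le_lt_trans _ _ 1); last exact: ltry.
    by apply: probability_le1; exact: measurable_box.
by split=> // A mA; exact: E.
Qed.

End MGFUnique.

(** * The Kompanets-Zeldovich-Barenblatt density *)

Lemma kzb_B_gt0 (R : realType) d (m : R) : 1 < m -> 0 < kzb_B d m.
Proof.
move=> m1; rewrite /kzb_B divr_gt0 ?subr_gt0// mulr_gt0//.
  by rewrite mulr_gt0// (lt_trans _ m1).
by rewrite ltr_wpDr// mulr_ge0// subr_ge0 ltW.
Qed.

Section BallDensity.
Context (R : realType) (d : nat).
Implicit Types (r p : R) (x xi : d.-tuple R).

Lemma dot_scalel r xi x : dot (scale r xi) x = r * dot xi x.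
Proof.
rewrite /dot mulr_sumr; apply: eq_bigr => i _.
by rewrite tnth_mktuple mulrA.
Qed.

(** The multivariate Pearson type II law on the ball of radius r. The profile has exponent p - 1, as
    in [tpow], hence 1 / (m - 1) at p = m / (m - 1). *)
Definition ball_density r p x : R :=
  Gamma (d%:R / 2 + p) / (Gamma p * (Num.sqrt pi ^+ d * r ^+ d)) *
  tpow p (1 - sqn x / r ^+ 2).

Lemma measurable_ball_density r p : measurable_fun setT (ball_density r p).
Proof. by apply: measurable_funM; [exact: measurable_cst|meas]. Qed.

Lemma ball_density_ge0 r p x : 0 < r -> 0 < p -> 0 <= ball_density r p x.
Proof.
move=> r0 p0; have dp : 0 < d%:R / 2 + p by rewrite ltr_wpDl// divr_ge0.
apply: mulr_ge0; last exact: tpow_ge0.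
by rewrite divr_ge0 ?mulr_ge0 ?exprn_ge0 ?sqrtr_ge0 ?(ltW (Gamma_gt0 _)) ?(ltW r0).
Qed.

Lemma ball_density_support r p x : 0 < r -> ball_density r p x != 0 ->
  forall i, tnth x i <= r.
Proof.
move=> r0 + i; apply: contraNT; rewrite -ltNge => ri.
rewrite /ball_density tpow0 ?mulr0// subr_le0 ler_pdivlMr ?exprn_gt0// mul1r.
apply: (@le_trans _ _ (tnth x i ^+ 2)).
  by rewrite lerXn2r ?nnegrE ?(ltW ri)// ltW// (lt_trans r0).
rewrite /sqn /dot (bigD1 i)//= -expr2 lerDl.
by apply: sumr_ge0 => j _; rewrite -expr2 sqr_ge0.
Qed.

Lemma ball_density_mgf r p xi : 0 < r -> 0 < p ->
  (\int[lebesgue_Rn d]_x (expR (dot xi x) * ball_density r p x)%:E =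
   bessel_series (d%:R / 2 + p) (r ^+ 2 * sqn xi))%E.
Proof.
move=> r0 p0; have dp : 0 < d%:R / 2 + p by rewrite ltr_wpDl// divr_ge0.
have mb := measurable_ball_density r p.
have b0 x := ball_density_ge0 x r0 p0.
rewrite -(@integral_scale _ _ _ r); last 3 first.
- by rewrite gt_eqF.
- by meas.
- by nn.
pose C := Gamma (d%:R / 2 + p) / (Gamma p * (Num.sqrt pi ^+ d * r ^+ d)).
have C0 : 0 <= C.
  by rewrite divr_ge0 ?mulr_ge0 ?exprn_ge0 ?sqrtr_ge0 ?(ltW (Gamma_gt0 _)) ?(ltW r0).
under eq_integral => x _.
  rewrite /ball_density -/C sqn_scale [_ * sqn x]mulrC mulfK ?expf_neq0 ?gt_eqF//.
  rewrite mulrCA dot_scale -dot_scalel EFinM.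
  over.
rewrite ge0_integralTZl; [|exact: C0|by meas|by nn].
rewrite ball_mgf// sqn_scale !muleA -!EFinM gtr0_norm//.
rewrite (_ : (_ * _ * _)%R = 1) ?mul1e//.
have := Gamma_gt0 dp; have := Gamma_gt0 p0; rewrite /C.
move: (Gamma _) (Gamma _) => g1 g2 g10 g20.
have : 0 < Num.sqrt pi :> R by rewrite sqrtr_gt0 pi_gt0.
move: (Num.sqrt pi) => s s0.
by field; rewrite !expf_neq0 ?gt_eqF.
Qed.

Context (disp : measure_display) (T : measurableType disp)
  (P : probability T R) (X : {RV P >-> d.-tuple R}).

Lemma ball_density_of_mgf r p : 0 < r -> 0 < p ->
  (forall xi, \int[P]_w (expR (dot xi (X w)))%:E =
    bessel_series (d%:R / 2 + p) (r ^+ 2 * sqn xi))%E ->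
  has_density X (ball_density r p).
Proof.
move=> r0 p0 E; apply: (@mgf_unique _ _ _ _ _ _ _ r).
- exact: measurable_ball_density.
- by move=> x; exact: ball_density_ge0.
- by move=> x; exact: ball_density_support.
- by move=> xi; rewrite E ball_density_mgf.
Qed.

(** The radius is where 1 - B |x|^2 / t^(2 beta) vanishes, and alpha = d beta makes t^(- alpha) the
    factor that r^d contributes to the normalisation. *)
Lemma kzbE (m : R) x t : 1 < m -> 0 < t ->
  kzb m x t = ball_density (t `^ kzb_beta d m / Num.sqrt (kzb_B d m)) (m / (m - 1)) x.
Proof.
move=> m1 t0; have B0 := kzb_B_gt0 d m1.
rewrite /kzb /kzb_C /ball_density /kzb_alpha.
move: (kzb_beta d m) (kzb_B d m) B0 => b B B0.
have -> : tpow (m / (m - 1)) (1 - sqn x / (t `^ b / Num.sqrt B) ^+ 2) =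
    Num.max 0 (1 - B * (norm2 x ^+ 2 / t `^ (2 * b))) `^ (1 / (m - 1)).
  rewrite norm2_sqr expr_div_n sqr_sqrtr ?(ltW B0)// -powR_mulrn ?powR_ge0//.
  rewrite -powRrM [b * _]mulrC.
  rewrite (_ : sqn x / (t `^ (2 * b) / B) = B * (sqn x / t `^ (2 * b))); last first.
    by rewrite invfM invrK; ring.
  move: (1 - _) => y; rewrite /tpow; have [y0|y0] := ltP 0 y.
    congr (_ `^ _); rewrite (_ : m / (m - 1) - 1 = 1 / (m - 1))//.
    by field; rewrite subr_eq0 gt_eqF.
  (* Outside the ball the maximum is 0, and 0 to the power 1 / (m - 1) is 0 because this exponent is
     nonzero. *)
  by rewrite powR0// div1r invr_eq0 subr_eq0 gt_eqF.
congr (_ * _).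
rewrite powRN -[d%:R * b]mulrC (powRrM t) powR_mulrn ?powR_ge0//.
rewrite -(powR_sqrt_exprn d (pi_gt0 R)) -(powR_sqrt_exprn d B0).
have : 0 < t `^ b by rewrite powR_gt0.
have : 0 < Num.sqrt B by rewrite sqrtr_gt0.
rewrite expr_div_n.
move: (Gamma _) (Gamma _) (Num.sqrt B) (t `^ b) (Num.sqrt pi) => g1 g2 B' t' s B'0 t'0.
rewrite !invfM invrK; ring.
Qed.

End BallDensity.

(** * Random flights *)

Section BesselSeries.
Context (R : realType).
Implicit Types (c z : R).
Local Open Scope ereal_scope.

Lemma bessel_series_ge0 c z : (0 < c)%R -> (0 <= z)%R -> 0 <= bessel_series c z.
Proof.
move=> c0 z0; apply: nneseries_ge0 => k _ _; rewrite lee_fin.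
by rewrite divr_ge0 ?exprn_ge0// !mulr_ge0 ?exprn_ge0 ?rising_ge0.
Qed.

Lemma le_rising c1 c2 k : (0 < c1)%R -> (c1 <= c2)%R -> (rising c1 k <= rising c2 k)%R.
Proof.
move=> c10 c12; apply: ler_prod => i _.
by rewrite addr_ge0 ?(ltW c10)//= lerD2r.
Qed.

(** At c = 1/2 the series is cosh(sqrt z), since (2k)! = 4^k k! (1/2)_k, and its denominators grow
    with c. It is applied with c = d/2 and d >= 1. *)
Lemma bessel_series_lty c z : (2^-1 <= c)%R -> (0 <= z)%R -> bessel_series c z < +oo.
Proof.
move=> c12 z0; have h0 : (0 < 2^-1 :> R)%R by rewrite invr_gt0.
have c0 : (0 < c)%R by apply: lt_le_trans c12.
pose y : R := Num.sqrt z; have yz : (y ^+ 2 = z)%R by rewrite sqr_sqrtr.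
apply: (@le_lt_trans _ _ (2^-1 * (expR y + expR (- y)))%:E); last exact: ltry.
rewrite cosh_series; apply: lee_nneseries => k _ //.
  by rewrite lee_fin divr_ge0 ?exprn_ge0// !mulr_ge0 ?exprn_ge0 ?rising_ge0.
rewrite lee_fin -yz -exprM mul2n ler_wpM2l ?exprn_double_ge0//.
have D0 : (0 < 4 ^+ k * k`!%:R :> R)%R by rewrite mulr_gt0 ?exprn_gt0// ltr0n fact_gt0.
rewrite lef_pV2 ?posrE; last 2 first.
- by rewrite mulr_gt0// rising_gt0.
- by rewrite ltr0n fact_gt0.
rewrite (_ : (k.*2)`!%:R = 4 ^+ k * k`!%:R * rising 2^-1 k)%R; last first.
  by rewrite rising_half mulrC divfK// gt_eqF.
by rewrite ler_wpM2l ?(ltW D0)// le_rising.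
Qed.

Lemma measurable_bessel_series d (T : measurableType d) c (h : T -> R) :
  (0 < c)%R -> (forall x, 0 <= h x)%R -> measurable_fun setT h ->
  measurable_fun setT (fun x => bessel_series c (h x)).
Proof.
move=> c0 h0 mh; apply: measurable_nneseries => k => [x|].
  rewrite lee_fin.
  by rewrite divr_ge0 ?exprn_ge0// !mulr_ge0 ?exprn_ge0 ?rising_ge0.
by apply/measurable_EFinP; apply: measurable_funM => //; exact: measurable_funX.
Qed.

End BesselSeries.

Section FlightMGF.
Context (R : realType) (disp : measure_display) (T : measurableType disp)
  (P : probability T R) (c : R) (n : nat) (t : R) (f : n.-tuple R -> R) (d : nat)
  (X : {RV P >-> d.-tuple R}).
Hypotheses (d0 : (0 < d)%N) (flight : flight_position c t f X).
Local Open Scope ereal_scope.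

Lemma flight_mgf (xi : d.-tuple R) :
  \int[P]_w (expR (dot xi (X w)))%:E =
  \int[lebesgue_Rn n]_x ((f x)%:E *
    \prod_(k < n.+1) bessel_series (d%:R / 2) (intertime t x k ^+ 2 * (c ^+ 2 * sqn xi))).
Proof.
have [tau [V [tauf uV indV indVtau XE]]] := flight.
have d2 : (2^-1 <= d%:R / 2 :> R)%R by rewrite -[leLHS]mul1r ler_wpM2r// ler1n.
have d20 : (0 < d%:R / 2 :> R)%R by rewrite divr_gt0// ltr0n.
have zz0 x k : (0 <= intertime t x k ^+ 2 * (c ^+ 2 * sqn xi))%R.
  by rewrite mulr_ge0 ?sqr_ge0// mulr_ge0 ?sqr_ge0 ?sqn_ge0.
have mV k : measurable_fun setT (V k : T -> d.-tuple R) by exact: measurable_funPT.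
have mtau : measurable_fun setT (tau : T -> n.-tuple R) by exact: measurable_funPT.
pose F (v : n.+1.-tuple (d.-tuple R)) (s : n.-tuple R) : \bar R :=
  (expR (\sum_(k < n.+1) c * intertime t s k * dot xi (tnth v k)))%:E.
pose VV w := [tuple V k w | k < n.+1].
have mVV : measurable_fun setT VV.
  apply/measurable_fun_tnthP => k; rewrite (_ : _ \o _ = V k)//.
  by apply/funext => w /=; rewrite tnth_mktuple.
transitivity (\int[P]_w F (VV w) (tau w)).
  apply: eq_integral => w _; congr (expR _)%:E; rewrite XE {1}/dot.
  under eq_bigr do rewrite tnth_mktuple mulr_sumr mulr_sumr.
  rewrite exchange_big/=; apply: eq_bigr => k _; rewrite /VV tnth_mktuple mulr_sumr.
  by apply: eq_bigr => i _; ring.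
have mF : measurable_fun setT (fun z => F z.1 z.2).
  apply/measurable_EFinP; apply: measurableT_comp; first exact: measurable_expR.
  apply: measurable_sum => k; apply: measurable_funM.
    apply: measurable_funM => //.
    exact: (measurableT_comp (measurable_intertime t k) measurable_snd).
  apply: (measurableT_comp (measurable_dot xi)).
  exact: (measurableT_comp (measurable_tnth k) measurable_fst).
rewrite (expectation_independent mVV mtau indVtau mF); last first.
  by move=> v s; rewrite lee_fin expR_ge0.
pose G s : \bar R := \prod_(k < n.+1) bessel_series (d%:R / 2)
  (intertime t s k ^+ 2 * (c ^+ 2 * sqn xi)).
have Gfin s : G s \is a fin_num.
  apply: prode_fin_num => k _; rewrite ge0_fin_numE; first exact: bessel_series_lty.
  exact: bessel_series_ge0.
have G0 s : 0 <= G s by apply: prode_ge0 => k _; exact: bessel_series_ge0.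
have mG : measurable_fun setT G.
  apply: emeasurable_prod => k; apply: measurable_bessel_series => //.
  apply: measurable_funM => //; apply: measurable_funX; exact: measurable_intertime.
(* With the intertimes frozen, independence of the directions gives one Bessel series per flight
   segment. [fine] yields a real function of the intertimes, to which their density can be
   applied. *)
transitivity (\int[P]_v (fine (G (tau v)))%:E).
  apply: eq_integral => v _.
  pose h (k : 'I_n.+1) (y : d.-tuple R) := expR (dot (scale (c * intertime t (tau v) k) xi) y).
  transitivity (\int[P]_w \prod_k (h k (V k w))%:E).
    apply: eq_integral => w _; rewrite /F expR_sum -prodEFin; apply: eq_bigr => k _.
    by rewrite /h dot_scalel /VV tnth_mktuple.
  rewrite expectation_prod_independent//; last 2 first.
  - move=> k; apply: measurableT_comp; [exact: measurable_expR|exact: measurable_dot].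
  - by move=> k y; exact: expR_ge0.
  rewrite fineK; last exact: Gfin.
  apply: eq_bigr => k _; rewrite /h sphere_mgf// sqn_scale.
  by congr (bessel_series _ _); ring.
rewrite (@expectation_density _ _ _ _ _ tau f (fun s => fine (G s)) tauf); last 2 first.
- exact: measurableT_comp.
- by move=> s; exact: fine_ge0.
by apply: eq_integral => s _; rewrite EFinM fineK.
Qed.

End FlightMGF.

Section FlightDensity.
Context (R : realType) (disp : measure_display) (T : measurableType disp)
  (P : probability T R) (n d : nat) (c t : R) (X : {RV P >-> d.-tuple R}).
Hypotheses (d0 : (0 < d)%N) (c0 : 0 < c) (t0 : 0 < t).

(** The last two conditions on [Phi] are one formula at a and at (n + 1) a. The factor (a)_(2k) is
    matched by the Dirichlet weights, the factor ((n + 1) a)_(2k) cancels against the final kernel,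
    and what remains is the move from d/2 to d/2 + p. *)
Lemma dirichlet_flight_density (Phi : R -> nat -> R) (a p : R) :
  0 < a -> 0 < p ->
  (forall x k, 0 < x -> 0 <= Phi x k) ->
  (forall x y N, cauchy_prod (Phi x) (Phi y) N = Phi (x + y) N) ->
  (forall k, Phi a k = rising a k.*2 / (4 ^+ k * k`!%:R * rising (d%:R / 2) k)) ->
  (forall k, Phi (n.+1%:R * a) k =
    rising (n.+1%:R * a) k.*2 / (4 ^+ k * k`!%:R * rising (d%:R / 2 + p) k)) ->
  flight_position c t (@dirichlet_pdf R n t a) X ->
  has_density X (ball_density (t * c) p).
Proof.
move=> a0 p0 Phi0 PhiD Phia PhiA flight.
have d20 : 0 < d%:R / 2 :> R by rewrite divr_gt0// ltr0n.
apply: ball_density_of_mgf => [|//|xi]; first exact: mulr_gt0.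
rewrite (flight_mgf d0 flight) (dirichlet_mgf Phi0 PhiD a0 d20 Phia)//; last first.
  by rewrite mulr_ge0 ?sqr_ge0 ?sqn_ge0.
rewrite /bessel_series; apply: eq_eseriesr => k _.
rewrite PhiA mulrA -exprMn; move: (((t * c) ^+ 2 * sqn xi) ^+ k) => z.
have : 0 < rising (n.+1%:R * a) k.*2 by rewrite rising_gt0// mulr_gt0// ltr0n.
move: (rising _ k.*2) => r r0; rewrite [r / _]mulrC mulfK ?gt_eqF//.
by rewrite mulrC.
Qed.

(** By duplication (x)_(2k) = 4^k (x/2)_k ((x + 1)/2)_k, so the Bessel parameter is (x + 1)/2: it is
    d/2 at x = d - 1 and d/2 + n (d - 1)/2 at x = (n + 1)(d - 1). *)
Lemma flight_f2_density : (0 < n)%N -> (2 <= d)%N ->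
  flight_position c t (@f2 R n t d) X ->
  has_density X (ball_density (t * c) (n%:R * (d%:R - 1) / 2)).
Proof.
move=> n0 d2; have a0 : 0 < d%:R - 1 :> R by rewrite subr_gt0 ltr1n.
have phiE (x : R) k : 0 < x ->
    phi_bessel x k = rising x k.*2 / (4 ^+ k * k`!%:R * rising ((x + 1) / 2) k).
  move=> x0; rewrite rising_double /phi_bessel.
  have : 0 < rising ((x + 1) / 2) k by rewrite rising_gt0// divr_gt0// addr_gt0.
  move: (rising _ _) (rising _ _) (fact_neq0 R k) => q r k0 r0.
  by field; rewrite k0 gt_eqF// expf_neq0.
apply: (dirichlet_flight_density (Phi := @phi_bessel R)) => //.
- by rewrite divr_gt0// mulr_gt0// ltr0n.
- by move=> x k; exact: phi_bessel_ge0.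
- by move=> x y N; exact: cauchy_phi_bessel.
- by move=> k; rewrite phiE// subrK.
- move=> k; rewrite phiE; last by rewrite mulr_gt0// ltr0n.
  congr (_ / (_ * rising _ _)).
  by rewrite -natr1; field.
Qed.

(** Here the Bessel parameter is x + 1: it is d/2 at x = d/2 - 1 and d/2 + n (d - 2)/2 at x = (n +
    1)(d/2 - 1). *)
Lemma flight_f3_density : (0 < n)%N -> (3 <= d)%N ->
  flight_position c t (@f3 R n t d) X ->
  has_density X (ball_density (t * c) (n%:R * (d%:R - 2) / 2)).
Proof.
move=> n0 d3; have d20 : 0 < d%:R - 2 :> R by rewrite subr_gt0 ltr_nat.
have a0 : 0 < d%:R / 2 - 1 :> R by lra.
apply: (dirichlet_flight_density (Phi := @phi_hagen R)) => //.
- by rewrite divr_gt0// mulr_gt0// ltr0n.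
- by move=> x k; exact: phi_hagen_ge0.
- by move=> x y N; exact: cauchy_phi_hagen.
- by move=> k; rewrite phi_hagenE// subrK.
- move=> k; rewrite phi_hagenE; last by rewrite mulr_gt0// ltr0n.
  congr (_ / (_ * rising _ _)).
  by rewrite -natr1; field.
Qed.

End FlightDensity.

(** * The telegraph process *)

Section TruncatedExponentials.
Context (R : realType).
Local Notation mu := (@lebesgue_measure R).
Local Open Scope ereal_scope.
Implicit Types (eta s t : R).

Definition expo eta s : \bar R := (tpow 1 s * expR (eta * s))%:E.

Lemma expo_ge0 eta s : 0 <= expo eta s.
Proof. by rewrite lee_fin mulr_ge0 ?tpow_ge0 ?expR_ge0. Qed.

Lemma measurable_expo eta : measurable_fun setT (expo eta).
Proof. by rewrite /expo; meas. Qed.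

Lemma tpow1E s : tpow 1 s = (0 < s)%R%:R.
Proof. by rewrite /tpow subrr powRr0; case: ifP. Qed.

Lemma phi_bessel2 k : phi_bessel 2 k = 1%R :> R.
Proof. by rewrite /phi_bessel divff ?pnatr_eq0// rising1 divff// fact_neq0. Qed.

(** On s > 0 this is cosh(eta s). Its Laplace transform s^-1 (1 - eta^2 / s^2)^-1 explains the
    all-ones sequence [phi_bessel 2]. *)
Lemma expo_cosh eta s :
  (2^-1)%:E * (expo eta s + expo (- eta)%R s) = gseries (phi_bessel 2) 1 (eta ^+ 2) s.
Proof.
have h0 : (0 < 2^-1 :> R)%R by rewrite invr_gt0.
have e2 : (0 <= eta ^+ 2)%R by exact: sqr_ge0.
have := @tpow_bessel_series R (fun=> phi_bessel 2) _ 1 2^-1 ltr01 h0 _ (eta ^+ 2)%R s e2.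
rewrite Gamma1 mul1e => <-; last 2 first.
- by move=> _ k _; exact: phi_bessel_ge0.
- move=> k; rewrite phi_bessel2 rising1 (_ : (k.*2)`!%:R = 4 ^+ k * k`!%:R * rising 2^-1 k)%R.
    by rewrite divff// !mulf_neq0 ?expf_neq0 ?fact_neq0 ?gt_eqF ?rising_gt0.
  by rewrite rising_half mulrC divfK// mulf_neq0 ?expf_neq0 ?fact_neq0.
rewrite -EFinD -EFinM /bessel_series.
transitivity ((tpow 1 s)%:E * ((2^-1 * (expR (eta * s) + expR (- (eta * s))))%R)%:E).
  by rewrite -EFinM -mulrDr mulNr mulrCA.
rewrite cosh_series; congr (_ * _); apply: eq_eseriesr => k _; congr _%:E.
rewrite (_ : (k.*2)`!%:R = 4 ^+ k * k`!%:R * rising 2^-1 k)%R.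
  by rewrite -exprMn [(s * eta)%R]mulrC -exprM mul2n.
by rewrite rising_half mulrC divfK// mulf_neq0 ?expf_neq0 ?fact_neq0.
Qed.

(** The substitution x = (1 + y) t / 2 turns the integrand into exp(eta t y) on (-1, 1), the case d
    = p = 1 of [ball_mgf]; the series of sinh(eta t) / eta comes out without a division by eta. The
    parameter 3/2 is d/2 + p. *)
Lemma conv_expo eta t :
  conv (expo eta) (expo (- eta)%R) t = gseries (phi_bessel 2) 2 (eta ^+ 2) t.
Proof.
have h0 : (0 < 3 / 2 :> R)%R by rewrite divr_gt0.
have e2 : (0 <= eta ^+ 2)%R by exact: sqr_ge0.
have G2 : Gamma 2 = 1%R :> R by rewrite -[2%R]/(1 + 1)%R GammaS// Gamma1 mulr1.
have := @tpow_bessel_series R (fun=> phi_bessel 2) _ 2%R (3 / 2)%R (ltr0Sn _ _) h0 _ (eta ^+ 2)%R t e2.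
rewrite G2 mul1e => <-; last 2 first.
- by move=> _ k _; exact: phi_bessel_ge0.
- move=> k; rewrite rising_double divff ?pnatr_eq0// rising1 phi_bessel2.
  rewrite (_ : (2 + 1) / 2 = 3 / 2)%R; last by congr (_ / _)%R; ring.
  by rewrite divff// !mulf_neq0 ?expf_neq0 ?fact_neq0 ?gt_eqF ?rising_gt0.
have [t0|t0] := leP t 0%R.
  rewrite (tpow0 _ t0) mul0e; apply: integral0_eq => x _.
  rewrite /expo -EFinM; have [x0|x0] := leP x 0%R; first by rewrite (tpow0 _ x0) !mul0r.
  have tx : (t - x <= 0)%R by rewrite subr_le0 (le_trans t0)// ltW.
  by rewrite (tpow0 _ tx) mul0r mulr0.
pose H x : \bar R := expo eta x * expo (- eta)%R (t - x)%R.
have mH : measurable_fun setT H.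
  apply: emeasurable_funM; first exact: measurable_expo.
  by apply: (measurableT_comp (measurable_expo _)); meas.
have H0 x : 0 <= H x by apply: mule_ge0; exact: expo_ge0.
have th : (0 < t / 2)%R by rewrite divr_gt0.
rewrite /conv -/H -(ge0_integral_shift (t / 2) mH H0).
rewrite -(@ge0_integral_scale R (fun x => H (x + t / 2)%R) (t / 2)) ?gt_eqF//; last first.
  by apply: (measurableT_comp mH); meas.
have HE y : H ((t / 2) * y + t / 2)%R =
    (expR (dot (tup1 (eta * t)) (tup1 y)) * tpow 1 (1 - sqn (tup1 y)))%:E.
  rewrite /H /expo /sqn /dot !big_ord1 /= !tpow1E -EFinM.
  rewrite mulrACA -expRD -natrM mulnb (mulrC _%:R); congr (expR _ * _%:R)%:E.
    by rewrite /tnth/=; field.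
  rewrite /tnth/=; congr nat_of_bool.
  rewrite (_ : t / 2 * y + t / 2 = t / 2 * (1 + y))%R; last by ring.
  rewrite (_ : t - t / 2 * (1 + y) = t / 2 * (1 - y))%R; last by field.
  rewrite !pmulr_rgt0// (_ : 1 - y * y = (1 + y) * (1 - y))%R; last by ring.
  have [y1|y1] := ltP 0%R (1 + y)%R; first by rewrite pmulr_rgt0.
  apply/esym/negbTE; rewrite -leNgt mulr_le0_ge0//; lra.
under eq_integral do rewrite HE.
rewrite -(@integral_lebesgue_Rn1 R (fun x => (expR (dot (tup1 (eta * t)) x) * tpow 1 (1 - sqn x))%:E));
  [|by meas|by nn].
rewrite ball_mgf// Gamma1.
have h2 : (0 < 2^-1 :> R)%R by rewrite invr_gt0.
rewrite (_ : 1%:R / 2 + 1 = 2^-1 + 1)%R ?div1r// GammaS// Gamma_half.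
rewrite (_ : (2^-1 + 1 = 3 / 2 :> R)%R); last by field.
rewrite (_ : sqn _ = t ^+ 2 * eta ^+ 2)%R; last first.
  by rewrite /sqn /dot big_ord1 /tnth/=; ring.
rewrite muleA -EFinM; congr (_%:E * _).
rewrite gtr0_norm// tpowE// (_ : 2 - 1 = 1)%R; last by ring.
rewrite powRr1 ?(ltW t0)// expr1.
have : (0 < Num.sqrt pi :> R)%R by rewrite sqrtr_gt0 pi_gt0.
by move: (Num.sqrt pi) => s s0; field; rewrite gt_eqF.
Qed.

End TruncatedExponentials.

Section AlternatingExponentials.
Context (R : realType).
Local Open Scope ereal_scope.
Implicit Types (eta s t : R).

Definition alt_expo eta (k : nat) : R -> \bar R := expo ((-1) ^+ k * eta)%R.

Lemma alt_expo_ge0 eta k t : 0 <= alt_expo eta k t.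
Proof. exact: expo_ge0. Qed.

Lemma measurable_alt_expo eta k : measurable_fun setT (alt_expo eta k).
Proof. exact: measurable_expo. Qed.

Lemma convs_alt_expo_ge0 eta n t : 0 <= convs (alt_expo eta) n t.
Proof. by apply: convs_ge0 => k x; exact: alt_expo_ge0. Qed.

Lemma measurable_convs_alt_expo eta n : measurable_fun setT (convs (alt_expo eta) n).
Proof.
by apply: measurable_convs => k; [exact: alt_expo_ge0|exact: measurable_alt_expo].
Qed.

(** Associativity isolates the first two intertimes, which carry opposite exponents, and the signs
    repeat with period two. *)
Lemma convs_alt_expoS2 eta n t : convs (alt_expo eta) n.+2 t =
  conv (gseries (phi_bessel 2) 2 (eta ^+ 2)) (convs (alt_expo eta) n) t.
Proof.
rewrite [LHS]/=.
have -> : (fun k => alt_expo eta k.+2) = alt_expo eta.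
  by apply/funext => k; rewrite /alt_expo !exprS mulrA mulrNN !mul1r.
rewrite /alt_expo expr0 expr1 mul1r mulN1r -/(alt_expo eta) convA; last 6 first.
- exact: measurable_expo.
- exact: measurable_expo.
- exact: measurable_convs_alt_expo.
- exact: expo_ge0.
- exact: expo_ge0.
- by move=> x; exact: convs_alt_expo_ge0.
by congr (conv _ _ t); apply/funext => s; exact: conv_expo.
Qed.

Lemma half_addee (x : \bar R) : 0 <= x -> (2^-1)%:E * (x + x) = x.
Proof.
move=> x0; rewrite ge0_muleDr// -ge0_muleDl ?lee_fin ?invr_ge0//.
by rewrite -EFinD (_ : 2^-1 + 2^-1 = 1)%R ?mul1e//; field.
Qed.

Lemma conv_half_sum (f g h : R -> \bar R) t :
  measurable_fun setT f -> measurable_fun setT g -> measurable_fun setT h ->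
  (forall x, 0 <= f x) -> (forall x, 0 <= g x) -> (forall x, 0 <= h x) ->
  (2^-1)%:E * (conv f g t + conv f h t) =
  conv f (fun s => (2^-1)%:E * (g s + h s)) t.
Proof.
move=> mf mg mh f0 g0 h0; rewrite /conv.
have mt (k : R -> \bar R) : measurable_fun setT k -> measurable_fun setT (fun x : R => k (t - x)%R).
  by move=> mk; apply: (measurableT_comp mk); meas.
have mfk (k : R -> \bar R) : measurable_fun setT k ->
    measurable_fun setT (fun x : R => f x * k (t - x)%R).
  by move=> mk; apply: emeasurable_funM => //; exact: mt.
rewrite -ge0_integralD//; [|by nn|exact: mfk|by nn|exact: mfk].
rewrite -ge0_integralTZl//; [|by apply: emeasurable_funD; exact: mfk|by nn].
by apply: eq_integral => x _; rewrite -ge0_muleDr// muleCA.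
Qed.

(** Each pair of consecutive intertimes contributes a factor (1 - w)^-1 to the generating function.
    For even n the unpaired intertime contributes the same factor once averaged into cosh, so there
    are floor(n/2) + 1 factors in all; this is why the induction has step two. *)
Lemma mean_convs_alt_expo eta n t :
  (2^-1)%:E * (convs (alt_expo eta) n t + convs (alt_expo (- eta)) n t) =
  gseries (phi_bessel (2 * (n./2)%:R + 2)) n.+1%:R (eta ^+ 2) t.
Proof.
elim/ltn_ind: n t => -[|[|n]] ih t.
- by rewrite mulr0 add0r /= /alt_expo expr0 !mul1r expo_cosh.
- rewrite /= /alt_expo expr0 expr1 !mul1r !mulN1r conv_expo conv_expo sqrrN.
  rewrite mulr0 add0r half_addee// gseries_ge0// ?sqr_ge0// => k.
  exact: phi_bessel_ge0.
have p2 k : (0 <= phi_bessel 2 k :> R)%R by exact: phi_bessel_ge0.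
have pn k : (0 <= phi_bessel (2 * (n./2)%:R + 2) k :> R)%R.
  by apply: phi_bessel_ge0; rewrite ltr_wpDl// mulr_ge0.
rewrite !convs_alt_expoS2 sqrrN conv_half_sum; last 6 first.
- by apply: measurable_gseries => //; exact: sqr_ge0.
- exact: measurable_convs_alt_expo.
- exact: measurable_convs_alt_expo.
- by move=> x; apply: gseries_ge0 => //; exact: sqr_ge0.
- by move=> x; exact: convs_alt_expo_ge0.
- by move=> x; exact: convs_alt_expo_ge0.
rewrite (_ : (fun s => _) = gseries (phi_bessel (2 * (n./2)%:R + 2)) n.+1%:R (eta ^+ 2)).
  rewrite (conv_gseries _ p2 pn (ltr0Sn _ _) (ltr0Sn _ _) (sqr_ge0 eta)).
  have -> : cauchy_prod (phi_bessel 2) (phi_bessel (2 * (n./2)%:R + 2)) =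
      phi_bessel (2 * (n.+2./2)%:R + 2) :> (nat -> R).
    apply/funext => k; rewrite cauchy_phi_bessel; congr (phi_bessel _ k).
    by rewrite /= -natr1; ring.
  have -> : (2 + n.+1%:R = n.+3%:R :> R)%R by rewrite (_ : n.+3 = 2 + n.+1)%N// natrD.
  by [].
by apply/funext => s; rewrite ih.
Qed.

End AlternatingExponentials.

Section Telegraph.
Context (R : realType) (disp : measure_display) (T : measurableType disp)
  (P : probability T R).
Local Open Scope ereal_scope.

(** The two atoms already have total mass 1, so the complement of the two events is null. *)
Lemma expectation_rademacher (V : {RV P >-> R}) (h : R -> \bar R) :
  P (V @^-1` [set 1%R]) = (2^-1)%:E -> P (V @^-1` [set (-1)%R]) = (2^-1)%:E ->
  measurable_fun setT h -> (forall v, 0 <= h v) ->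
  \int[P]_w h (V w) = (2^-1)%:E * (h 1%R + h (-1)%R).
Proof.
move=> P1 PN1 mh h0; set A := V @^-1` _ in P1; set B := V @^-1` _ in PN1.
have mV : measurable_fun setT (V : T -> R) by exact: measurable_funPT.
have mA : measurable A by rewrite -[A]setTI; exact: mV.
have mB : measurable B by rewrite -[B]setTI; exact: mV.
have AB0 : [disjoint A & B].
  rewrite disj_set2E; apply/eqP/seteqP; split => // w [Aw Bw].
  have /eqP : (1 = -1 :> R)%R by have : V w = (-1)%R := Bw; rewrite (Aw : V w = 1%R).
  by rewrite -subr_eq0 opprK -(natrD _ 1 1) pnatr_eq0.
have mhV : measurable_fun setT (fun w => h (V w)) by exact: measurableT_comp.
have mAB : measurable (A `|` B) by exact: measurableU.
have PAB : P (A `|` B) = 1.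
  rewrite measureU//; last by apply/eqP; rewrite -disj_set2E.
  by rewrite [X in X + _]P1 [X in _ + X]PN1 -EFinD (_ : 2^-1 + 2^-1 = 1)%R//; field.
have PC : P (~` (A `|` B)) = 0 by rewrite probability_setC// PAB subee.
rewrite (ge0_negligible_integral (measurableC mAB) _ _ _ PC)// setTD setCK.
rewrite ge0_integral_setU//; last exact: measurable_funTS.
rewrite (eq_integral (cst (h 1%R))) => [|w /set_mem /= ->//].
rewrite (eq_integral (cst (h (-1)%R)) (fun w => h (V w))) => [|w /set_mem /= ->//].
by rewrite !integral_cst// [X in _ * X]P1 [X in _ + _ * X]PN1 -ge0_muleDl// muleC.
Qed.

(** The uniform law on the simplex is the Dirichlet law with a = 1, where Gamma(n + 1) = n! and the
    powers are trivial. *)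
Lemma f1E n (t : R) x : (0 < t)%R ->
  @f1 R n t x = (n`!%:R / t ^+ n * \prod_(k < n.+1) tpow 1 (intertime t x k))%R.
Proof.
move=> t0; have := dirichlet_pdfE 1 x t0; rewrite /dirichlet_pdf Gamma1 expr1n.
rewrite mulr1 subrr -natr1 addrK addrC rising_Gamma// rising1 Gamma1 powR_mulrn ?ltW//.
rewrite !mulr1 divr1 big1 => [|k _]; last exact: powRr0.
by rewrite mul1r /f1.
Qed.

Context (c : R) (n : nat) (t : R) (X : {RV P >-> 1.-tuple R}).
Hypotheses (t0 : (0 < t)%R) (telegraph : telegraph_position c t (@f1 R n t) X).

Lemma telegraph_mgf (xi : 1.-tuple R) :
  \int[P]_w (expR (dot xi (X w)))%:E =
  (n`!%:R / t ^+ n)%:E *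
    gseries (phi_bessel (2 * (n./2)%:R + 2)) n.+1%:R (c ^+ 2 * sqn xi) t.
Proof.
have [tau [V0 [tauf [P1 PN1] indVtau XE]]] := telegraph.
set eta := (c * tnth xi ord0)%R.
have eta2 : (c ^+ 2 * sqn xi = eta ^+ 2)%R.
  by rewrite /sqn /dot big_ord1 /eta; ring.
pose S (s : n.-tuple R) : R := (\sum_(k < n.+1) (-1) ^+ k * intertime t s k)%R.
have mS : measurable_fun setT S.
  by apply: measurable_sum => k; apply: measurable_funM => //; exact: measurable_intertime.
have mV : measurable_fun setT (V0 : T -> R) by exact: measurable_funPT.
have mtau : measurable_fun setT (tau : T -> n.-tuple R) by exact: measurable_funPT.
pose F (v : R) (s : n.-tuple R) : \bar R := (expR (eta * v * S s))%:E.
have mF : measurable_fun setT (fun z : R * n.-tuple R => F z.1 z.2).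
  apply/measurable_EFinP; apply: measurableT_comp; first exact: measurable_expR.
  apply: measurable_funM; last exact: (measurableT_comp mS measurable_snd).
  by apply: measurable_funM => //; exact: measurable_fst.
have F0 v s : 0 <= F v s by rewrite lee_fin expR_ge0.
transitivity (\int[P]_w F (V0 w) (tau w)).
  apply: eq_integral => w _; congr (expR _)%:E.
  rewrite XE /dot big_ord1 -[X in (_ * X)%R]/(c * V0 w * S (tau w))%R /eta.
  by move: (S _) => ?; ring.
rewrite (expectation_independent mV mtau indVtau mF F0).
(* The sign is averaged out first, with the intertimes frozen: the integrand becomes cosh, half the
   sum of the two alternating products with exponents eta and - eta. *)
pose h s : R := (2^-1 * (expR (eta * S s) + expR (- eta * S s)))%R.
transitivity (\int[P]_v (h (tau v))%:E).
  apply: eq_integral => v _; rewrite (expectation_rademacher P1 PN1 (h := F ^~ (tau v)))//.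
    by rewrite /F mulr1 mulrN1 -EFinD -EFinM.
  apply/measurable_EFinP; apply: measurableT_comp; first exact: measurable_expR.
  by apply: measurable_funM => //; apply: measurable_funM.
have mE (e : R) : measurable_fun setT (fun s => expR (e * S s)%R).
  by apply: measurableT_comp; [exact: measurable_expR|exact: measurable_funM].
rewrite (@expectation_density _ _ _ _ _ tau _ h tauf); last 2 first.
- by apply: measurable_funM => //; apply: measurable_funD; exact: mE.
- by move=> s; rewrite mulr_ge0 ?invr_ge0// addr_ge0 ?expR_ge0.
have alt e (s : n.-tuple R) : \prod_(k < n.+1) alt_expo e k (intertime t s k) =
    (\prod_(k < n.+1) tpow 1 (intertime t s k) * expR (e * S s))%:E.
  rewrite prodEFin big_split/= -expR_sum mulr_sumr; congr (_ * expR _)%:E.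
  by apply: eq_bigr => k _; rewrite mulrCA mulrA.
have nt0 : (0 <= n`!%:R / t ^+ n)%R by rewrite divr_ge0// exprn_ge0// ltW.
rewrite eta2 -mean_convs_alt_expo.
have convsE e : convs (alt_expo e) n t =
    \int[lebesgue_Rn n]_s \prod_(k < n.+1) alt_expo e k (intertime t s k).
  rewrite integral_intertimes//; first by move=> k x; exact: alt_expo_ge0.
  by move=> k; exact: measurable_alt_expo.
have malt e : measurable_fun setT
    (fun s : n.-tuple R => \prod_(k < n.+1) alt_expo e k (intertime t s k)).
  by apply: measurable_prod_intertimes => k; exact: measurable_alt_expo.
have alt0 e (s : n.-tuple R) : 0 <= \prod_(k < n.+1) alt_expo e k (intertime t s k).
  by apply: prode_ge0 => k _; exact: alt_expo_ge0.
have h12 : (0 <= 2^-1 :> R)%R by rewrite invr_ge0.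
rewrite !convsE -ge0_integralD//.
rewrite -ge0_integralTZl//; last by move=> s; exact: adde_ge0.
  rewrite -ge0_integralTZl//.
  - apply: eq_integral => s _; rewrite !alt f1E// -EFinD -!EFinM /h.
    by congr _%:E; ring.
  - by apply: emeasurable_funM => //; exact: emeasurable_funD.
  - by move=> s; apply: mule_ge0; [rewrite lee_fin|exact: adde_ge0].
exact: emeasurable_funD.
Qed.

(** Duplication splits (n + 1)_(2j) into two rising factorials. For n = 2k + 1 the numerator (k +
    1)_j cancels one, for n = 2k + 2 the numerator (k + 2)_j does; either way (k + 3/2)_j remains,
    that is 1/2 + p with p = k + 1, which is why two values of n share one m. *)
Lemma telegraph_density k : (0 < c)%R -> n = (2 * k + 1)%N \/ n = (2 * k + 2)%N ->
  has_density X (ball_density (t * c) (k%:R + 1)).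
Proof.
move=> c0 nk; apply: ball_density_of_mgf => [||xi].
- exact: mulr_gt0.
- by rewrite ltr_wpDl.
have z0 : (0 <= c ^+ 2 * sqn xi)%R by rewrite mulr_ge0 ?sqr_ge0 ?sqn_ge0.
have p0 : (0 < 2 * (n./2)%:R + 2 :> R)%R by rewrite ltr_wpDl// mulr_ge0.
rewrite telegraph_mgf.
have -> : (n`!%:R / t ^+ n = Gamma n.+1%:R / t `^ (n.+1%:R - 1))%R.
  by rewrite -natr1 addrK addrC rising_Gamma// rising1 Gamma1 mulr1 powR_mulrn// ltW.
rewrite gseries_normalized//; last by move=> j; exact: phi_bessel_ge0.
rewrite /bessel_series; apply: eq_eseriesr => j _.
rewrite mulrA -exprMn mulrC; congr (_ * _)%:E.
have r0 (x : R) : (0 < x)%R -> (rising x j != 0)%R by move=> x0; rewrite gt_eqF// rising_gt0.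
have f0 := fact_neq0 R j; have e0 : (4 ^+ j != 0 :> R)%R by rewrite expf_neq0.
rewrite rising_double /phi_bessel (_ : 1%:R / 2 + (k%:R + 1) = k%:R + 3 / 2)%R; last by field.
have k0 : (0 <= k%:R :> R)%R by [].
case: nk => ->.
  have -> : ((2 * k + 1)./2 = k)%N by rewrite mul2n addn1 /= uphalf_double.
  have -> : ((2 * k%:R + 2) / 2 = k%:R + 1 :> R)%R by field.
  have -> : ((2 * k + 1).+1%:R / 2 = k%:R + 1 :> R)%R by rewrite -natr1 natrD natrM; field.
  have -> : (((2 * k + 1).+1%:R + 1) / 2 = k%:R + 3 / 2 :> R)%R.
    by rewrite -natr1 natrD natrM; field.
  have := r0 (k%:R + 1)%R; have := r0 (k%:R + 3 / 2)%R.
  move: (rising _ _) (rising _ _) => a b a0 b0.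
  by field; rewrite e0 f0 a0 ?b0//; lra.
have -> : ((2 * k + 2)./2 = k.+1)%N by rewrite mul2n addn2 /= doubleK.
have -> : ((2 * k.+1%:R + 2) / 2 = k%:R + 2 :> R)%R by rewrite -natr1; field.
have -> : ((2 * k + 2).+1%:R / 2 = k%:R + 3 / 2 :> R)%R by rewrite -natr1 natrD natrM; field.
have -> : (((2 * k + 2).+1%:R + 1) / 2 = k%:R + 2 :> R)%R.
  by rewrite -natr1 natrD natrM; field.
have := r0 (k%:R + 2)%R; have := r0 (k%:R + 3 / 2)%R.
move: (rising _ _) (rising _ _) => a b a0 b0.
by field; rewrite e0 f0 a0 ?b0//; lra.
Qed.

End Telegraph.

(** * Matching the exponent of the density with n and m *)

Lemma has_density_kzb (R : realType) (disp : measure_display)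
    (T : measurableType disp) (P : probability T R) d (X : {RV P >-> d.-tuple R})
    (m p t : R) : 1 < m -> 0 < t -> p = m / (m - 1) ->
  has_density X (ball_density (t `^ kzb_beta d m * (1 / Num.sqrt (kzb_B d m))) p) ->
  has_density X (fun x => kzb m x t).
Proof.
move=> m1 t0 ->; rewrite (_ : (fun x => _) = ball_density
  (t `^ kzb_beta d m * (1 / Num.sqrt (kzb_B d m))) (m / (m - 1)))//.
by apply/funext => x; rewrite kzbE// div1r.
Qed.

Theorem theorem1 (R : realType) (disp : measure_display)
    (T : measurableType disp) (P : probability T R)
    (n : nat) (m : R) (hn : (1 <= n)%N) (hm : 1 < m) :
  [/\
    (* (i) *)
    forall (k : nat), (1 <= k)%N ->
      (n = (2 * k + 1)%N /\ m = (n%:R + 1) / (n%:R - 1)) \/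
      (n = (2 * k + 2)%N /\ m = n%:R / (n%:R - 2)) ->
      m = 1 + 1 / k%:R /\
      forall X : R -> {RV P >-> 1.-tuple R},
        (forall s : R, 0 < s ->
          telegraph_position (1 / Num.sqrt (kzb_B 1 m)) s (@f1 R n s) (X s)) ->
        forall t : R, 0 < t ->
          has_density (X (t `^ kzb_beta 1 m)) (fun x => kzb m x t),
    (* (ii) *)
    forall d : nat, (2 <= d)%N -> 2 / n%:R + 1 < d%:R :> R ->
      m = (n%:R * (d%:R - 1)) / (n%:R * (d%:R - 1) - 2) ->
      forall X : R -> {RV P >-> d.-tuple R},
        (forall s : R, 0 < s ->
          flight_position (1 / Num.sqrt (kzb_B d m)) s (@f2 R n s d) (X s)) ->
        forall t : R, 0 < t ->
          has_density (X (t `^ kzb_beta d m)) (fun x => kzb m x t)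
  & (* (iii) *)
    forall d : nat, (3 <= d)%N -> 2 / n%:R + 2 < d%:R :> R ->
      m = (n%:R * (d%:R - 2)) / (n%:R * (d%:R - 2) - 2) ->
      forall X : R -> {RV P >-> d.-tuple R},
        (forall s : R, 0 < s ->
          flight_position (1 / Num.sqrt (kzb_B d m)) s (@f3 R n s d) (X s)) ->
        forall t : R, 0 < t ->
          has_density (X (t `^ kzb_beta d m)) (fun x => kzb m x t)].
Proof.
have c0 d : 0 < 1 / Num.sqrt (kzb_B d m).
  by rewrite div1r invr_gt0 sqrtr_gt0 kzb_B_gt0.
have n0 : 0 < n%:R :> R by rewrite ltr0n.
(* With N = n (d - 1) or N = n (d - 2), the lower bound on d says N > 2, and the prescribed m is the
   one for which m / (m - 1) equals the exponent p = N / 2. *)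
have conjugate (N : R) : 2 < N -> m = N / (N - 2) -> N / 2 = m / (m - 1).
  by move=> N2 ->; field; rewrite subr_eq0 gt_eqF//; lra.
split.
- move=> k k1 nm; have k0 : 0 < k%:R :> R by rewrite ltr0n.
  have mE : m = 1 + 1 / k%:R.
    by case: nm => -[nE ->]; rewrite nE natrD natrM; field; rewrite !lt0r_neq0//; lra.
  split=> // X flight t t0; have s0 : 0 < t `^ kzb_beta 1 m by rewrite powR_gt0.
  (* For m = 1 + 1 / k the value of m / (m - 1) is k + 1. *)
  apply: (has_density_kzb (p := k%:R + 1)) => //.
    by rewrite mE; field; rewrite !lt0r_neq0//; lra.
  apply: (telegraph_density s0 (flight _ s0)) => //.
  by case: nm => -[nE _]; [left|right].
- move=> d d2 dn mE X flight t t0.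
  have s0 : 0 < t `^ kzb_beta d m by rewrite powR_gt0.
  apply: (has_density_kzb (p := n%:R * (d%:R - 1) / 2)) => //.
    apply: conjugate => //; rewrite -ltr_pdivrMl// mulrC; lra.
  by apply: (flight_f2_density _ _ s0 hn d2 (flight _ s0)) => //; exact: ltnW.
- move=> d d3 dn mE X flight t t0.
  have s0 : 0 < t `^ kzb_beta d m by rewrite powR_gt0.
  apply: (has_density_kzb (p := n%:R * (d%:R - 2) / 2)) => //.
    apply: conjugate => //; rewrite -ltr_pdivrMl// mulrC; lra.
  apply: (flight_f3_density _ _ s0 hn d3 (flight _ s0)) => //.
  exact: leq_trans d3.
Qed.
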